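(* Let $d\geq 2$ and let $1\leq \beta <d$ be fixed. Then for all $\alpha$ satisfying $0<\alpha< 1$ there exists a positive constant $\delta_{\alpha,d}$, depending only on $\alpha$ and $d$, such that for all $u_0 \in L^\infty(|x|\mathrm{d}x) \cap L^\infty(|x|^\beta\mathrm{d}x)$ (with values in $\mathbb{R}^d$) with $\operatorname{div}(u_0) = 0$ satisfying $$\sup_{x \in \mathbb{R}^d,\, t>0}|x|^\alpha t^{\frac{1}{2}(1-\alpha)}|(e^{t\Delta}u_0)(x)|\leq \delta_{\alpha,d},$$ the Navier-Stokes equations with initial datum $u_0$ have a global mild solution $u$ on $(0,\infty) \times \mathbb{R}^d$ such that $$\sup_{x \in \mathbb{R}^d,\, t>0}\big(|x|+t^{\frac{1}{2}}\big)|u(x,t)| <+\infty$$ and $$\sup_{x \in \mathbb{R}^d,\, 0<t<T}|x|^\beta|u(x,t)| <+\infty\quad\text{for all } T \in (0, \infty).$$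
   Context: For $\beta\geq 0$, $L^\infty(|x|^\beta\mathrm{d}x)$ denotes the space of measurable (scalar- or vector-valued) functions $u$ on $\mathbb{R}^d$ with $\|u\|_{L^\infty(|x|^\beta\mathrm{d}x)}:=\operatorname{ess\,sup}_{x\in\mathbb{R}^d}|x|^\beta|u(x)|<+\infty$. The heat semigroup is $e^{t\Delta}u=(4\pi t)^{-d/2}e^{-|\cdot|^2/(4t)}*u$. The Navier-Stokes equations are $\partial_t u=\Delta u-\nabla\cdot(u\otimes u)-\nabla p$, $\nabla\cdot u=0$, $u(0,x)=u_0$ on $\mathbb{R}^d$. A mild solution on the time interval from $0$ to $T$ ($T=\infty$ for a global one) with divergence-free initial datum $u_0$ is a function $u$ solving the integral equation $$u(t) = e^{t\Delta}u_0 - \int_{0}^{t} e^{(t-\tau) \Delta} \mathbb{P}\nabla\cdot\big(u(\tau)\otimes u(\tau)\big)\,\mathrm{d}\tau .$$ Here $(u\otimes v)_{ij}=u_iv_j$, $(\nabla\cdot F)_i=\sum_{j=1}^d\partial_jF_{ij}$ for a tensor $F=(F_{ij})$, and $\mathbb{P}$ is the Helmholtz-Leray projection $(\mathbb{P}f)_j=f_j+\sum_{k=1}^dR_jR_kf_k$ with $\widehat{R_jg}(\xi)=\frac{i\xi_j}{|\xi|}\hat g(\xi)$. The operator $e^{t\Delta}\mathbb{P}\nabla\cdot$ acts by convolution with its (integrable) kernel: its $j$-th component on $F$ is $\sum_{k,l}K^t_{jkl}*F_{kl}$ with $\widehat{K^t_{jkl}}(\xi)=(\delta_{jk}-\xi_j\xi_k/|\xi|^2)\,i\xi_l\,e^{-t|\xi|^2}$.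 *)

(* Defs.v *)
From HB Require Import structures.
From mathcomp Require Import all_boot all_order all_algebra.
From mathcomp Require Import complex.
From mathcomp Require Import all_classical all_reals all_analysis.
From mathcomp Require Import ess_sup_inf.

Set Implicit Arguments.
Unset Strict Implicit.
Unset Printing Implicit Defensive.

Import Order.TTheory GRing.Theory Num.Theory.
Import numFieldNormedType.Exports.

Local Open Scope classical_set_scope.
Local Open Scope ring_scope.

Definition measure_rV_display : measure_display.
Proof. exact: default_measure_display. Qed.

Section measurable_rV.
Context {R : realType} (n : nat).

Definition rV_coord (i : 'I_n) (x : 'rV[R]_n) : measurableTypeR R := x ord0 i.

(* Borel sigma-algebra of R^n, generated by the coordinates, as the library
   does for tuples. *)
HB.instance Definition _ := @isMeasurable.Build measure_rV_display 'rV[R]_n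
  (g_sigma_preimage rV_coord)
  (@sigma_algebra0 _ _ _) (@sigma_algebraC _ _)
  (@sigma_algebra_bigcup _ _ _).

Lemma measurable_rV_coord (i : 'I_n) :
  measurable_fun [set: 'rV[R]_n] (fun x : 'rV[R]_n => x ord0 i).
Proof.
move=> _ Y mY; rewrite setTI; apply: sub_sigma_algebra => /=.
rewrite -bigcup_seq/=; exists i => /=; first by rewrite mem_index_enum.
by exists Y => //; rewrite setTI.
Qed.

Lemma measurable_fun_rV d (T : measurableType d) (f : T -> 'rV[R]_n) :
  (forall i, measurable_fun [set: T] (fun t => f t ord0 i)) ->
  measurable_fun [set: T] f.
Proof.
move=> mf _ A mA; rewrite setTI.
have : preimage_set_system [set: T] f (g_sigma_preimage rV_coord) (f @^-1` A).
  by exists A => //; rewrite setTI.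
rewrite -g_sigma_preimage_comp; move: (f @^-1` A).
apply: smallest_sub; first exact: sigma_algebra_measurable.
rewrite -bigcup_seq; apply: bigcup_sub => i _ B [C mC <-].
exact: mf.
Qed.

End measurable_rV.

Section lebesgue_rV.
Context {R : realType}.
Local Open Scope ereal_scope.

Definition cons_rV n (p : measurableTypeR R * 'rV[R]_n) : 'rV[R]_n.+1 :=
  row_mx (p.1 : R)%:M p.2.

Lemma measurable_cons_rV n : measurable_fun [set: _] (@cons_rV n).
Proof.
apply: measurable_fun_rV => i; case: (@split_ordP 1 n i) => j ->.
  have -> : (fun p => @cons_rV n p ord0 (lshift n j)) = fst.
    by apply/funext => p; rewrite [LHS]row_mxEl mxE (ord1 j) eqxx.
  exact: measurable_fst.
have -> : (fun p => @cons_rV n p ord0 (rshift 1 j)) =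
    (fun x : 'rV[R]_n => x ord0 j) \o snd.
  by apply/funext => p; rewrite [LHS]row_mxEr.
by apply: measurableT_comp => //; exact: measurable_rV_coord.
Qed.

#[local] Hint Extern 0 (measurable_fun _ (@cons_rV _)) =>
  solve [apply: measurable_cons_rV] : core.

Section step.
Context {n : nat} (m : {sigma_finite_measure set 'rV[R]_n -> \bar R}).

Definition lebesgue_rV_step : set 'rV[R]_n.+1 -> \bar R :=
  pushforward (lebesgue_measure \x m) (@cons_rV n).

Let step0 : lebesgue_rV_step set0 = 0. Proof. exact: measure0. Qed.

Let step_ge0 A : 0 <= lebesgue_rV_step A. Proof. exact: measure_ge0. Qed.

Let step_sigma_additive : semi_sigma_additive lebesgue_rV_step.
Proof. exact: measure_semi_sigma_additive. Qed.

HB.instance Definition _ := isMeasure.Build _ _ _ lebesgue_rV_step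
  step0 step_ge0 step_sigma_additive.

Let step_sigma_finite : sigma_finite [set: 'rV[R]_n.+1] lebesgue_rV_step.
Proof.
have /sigma_finiteP[F [FT ndF mF]] := sigma_finiteT (@lebesgue_measure R).
have /sigma_finiteP[G [GT ndG mG]] := sigma_finiteT m.
pose g (x : 'rV[R]_(1 + n)) : measurableTypeR R * 'rV[R]_n :=
  (x ord0 (lshift n ord0), rsubmx x).
have mg : measurable_fun [set: _] g.
  apply/measurable_fun_pairP; split; first exact: measurable_rV_coord.
  apply: measurable_fun_rV => i.
  rewrite (_ : (fun t => _) = fun x : 'rV[R]_(1 + n) => x ord0 (rshift 1 i)).
    exact: measurable_rV_coord.
  by apply/funext => x; rewrite /= mxE.
have gK : cancel (@cons_rV n) g.
  move=> [x v]; rewrite /g /cons_rV row_mxKr; congr (_, _).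
  by rewrite row_mxEl mxE eqxx.
exists (fun k => g @^-1` (F k `*` G k)).
  rewrite -preimage_bigcup (_ : \bigcup_k _ = setT) ?preimage_setT//.
  apply/seteqP; split => // -[x v] _.
  have [i _ Fx] : (\bigcup_k F k) x by rewrite -FT.
  have [j _ Gv] : (\bigcup_k G k) v by rewrite -GT.
  exists (maxn i j) => //; split.
    by move: x Fx; exact/subsetPset/ndF/leq_maxl.
  by move: v Gv; exact/subsetPset/ndG/leq_maxr.
move=> k; have [mFk Fk] := mF k; have [mGk Gk] := mG k.
have mFG : measurable (F k `*` G k) by exact: measurableX.
split; first by rewrite -[X in measurable X]setTI; exact: mg.
rewrite /lebesgue_rV_step /pushforward -comp_preimage (_ : _ \o _ = id).
  by rewrite preimage_id product_measure1E// lte_mul_pinfty// ge0_fin_numE.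
by apply/funext => p /=; rewrite gK.
Qed.

HB.instance Definition _ := Measure_isSigmaFinite.Build _ _ _ lebesgue_rV_step
  step_sigma_finite.

End step.

Fixpoint lebesgue_rV n : {sigma_finite_measure set 'rV[R]_n -> \bar R} :=
  if n is n'.+1 then lebesgue_rV_step (lebesgue_rV n') else \d_(0%R : 'rV[R]_0).

Lemma lebesgue_rV_box n (A : 'I_n -> set (measurableTypeR R)) :
  (forall i, measurable (A i)) ->
  lebesgue_rV n [set x | forall i, A i (x ord0 i)] =
  \prod_(i < n) lebesgue_measure (A i).
Proof.
elim: n A => [|n IHn] A mA.
  by rewrite big_ord0 /= diracE mem_set// => -[].
pose B : set 'rV[R]_n := [set v | forall i, A (rshift 1 i) (v ord0 i)].
have mB : measurable B.
  rewrite (_ : B = \bigcap_(i in [set: 'I_n])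
      ((fun v : 'rV[R]_n => v ord0 i) @^-1` A (rshift 1 i))); last first.
    by apply/seteqP; split => [v Bv i _|v Bv i]; exact: Bv.
  apply: fin_bigcap_measurable => // i _.
  by have := measurable_rV_coord i measurableT (mA (rshift 1 i)); rewrite setTI.
rewrite big_ord_recl /= /lebesgue_rV_step /pushforward.
rewrite (_ : _ @^-1` _ = A ord0 `*` B).
  rewrite product_measure1E//; congr (_ * _).
  rewrite [LHS](IHn (fun i => A (rshift 1 i)))//.
  by apply: eq_bigr => i _; rewrite (_ : rshift 1 i = lift ord0 i)//; exact/val_inj.
apply/seteqP; split => [[x v]/= xvA|[x v] [/= Ax Bv] i].
  split=> [|i] /=.
    have := xvA ord0.
    have -> : ord0 = @lshift 1 n ord0 :> 'I_n.+1 by exact/val_inj.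
    by rewrite [X in A _ X]row_mxEl mxE eqxx.
  by have := xvA (rshift 1 i); rewrite [X in A _ X]row_mxEr.
case: (@split_ordP 1 n i) => j ->.
  rewrite [X in A _ X]row_mxEl mxE (ord1 j) eqxx.
  by have -> : @lshift 1 n ord0 = ord0 :> 'I_n.+1 by exact/val_inj.
by rewrite [X in A _ X]row_mxEr; exact: Bv.
Qed.

End lebesgue_rV.

Section euclidean_space.
Local Open Scope complex_scope.
Context {R : realType} {d : nat}.
Implicit Types (x y xi : 'rV[R]_d) (t : R).

Definition dotp x y : R := \sum_(i < d) x ord0 i * y ord0 i.

(* Euclidean length: the norm `|x| of the library on 'rV[R]_d is the sup
   norm. *)
Definition enorm x : R := Num.sqrt (dotp x x).

(* L^oo(|x|^beta dx), for vector-valued functions. *)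
Definition weighted_Linfty (beta : R) (u : 'rV[R]_d -> 'rV[R]_d) : Prop :=
  measurable_fun [set: 'rV[R]_d] u /\
  (ess_sup (lebesgue_rV d) (fun x => (enorm x `^ beta * enorm (u x))%:E)
    < +oo)%E.

Definition iter_partial (s : seq 'I_d) (phi : 'rV[R]_d -> R) : 'rV[R]_d -> R :=
  foldr (fun i f => 'D_(delta_mx ord0 i) f) phi s.

(* C^oo with compact support: differentiability of all the iterated partial
   derivatives includes their existence and continuity. *)
Definition test_function (phi : 'rV[R]_d -> R) : Prop :=
  (forall s x, differentiable (iter_partial s phi) x) /\
  compact (closure [set x | phi x != 0]).

(* div u = 0 in the sense of distributions, for a locally integrable u; the
   elements of L^oo(|x|dx) are locally integrable when d >= 2. *)
Definition divergence_free (u : 'rV[R]_d -> 'rV[R]_d) : Prop :=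
  forall phi, test_function phi ->
    \int[lebesgue_rV d]_x
      (\sum_(i < d) u x ord0 i * 'D_(delta_mx ord0 i) phi x) = 0.

Definition time_interval (T : \bar R) : set R :=
  [set t : R | 0 < t /\ (t%:E < T)%E].

Definition space_time_sup (T : \bar R) (f : R -> 'rV[R]_d -> R) : \bar R :=
  ereal_sup [set (f t x)%:E | t in time_interval T & x in [set: 'rV[R]_d]].

Definition heat_kernel t x : R :=
  (4 * pi * t) `^ (- (d%:R / 2)) * expR (- (enorm x ^+ 2 / (4 * t))).

Definition heat t (u : 'rV[R]_d -> 'rV[R]_d) x : 'rV[R]_d :=
  \row_(j < d) \int[lebesgue_rV d]_y (heat_kernel t (x - y) * u y ord0 j).

Definition expi (a : R) : R[i] := cos a +i* sin a.

(* Inverse of the Fourier transform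
   f |-> (xi |-> \int f(x) exp(- i x.xi) dx), for which d/dx_l is multiplication
   by i xi_l and convolution is sent to the product. *)
Definition inverse_fourier (m : 'rV[R]_d -> R[i]) x : R[i] :=
  let f xi := expi (dotp x xi) * m xi in
  (((2 * pi) ^+ d)^-1)%:C *
  ((\int[lebesgue_rV d]_xi complex.Re (f xi)) +i*
   (\int[lebesgue_rV d]_xi complex.Im (f xi))).

Definition oseen_symbol t (j k l : 'I_d) xi : R[i] :=
  ((j == k)%:R - xi ord0 j * xi ord0 k / enorm xi ^+ 2)%:C *
  (0 +i* xi ord0 l) * (expR (- (t * enorm xi ^+ 2)))%:C.

(* The symbol is integrable (t > 0), odd and purely imaginary, so its inverse
   Fourier transform is real-valued. *)
Definition oseen_kernel t (j k l : 'I_d) x : R :=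
  complex.Re (inverse_fourier (oseen_symbol t j k l) x).

Definition tensor (u v : 'rV[R]_d -> 'rV[R]_d) x : 'M[R]_d :=
  \matrix_(i < d, j < d) (u x ord0 i * v x ord0 j).

(* The operator e^{t Delta} P div, P the Helmholtz-Leray projection, on
   tensor fields. *)
Definition heat_leray_div t (F : 'rV[R]_d -> 'M[R]_d) x : 'rV[R]_d :=
  \row_(j < d) \sum_(k < d) \sum_(l < d)
    \int[lebesgue_rV d]_y (oseen_kernel t j k l (x - y) * F y k l).

(* Mild solution on (0, T) x R^d. The integral equation holds at every (t, x);
   the Duhamel term is required to converge absolutely, since an integral that
   diverges has an arbitrary value in the library. *)
Definition mild_solution (T : \bar R) (u0 : 'rV[R]_d -> 'rV[R]_d)
    (u : R -> 'rV[R]_d -> 'rV[R]_d) : Prop :=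
  measurable_fun (time_interval T `*` [set: 'rV[R]_d])
    (fun p : R * 'rV[R]_d => u p.1 p.2) /\
  forall t x, time_interval T t ->
    (forall j k l,
      (lebesgue_measure \x lebesgue_rV d)%E.-integrable
        (`]0, t[ `*` [set: 'rV[R]_d])
        (fun p => (oseen_kernel (t - p.1) j k l (x - p.2) *
                   tensor (u p.1) (u p.1) p.2 k l)%:E)) /\
    u t x = heat t u0 x -
      \row_(j < d) \int[lebesgue_measure]_(tau in `]0, t[)
        heat_leray_div (t - tau) (tensor (u tau) (u tau)) x ord0 j.

End euclidean_space.

(* Main.v *)
From HB Require Import structures.
Require Import Defs.
From mathcomp Require Import all_boot all_order all_algebra.
From mathcomp Require Import all_classical all_reals all_analysis.
From mathcomp Require Import complex ess_sup_inf measurable_realfun.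
From mathcomp Require Import ring lra.

(** Write N for the l^1 norm and majorant r x = r^(1/2) (r + N x)^-(d + 1/2).
The kernel of e^(t Delta) P div is bounded by C t^(-1/2) majorant (sqrt t): its
symbol is a Gaussian moment minus a singular term, and the singularity is
removed by writing e^(-t|xi|^2)/|xi|^2 as the integral over rho > sqrt t of
2 rho e^(-rho^2 |xi|^2); the decay of the oscillating Gaussian moments comes
from integrations by parts in each variable. Convolution with majorant r maps
N^-g to max(r, N)^-g for 0 <= g < d, so the Duhamel integral of a tensor bounded
by s^-k N^-g is at most C t^(1/2 - (g-g')/2 - k) N^-g' for g' <= g close to g.

The Picard iterates from 0 then satisfy three bounds: N^alpha t^((1-alpha)/2) |u|
stays below a small eta, which makes the map a contraction for the norm
sup (N + sqrt t) |u|; this norm stays bounded; and N^beta |u| <= A e^(lam t) on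
(0, T) for lam large, because e^(-lam (t-s)) <= (lam (t-s))^(-1/4) gains a small
factor in the Duhamel integral. *)

Set Implicit Arguments.
Unset Strict Implicit.
Unset Printing Implicit Defensive.

Import Order.TTheory GRing.Theory Num.Theory.
Import numFieldNormedType.Exports.

Local Open Scope classical_set_scope.
Local Open Scope ring_scope.

(** * Integration over row vectors *)

Section rV_integral.
Context {R : realType}.
Local Open Scope ereal_scope.

(** In the fixed point argument every product keeps at least one subcritical factor. That factor
    carries the only smallness that is assumed, and it leaves N^-(1+alpha), or N^-alpha
    s^-(1-alpha/2), which are integrable because alpha < 1 and d >= 2; by contrast N^-2 is not
    locally integrable in the plane and s^-1 is not integrable at 0. The threshold eta comes from
    the constants of the Duhamel operator for exponents built from alpha, before beta, u_0 and the
    size M of the critical norm are chosen; hence delta depends on alpha and d only.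

    The weight beta is not part of the contraction: N^-1 N^-beta is too singular at the origin when
    beta + 1 >= d. The bound is propagated along the iterates instead. Inside the unit ball the
    other two bounds are used; outside it one factor is at most M and the estimate is linear in the
    other, so a large lam replaces smallness.

    Real powers with negative exponent take the value 0 at 0, so bounds by N^-g can fail at the
    origin. They are stated where N > 0, and the coordinate hyperplanes are discarded as a null
    set. *)

Lemma ge0_integral_lebesgue_rVS n (f : 'rV[R]_n.+1 -> \bar R) :
  measurable_fun [set: 'rV[R]_n.+1] f -> (forall x, 0 <= f x) ->
  \int[@lebesgue_rV R n.+1]_x f x =
  \int[lebesgue_measure]_a \int[@lebesgue_rV R n]_v f (cons_rV (a, v)).
Proof.
move=> mf f0.
rewrite [LHS](@ge0_integral_pushforward _ _ _ _ R (@cons_rV R n)) //; last exact: measurable_cons_rV.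
rewrite preimage_setT fubini_tonelli1//.
  by apply: measurableT_comp => //; exact: measurable_cons_rV.
by move=> x; exact: f0.
Qed.

Lemma integrable_lebesgue_rVS n (f : 'rV[R]_n.+1 -> \bar R) :
  (@lebesgue_rV R n.+1).-integrable [set: 'rV[R]_n.+1] f ->
  (lebesgue_measure \x @lebesgue_rV R n).-integrable [set: _] (f \o @cons_rV R n).
Proof.
move=> /integrableP[mf foo].
have mc := @measurable_cons_rV R n.
apply/integrableP; split; first exact: measurableT_comp.
rewrite fubini_tonelli1//; last first.
  by apply: measurableT_comp => //; exact: measurableT_comp.
by rewrite ge0_integral_lebesgue_rVS// in foo; exact: measurableT_comp.
Qed.

Lemma integral_lebesgue_rVS n (f : 'rV[R]_n.+1 -> \bar R) :
  (@lebesgue_rV R n.+1).-integrable [set: 'rV[R]_n.+1] f ->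
  \int[@lebesgue_rV R n.+1]_x f x =
  \int[lebesgue_measure]_a \int[@lebesgue_rV R n]_v f (cons_rV (a, v)).
Proof.
move=> intf; have intfc := integrable_lebesgue_rVS intf.
have mc := @measurable_cons_rV R n.
rewrite [LHS](@integral_pushforward _ _ _ _ R (@cons_rV R n) mc (lebesgue_measure \x @lebesgue_rV R n)%E setT f) //.
  by rewrite preimage_setT -integral12_prod_meas1.
exact: (measurable_int _ intf).
Qed.

Lemma cons_rV0 n (p : R * 'rV[R]_n) : cons_rV p ord0 ord0 = p.1.
Proof.
rewrite /cons_rV (_ : ord0 = @lshift 1 n ord0); last exact/val_inj.
by rewrite [LHS]row_mxEl mxE eqxx.
Qed.

Lemma cons_rVS n (p : R * 'rV[R]_n) i : cons_rV p ord0 (lift ord0 i) = p.2 ord0 i.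
Proof.
rewrite /cons_rV (_ : lift ord0 i = @rshift 1 n i); last exact/val_inj.
by rewrite [LHS]row_mxEr.
Qed.

Lemma measurable_prod_rV n (f : 'I_n -> R -> R) :
  (forall i, measurable_fun [set: R] (f i)) ->
  measurable_fun [set: 'rV[R]_n] (fun x => \prod_(i < n) f i (x ord0 i))%R.
Proof.
move=> mf; apply: measurable_prod => i _.
by apply: measurableT_comp => //; exact: measurable_rV_coord.
Qed.

Lemma ge0_integral_prod_rV n (f : 'I_n -> R -> R) :
  (forall i, measurable_fun [set: R] (f i)) -> (forall i x, (0 <= f i x)%R) ->
  \int[@lebesgue_rV R n]_x (\prod_(i < n) f i (x ord0 i))%:E =
  \prod_(i < n) \int[lebesgue_measure]_a (f i a)%:E.
Proof.
elim: n f => [|n IH] f mf f0.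
  under eq_integral do rewrite big_ord0.
  by rewrite [LHS](integral_cst _ measurableT 1) /= diracE in_setT mule1 big_ord0.
rewrite ge0_integral_lebesgue_rVS; first last.
- by move=> x; rewrite lee_fin; exact: prodr_ge0.
- by apply/measurable_EFinP; exact: measurable_prod_rV.
under eq_integral => a _.
  under eq_integral => v _.
    rewrite big_ord_recl cons_rV0 /=; under eq_bigr do rewrite cons_rVS.
    rewrite EFinM; over.
  rewrite /= ge0_integralZl//; first last.
  - by rewrite lee_fin.
  - by move=> v _; rewrite lee_fin prodr_ge0.
  - by apply/measurable_EFinP; exact: (@measurable_prod_rV n (fun i => f (lift ord0 i))).
  rewrite (IH (fun i => f (lift ord0 i)))//; over.
rewrite /= ge0_integralZr// ?big_ord_recl//.
- by apply/measurable_EFinP; exact: mf.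
- by move=> x _; rewrite lee_fin.
- by apply: prode_ge0 => i _; apply: integral_ge0 => x _; rewrite lee_fin.
Qed.

(** Pointwise bounds by negative powers of the coordinates, or of their l^1 norm, fail where the
    base vanishes, since such a power is then 0 by convention. This null set is removed before
    integrating. *)
Lemma ae_coord_neq0 n :
  {ae @lebesgue_rV R n, forall x : 'rV[R]_n, forall i, x ord0 i != 0%R}.
Proof.
suff : {ae @lebesgue_rV R n, forall x : 'rV[R]_n, forall k, forall kn : (k < n)%N,
    x ord0 (Ordinal kn) != 0%R}.
  by apply: filterS => x H [i ilt]; exact: H.
apply: ae_foralln => k.
have [kn|nk] : (k < n)%N \/ ~ (k < n)%N by case: (k < n)%N; [left|right].
  2: by apply: aeW => x kn; case: nk.
pose A (i : 'I_n) : set (measurableTypeR R) := if i == Ordinal kn then [set 0%R] else setT.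
have mA i : measurable (A i) by rewrite /A; case: ifP => _ //; exact: measurable_set1.
exists [set x : 'rV[R]_n | forall i, A i (x ord0 i)]; split.
- rewrite (_ : mkset _ = (fun x : 'rV[R]_n => x ord0 (Ordinal kn)) @^-1` [set 0%R]).
    have := @measurable_rV_coord R n (Ordinal kn) measurableT [set 0%R] (measurable_set1 _).
    by rewrite setTI.
  apply/seteqP; split => [x /(_ (Ordinal kn))|x /= x0 i]; rewrite /A ?eqxx//.
  by case: eqP => // ->.
(* The hyperplane is a box with one side of measure 0 and the others of infinite measure; the
   convention 0 * oo = 0 gives it measure 0. *)
- apply: (eq_trans (lebesgue_rV_box mA)); rewrite (bigD1 (Ordinal kn))//= {1}/A eqxx lebesgue_measure_set1.
  by rewrite mul0e.
- move=> x /= H i; rewrite /A; case: eqP => // -> /=.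
  apply/eqP; rewrite -[_ == _]negbK; apply/negP => H'; apply: H => kn'.
  by rewrite (_ : Ordinal kn' = Ordinal kn)//; exact/val_inj.
Qed.

End rV_integral.

(** * Bounds, measurability and Fubini for real-valued integrals *)

Section integral_bounds.
Context {R : realType}.
Local Open Scope ereal_scope.

Lemma le_integrable_bound d (T : measurableType d) (mu : {measure set T -> \bar R})
    (D : set T) (f : T -> R) (c : R) : measurable D -> measurable_fun D f ->
  \int[mu]_(x in D) `|f x|%:E <= c%:E -> mu.-integrable D (EFin \o f).
Proof.
move=> mD mf fc; apply/integrableP; split; first exact/measurable_EFinP.
exact: (le_lt_trans fc (ltry _)).
Qed.

Lemma normr_Rintegral_le d (T : measurableType d) (mu : {measure set T -> \bar R})
    (D : set T) (f : T -> R) (c : R) : measurable D -> measurable_fun D f ->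
  \int[mu]_(x in D) `|f x|%:E <= c%:E ->
  (`|\int[mu]_(x in D) f x| <= c)%R.
Proof.
move=> mD mf fc; rewrite -lee_fin EFin_normr_Rintegral//.
  by apply: le_trans fc; apply: le_abse_integral => //; exact/measurable_EFinP.
exact: le_integrable_bound fc.
Qed.

(** Tonelli applies separately to the positive and the negative part; divergent values merely pass
    through the measurable map [fine]. *)
Lemma measurable_Rintegral_param d1 d2 (T1 : measurableType d1)
    (T2 : measurableType d2) (m2 : {sigma_finite_measure set T2 -> \bar R})
    (f : T1 * T2 -> R) : measurable_fun [set: T1 * T2] f ->
  measurable_fun [set: T1] (fun x => \int[m2]_y f (x, y))%R.
Proof.
move=> mf; apply: measurableT_comp => //.
have mF : measurable_fun [set: T1 * T2] (EFin \o f) by exact/measurable_EFinP.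
under eq_fun do rewrite integralE.
apply: emeasurable_funB.
- rewrite [X in measurable_fun _ X](_ : _ = fun x => \int[m2]_y (EFin \o f)^\+ (x, y)).
    apply: (measurable_fun_fubini_tonelli_F (EFin \o f)^\+) => //.
    exact: measurable_funepos.
  by apply/funext => x; apply: eq_integral => y _; rewrite !funeposE.
- rewrite [X in measurable_fun _ X](_ : _ = fun x => \int[m2]_y (EFin \o f)^\- (x, y)).
    apply: (measurable_fun_fubini_tonelli_F (EFin \o f)^\-) => //.
    exact: measurable_funeneg.
  by apply/funext => x; apply: eq_integral => y _; rewrite !funenegE.
Qed.

End integral_bounds.

Section product_sigma_finite.
Context {R : realType} d1 d2 (T1 : measurableType d1) (T2 : measurableType d2).
Variables (m1 : {sigma_finite_measure set T1 -> \bar R})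
          (m2 : {sigma_finite_measure set T2 -> \bar R}).
Local Open Scope ereal_scope.

Lemma product_measure1_sigma_finite : sigma_finite [set: T1 * T2] (m1 \x m2).
Proof.
have /sigma_finiteP[F [FT ndF mF]] := sigma_finiteT m1.
have /sigma_finiteP[G [GT ndG mG]] := sigma_finiteT m2.
exists (fun k => F k `*` G k).
  apply/seteqP; split => // -[x v] _.
  have [i _ Fx] : (\bigcup_k F k) x by rewrite -FT.
  have [j _ Gv] : (\bigcup_k G k) v by rewrite -GT.
  exists (maxn i j) => //; split.
    by move: x Fx; exact/subsetPset/ndF/leq_maxl.
  by move: v Gv; exact/subsetPset/ndG/leq_maxr.
move=> k; have [mFk Fk] := mF k; have [mGk Gk] := mG k; split; first exact: measurableX.
by rewrite product_measure1E// lte_mul_pinfty// ge0_fin_numE.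
Qed.

End product_sigma_finite.

Section real_integrals.
Context {R : realType}.

(** Serves the space-time measure, a product whose sigma-finiteness is a lemma; the corresponding
    structure is packed on the spot. *)
Lemma measurable_Rintegral_sigma_finite d1 d2 (T1 : measurableType d1)
    (T2 : measurableType d2) (m2 : {measure set T2 -> \bar R}) (f : T1 * T2 -> R) :
  sigma_finite [set: T2] m2 -> measurable_fun [set: T1 * T2] f ->
  measurable_fun [set: T1] (fun z => \int[m2]_w f (z, w)).
Proof.
move=> sm2.
pose H1 := @isSFinite.Build _ T2 R (Measure.sort m2) (sfinite_measure_sigma_finite sm2).
pose H2 := @isSigmaFinite.Build _ T2 R (Measure.sort m2) sm2.
pose m : {sigma_finite_measure set T2 -> \bar R} :=
  HB.pack_for (SigmaFiniteMeasure.type T2 R) (Measure.sort m2) H1 H2.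
exact: (@measurable_Rintegral_param R _ _ _ _ m).
Qed.

Lemma ler_norm_sum1 (I : finType) (c : I -> R) (b : R) :
  (forall i, `|c i| <= b) -> `|\sum_i c i| <= #|I|%:R * b.
Proof.
move=> h; rewrite mulr_natl -sumr_const.
have h1 := @ler_norm_sum R R I (index_enum I) c predT.
have h2 := @ler_sum R I (index_enum I) predT (fun i => `|c i|) (fun=> b) (fun i _ => h i).
exact: (@le_trans _ R _ _ _ h1 h2).
Qed.

Lemma Rintegral_sum d' (T : measurableType d') (m : {measure set T -> \bar R}) (I : Type) (D : set T)
    (s : seq I) (f : I -> T -> R) : measurable D ->
  (forall i, m.-integrable D (EFin \o f i)) ->
  m.-integrable D (EFin \o (fun z => \sum_(i <- s) f i z)) /\
  \int[m]_(z in D) \sum_(i <- s) f i z = \sum_(i <- s) \int[m]_(z in D) f i z.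
Proof.
move=> mD fi; elim: s => [|i s [IH1 IH2]].
  under [in X in _ /\ X]eq_Rintegral do rewrite big_nil.
  rewrite big_nil /Rintegral integral0; split => //.
  by rewrite [X in _.-integrable _ X](_ : _ = cst 0%E); [exact: integrable0|apply/funext => z /=; rewrite big_nil].
have e : (fun z => \sum_(i <- i :: s) f i z) = (fun z => f i z + \sum_(i <- s) f i z).
  by apply/funext => z; rewrite big_cons.
rewrite e big_cons RintegralD// IH2; split => //.
have h := integrableD mD (fi i) IH1.
by apply: eq_integrable h.
Qed.

Lemma Rintegral_setX d1 d2 (T1 : measurableType d1) (T2 : measurableType d2)
    (m1 : {sigma_finite_measure set T1 -> \bar R}) (m2 : {sigma_finite_measure set T2 -> \bar R})
    (D : set T1) (f : T1 * T2 -> R) : measurable D ->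
  (m1 \x m2)%E.-integrable (D `*` setT) (EFin \o f) ->
  m1.-integrable D (EFin \o (fun z => \int[m2]_w f (z, w))) /\
  \int[m1]_(z in D) \int[m2]_w f (z, w) = \int[(m1 \x m2)%E]_(p in D `*` setT) f p.
Proof.
move=> mD fi; have mDT : measurable (D `*` [set: T2]) by exact: measurableX.
pose g := (EFin \o f) \_ (D `*` setT).
have gi : (m1 \x m2)%E.-integrable setT g by exact: (iffLR (integrable_mkcond _ mDT) fi).
have Fi := integrable_fubini_F gi; have gE := integral12_prod_meas1 gi.
have FE z : D z -> fubini_F m2 g z = (\int[m2]_w (f (z, w))%:E)%E.
  move=> Dz; rewrite /fubini_F; apply: eq_integral => w _.
  by rewrite /g patchE mem_set.
have F0 z : ~ D z -> fubini_F m2 g z = 0%E.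
  move=> Dz; rewrite /fubini_F; under eq_integral => w _.
    rewrite /g patchE memNset; last by move=> [].
    over.
  by rewrite integral0.
have FD : fubini_F m2 g = (fubini_F m2 g) \_ D.
  apply/funext => z; rewrite patchE; case: ifPn => // /negP; rewrite inE; exact: F0.
have FiD : m1.-integrable D (fubini_F m2 g) by exact: integrableS Fi.
have Fae := integrable_ae mD FiD.
(* The real inner integral is 0 where the extended one is infinite, so the two agree only almost
   everywhere; integrability makes the exceptional set null. *)
have ae : ae_eq m1 D (EFin \o (fun z => \int[m2]_w f (z, w))) (fubini_F m2 g).
  by apply: filterS Fae => z h Dz /=; have := h Dz; rewrite FE// /Rintegral => /fineK.
have mF := measurable_int _ FiD.
have mf : measurable_fun D (EFin \o (fun z => \int[m2]_w f (z, w))).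
  apply/measurable_EFinP; rewrite /Rintegral.
  apply: (eq_measurable_fun (fine \o fubini_F m2 g)).
    by move=> z /set_mem Dz /=; rewrite FE.
  by apply: measurableT_comp => //.
split.
  apply: (le_integrable mD mf _ FiD) => z Dz /=.
  by rewrite FE// /Rintegral; case: (integral _ _ _) => [r| |] /=; rewrite ?normr0 ?leey.
have e := ae_eq_integral _ _ mD mF mf (ae_eq_sym ae).
rewrite [LHS]/Rintegral -e.
rewrite [RHS](_ : _ = fine (\int[(m1 \x m2)%E]_p g p)%E); last by rewrite /g -integral_mkcond.
by rewrite -gE [in RHS]FD -integral_mkcond.
Qed.

End real_integrals.

Section measurability.
Context {R : realType} d (T : measurableType d).
Implicit Types f g : T -> R.

Lemma measurable_fun_powR f (p : R) : measurable_fun [set: T] f ->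
  measurable_fun [set: T] (fun x => f x `^ p).
Proof. exact: (@measurableT_comp _ _ _ _ _ _ (@powR R ^~ p)). Qed.

Lemma measurable_fun_norm f : measurable_fun [set: T] f ->
  measurable_fun [set: T] (fun x => `|f x|).
Proof. exact: (@measurableT_comp _ _ _ _ _ _ (@Num.norm R R)). Qed.

Lemma measurable_fun_ltb f g : measurable_fun [set: T] f ->
  measurable_fun [set: T] g -> measurable_fun [set: T] (fun x => (f x < g x)%R%:R : R).
Proof.
move=> mf mg.
apply: (@measurableT_comp _ _ _ _ _ _ (fun b : bool => b%:R : R) _ (fun x => (f x < g x)%R)) => //.
exact: measurable_fun_ltr.
Qed.

End measurability.

(** * Power integrals on the real line *)

Section one_dimensional_integrals.
Context {R : realType}.
Local Notation mu := (@lebesgue_measure R).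

(** Uniqueness of the Lebesgue measure: the preimage of []a, b]] under the reflection is [[c - b, c
    - a[], of the same length, so the push-forward is the measure itself. *)
Lemma integral_lebesgue_reflect (f : R -> \bar R) (c : R) :
  measurable_fun [set: R] f -> (forall x, 0 <= f x)%E ->
  (\int[mu]_x f (c - x)%R = \int[mu]_x f x)%E.
Proof.
move=> mf f0.
have mr : measurable_fun [set: measurableTypeR R] (fun x : R => c - x : measurableTypeR R).
  exact: measurable_funB.
have E A : measurable A -> mu A = pushforward mu (fun x : R => c - x : measurableTypeR R) A.
  move=> mA; apply: lebesgue_measure_unique => //= _ [[a b]] _ <-.
  rewrite /pushforward (_ : _ @^-1` _ = `[c - b, c - a[%classic).
    rewrite !lebesgue_measure_itv/= !lte_fin.
    rewrite (_ : (c - b < c - a) = (a < b)); last by apply/idP/idP; lra.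
    by case: ifP => // _; congr (_%:E); ring.
  by apply/seteqP; split => x /=; rewrite !in_itv/=; lra.
rewrite [RHS](eq_measure_integral (pushforward mu (fun x : R => c - x : measurableTypeR R))).
  by rewrite (@ge0_integral_pushforward _ _ _ _ R _ mr) //= preimage_setT.
by move=> A mA _; exact: E.
Qed.

(** The part of a power singularity inside a ball; with exponent [a = 0] it is the indicator of the
    ball. *)
Definition cut_powR (a rho z : R) : R := `|z| `^ (- a) * (`|z| < rho)%R%:R.

Lemma measurable_cut_powR a rho : measurable_fun [set: R] (cut_powR a rho).
Proof.
apply: measurable_funM.
  by apply: measurable_fun_powR; exact: measurable_fun_norm.
by apply: measurable_fun_ltb => //; exact: measurable_fun_norm.
Qed.

Lemma cut_powR_ge0 a rho z : 0 <= cut_powR a rho z.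
Proof. by rewrite mulr_ge0// powR_ge0. Qed.

Lemma integral_powR_itv (a eta rho : R) : a < 1 -> 0 < eta -> eta < rho ->
  (\int[mu]_(z in `[eta, rho]) (z `^ (- a))%:E <= (rho `^ (1 - a) / (1 - a))%:E)%E.
Proof.
move=> a1 eta0 er.
have pos (z : R) : eta <= z -> 0 < z by move=> ?; exact: lt_le_trans eta0 _.
pose F z := z `^ (1 - a) / (1 - a).
have dF (z : R) : 0 < z -> is_derive z 1 F (z `^ (- a)).
  move=> z0; rewrite /F.
  have -> : z `^ (- a) = (1 - a)^-1 *: ((1 - a) * z `^ (1 - a - 1)).
    by rewrite scalerAl [_ *: _]mulVf ?mul1r; [congr (_ `^ _); ring|lra].
  have -> : (fun z : R => z `^ (1 - a) / (1 - a)) = (1 - a)^-1 \*: (fun x : R => x `^ (1 - a)).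
    by apply/funext => x /=; rewrite [_ *: _]mulrC.
  by apply: is_deriveZ; exact: is_derive1_powR.
have cF (z : R) : 0 < z -> {for z, continuous F}.
  by move=> z0; apply/differentiable_continuous/derivable1_diffP; exact: (@ex_derive _ _ _ _ _ _ _ (dF z z0)).
rewrite (@continuous_FTC2 _ _ F)//.
- rewrite -EFinB lee_fin lerBlDr lerDl.
  by rewrite divr_ge0 ?powR_ge0// subr_ge0 ltW.
- apply: derivable_within_continuous => z; rewrite in_itv/= => /andP[ez _].
  by apply: ex_derive; apply: is_derive1_powR; exact: pos.
- split.
  + move=> z; rewrite in_itv/= => /andP[/ltW/pos z0 _].
    exact: (@ex_derive _ _ _ _ _ _ _ (dF z z0)).
  + by apply: cvg_at_right_filter; exact: cF.
  + by apply: cvg_at_left_filter; apply: cF; exact: lt_trans er.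
- move=> z; rewrite in_itv/= => /andP[/ltW/pos z0 _].
  by rewrite derive1E; exact: (@derive_val _ _ _ _ _ _ _ (dF z z0)).
Qed.

Lemma integral_powR_itv0 (a rho : R) : a < 1 -> 0 < rho ->
  (\int[mu]_(z in `[0%R, rho]) (z `^ (- a))%:E <= (rho `^ (1 - a) / (1 - a))%:E)%E.
Proof.
move=> a1 rho0.
have mp (D : set R) : measurable_fun D (fun z : R => z `^ (- a)).
  by apply: measurable_funTS; exact: measurable_fun_powR.
rewrite -integral_itv_obnd_cbnd//; last by apply/measurable_EFinP; exact: mp.
(* The intervals stay away from the singularity. With [n.+2] the left end is strictly below [rho]
   already for [n = 0], as the fundamental theorem of calculus requires. *)
pose F n : set R := `[rho / n.+2%:R, rho]%classic.
have FE : `]0, rho]%classic = \bigcup_n F n.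
  apply/seteqP; split => [z|z [n _]]; rewrite /F /= !in_itv/=; last first.
    by move=> /andP[nz ->]; rewrite andbT (lt_le_trans _ nz)// divr_gt0.
  move=> /andP[z0 zr]; have rz : 0 <= rho / z by rewrite divr_ge0 ?ltW.
  have [n nz] : exists n : nat, rho / z < n.+1%:R.
    by exists (Num.truncn (rho / z)); exact: truncnS_gt.
  exists n => //=; rewrite in_itv/= zr andbT ler_pdivrMr// mulrC.
  rewrite -ler_pdivrMr// (le_trans (ltW nz))// ler_nat//.
rewrite FE; have := @ge0_nondecreasing_set_cvg_integral _ (measurableTypeR R) R F (fun z : R => (z `^ (- a))%:E) mu.
move=> H; apply: (cvge_to_le (H _ _ _ _)).
- apply/nondecreasing_seqP => n; apply/subsetPset => z; rewrite /F /= !in_itv/=.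
  move=> /andP[nz ->]; rewrite andbT (le_trans _ nz)// ler_pM2l// lef_pV2 ?posrE//.
  by rewrite ler_nat.
- by move=> n; exact: measurable_itv.
- by move=> n; apply/measurable_EFinP; exact: mp.
- by move=> n x _; rewrite lee_fin powR_ge0.
- apply: nearW => n; apply: integral_powR_itv => //; first by rewrite divr_gt0.
  by rewrite ltr_pdivrMr// ltr_pMr// ltr1n.
Qed.

Lemma integral_cut_powR (a rho : R) : a < 1 -> 0 < rho ->
  (\int[mu]_z (cut_powR a rho z)%:E <= (2 * rho `^ (1 - a) / (1 - a))%:E)%E.
Proof.
move=> a1 rho0.
pose h := (fun z : R => (z `^ (- a))%:E) \_ `[0, rho].
have mh : measurable_fun [set: R] h.
  apply/(measurable_restrictT _ _).1 => //.
  by apply/measurable_EFinP; apply: measurable_funTS; exact: measurable_fun_powR.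
have h0 z : (0 <= h z)%E.
  by rewrite /h patchE; case: ifP => // _; rewrite lee_fin powR_ge0.
have hI : (\int[mu]_z h z <= (rho `^ (1 - a) / (1 - a))%:E)%E.
  by rewrite -integral_mkcond; exact: integral_powR_itv0.
apply: (@le_trans _ _ (\int[mu]_z (h z + h (0 - z)%R))%E).
  apply: ge0_le_integral => //.
  - by move=> z _; rewrite lee_fin cut_powR_ge0.
  - by apply/measurable_EFinP; exact: measurable_cut_powR.
  - apply: emeasurable_funD => //; apply: measurableT_comp => //.
    exact: measurable_funB.
  - move=> z _; rewrite /cut_powR; case: ltP => [zr|]; last first.
      by rewrite mulr0 => _; exact: adde_ge0.
    rewrite mulr1 sub0r; have [z0|z0] := leP 0 z.
      rewrite -[leLHS]adde0 leeD// /h patchE mem_set//=; first by rewrite ger0_norm.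
      by rewrite in_itv/= z0/= ltW// (le_lt_trans _ zr)// ler_norm.
    rewrite -[leLHS]add0e leeD// /h patchE mem_set//=; first by rewrite ltr0_norm.
    by rewrite in_itv/= oppr_ge0 ltW//= (le_trans _ (ltW zr))// -normrN ler_norm.
rewrite ge0_integralD//; last first.
  by apply: measurableT_comp => //; exact: measurable_funB.
rewrite integral_lebesgue_reflect//.
rewrite (_ : 2 * _ / _ = rho `^ (1 - a) / (1 - a) + rho `^ (1 - a) / (1 - a)); last by ring.
by rewrite EFinD leeD.
Qed.

Lemma integral_powR_itvy (e r : R) : 0 < e -> 0 < r ->
  (\int[mu]_(z in `[r, +oo[) (z `^ (- 1 - e))%:E = (r `^ (- e) / e)%:E)%E.
Proof.
move=> e0 r0.
have pos (z : R) : r <= z -> 0 < z by move=> ?; exact: lt_le_trans r0 _.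
pose F (z : R) := (- e^-1) * z `^ (- e).
have dF (z : R) : 0 < z -> is_derive z 1 F (z `^ (- 1 - e)).
  move=> z0; rewrite /F.
  have -> : z `^ (- 1 - e) = (- e^-1) *: ((- e) * z `^ (- e - 1)).
    rewrite scalerAl [_ *: _]mulrNN mulVf ?mul1r ?gt_eqF//.
    by congr (_ `^ _); ring.
  by apply: (@is_deriveZ _ _ _ (fun x : R => x `^ (- e))); exact: is_derive1_powR.
have cF (z : R) : 0 < z -> {for z, continuous F}.
  by move=> z0; apply/differentiable_continuous/derivable1_diffP; exact: (@ex_derive _ _ _ _ _ _ _ (dF z z0)).
rewrite (@ge0_continuous_FTC2y _ _ F _ 0)//.
- by rewrite sub0e -EFinN /F; congr (_%:E); ring.
- by move=> z _; exact: powR_ge0.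
- apply: derivable_within_continuous => z; rewrite in_itv/= andbT => ez.
  by apply: ex_derive; apply: is_derive1_powR; exact: pos.
- apply/cvgrPdist_le => /= eps eps0; have ee0 : 0 < eps * e by rewrite mulr_gt0.
  near=> z; rewrite sub0r normrN /F mulNr normrN normrM !ger0_norm ?powR_ge0 ?invr_ge0 ?(ltW e0)//.
  have z0 : 0 < z by near: z; apply: nbhs_pinfty_gt; rewrite num_real.
  rewrite mulrC ler_pdivrMr// powRN -[leRHS]invrK lef_pV2 ?posrE ?invr_gt0 ?powR_gt0//.
  rewrite -[leLHS]powRr1 ?invr_ge0 ?(ltW ee0)// -(@mulVf _ e) ?gt_eqF// powRrM.
  apply: ge0_ler_powR; rewrite ?nnegrE ?(ltW e0) ?(ltW z0) ?powR_ge0//.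
- by move=> z /ltW/pos z0; exact: (@ex_derive _ _ _ _ _ _ _ (dF z z0)).
- by apply: cvg_at_right_filter; exact: cF.
- move=> z; rewrite in_itv/= andbT => /ltW/pos z0.
  by rewrite derive1E; exact: (@derive_val _ _ _ _ _ _ _ (dF z z0)).
Unshelve. all: end_near. Qed.

Lemma gt0_powRD (x p q : R) : 0 < x -> x `^ (p + q) = x `^ p * x `^ q.
Proof. by move=> x0; rewrite powRD// (gt_eqF x0) implybT. Qed.

Lemma ler_powRN (p x y : R) : 0 <= p -> 0 < x -> x <= y -> y `^ (- p) <= x `^ (- p).
Proof.
move=> p0 x0 xy; have y0 := lt_le_trans x0 xy.
rewrite !powRN lef_pV2 ?posrE ?powR_gt0//.
by apply: ge0_ler_powR; rewrite ?nnegrE// ltW.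
Qed.

(** With z = c - y, the integrand is at most r^(-1-e) for |z| < r, an interval of length 2r, and at
    most |z|^(-1-e) beyond. The two regions contribute 2 r^-e and (2/e) r^-e. *)
Lemma integral_shifted_powR (e r c : R) : 0 < e -> 0 < r ->
  (\int[mu]_y ((r + `|c - y|) `^ (- 1 - e))%:E <= ((2 + 2 / e) * r `^ (- e))%:E)%E.
Proof.
move=> e0 r0.
have mf : measurable_fun [set: R] (fun y : R => ((r + `|y|) `^ (- 1 - e))%:E).
  by apply/measurable_EFinP/measurable_fun_powR; exact: measurable_funD.
rewrite (@integral_lebesgue_reflect (fun y : R => ((r + `|y|) `^ (- 1 - e))%:E))//; last first.
  by move=> y; rewrite lee_fin powR_ge0.
pose h := (fun z : R => (z `^ (- 1 - e))%:E) \_ `[r, +oo[.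
have mh : measurable_fun [set: R] h.
  apply/(measurable_restrictT _ _).1 => //.
  by apply/measurable_EFinP; apply: measurable_funTS; exact: measurable_fun_powR.
have h0 z : (0 <= h z)%E.
  by rewrite /h patchE; case: ifP => // _; rewrite lee_fin powR_ge0.
have hI : (\int[mu]_z h z <= (r `^ (- e) / e)%:E)%E.
  by rewrite -integral_mkcond; rewrite integral_powR_itvy.
have mc : measurable_fun [set: R] (fun z : R => (r `^ (- 1 - e) * cut_powR 0 r z)%:E).
  by apply/measurable_EFinP/measurable_funM => //; exact: measurable_cut_powR.
have mhN : measurable_fun [set: R] (fun z : R => h (0 - z)%R).
  by apply: measurableT_comp => //; exact: measurable_funB.
apply: (@le_trans _ _ (\int[mu]_z ((r `^ (- 1 - e) * cut_powR 0 r z)%:E +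
   (h z + h (0 - z)%R)))%E).
  apply: ge0_le_integral => //.
  - by move=> z _; rewrite lee_fin powR_ge0.
  - by apply: emeasurable_funD => //; apply: emeasurable_funD.
  - move=> z _; rewrite /cut_powR oppr0 powRr0 mul1r sub0r.
    have le1 x : 0 < x -> x <= r + `|z| -> (r + `|z|) `^ (-1 - e) <= x `^ (-1 - e).
      move=> x0 xr; rewrite -opprD; apply: ler_powRN => //.
      by rewrite addr_ge0// ltW.
    case: ltP => [zr|rz].
      rewrite mulr1 -[leLHS]adde0 leeD ?adde_ge0// lee_fin.
      by apply: le1 => //; rewrite lerDl.
    rewrite mulr0 add0e; have [z0|z0] := leP 0 z.
      rewrite -[leLHS]adde0 leeD// /h patchE mem_set//=.
        rewrite lee_fin -[X in _ <= X `^ _](ger0_norm z0).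
        by apply: le1; [exact: lt_le_trans rz|rewrite lerDr ltW].
      by rewrite in_itv/= andbT; rewrite ger0_norm in rz.
    rewrite -[leLHS]add0e leeD// /h patchE mem_set//=.
      rewrite lee_fin -[X in _ <= X `^ _](ltr0_norm z0).
      by apply: le1; [exact: lt_le_trans rz|rewrite lerDr ltW].
    by rewrite in_itv/= andbT; rewrite ltr0_norm in rz.
rewrite ge0_integralD//; last 3 first.
- by move=> z _; rewrite lee_fin mulr_ge0 ?powR_ge0 ?cut_powR_ge0.
- by move=> z _; exact: adde_ge0.
- exact: emeasurable_funD.
rewrite ge0_integralD// (integral_lebesgue_reflect 0 mh)//.
under eq_integral do rewrite EFinM.
rewrite ge0_integralZl//; last 3 first.
- by apply/measurable_EFinP; exact: measurable_cut_powR.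
- by move=> z _; rewrite lee_fin cut_powR_ge0.
- by rewrite lee_fin powR_ge0.
apply: (@le_trans _ _ ((r `^ (- 1 - e))%:E * (2 * r `^ (1 - 0) / (1 - 0))%:E +
    ((r `^ (- e) / e)%:E + (r `^ (- e) / e)%:E))%E).
  by rewrite leeD ?leeD// lee_pmul2l ?lte_fin ?powR_gt0// integral_cut_powR.
rewrite -EFinM -!EFinD lee_fin subr0 divr1 (mulrCA _ 2) -gt0_powRD//.
by rewrite addrAC addNr add0r le_eqVlt; apply/orP; left; apply/eqP; ring.
Qed.

(** A crude bound of the Beta integral by cutting at t/2: below it (t-s)^-p is at most (t/2)^-p,
    above it s^-q is at most (t/2)^-q, and one power remains to integrate. *)
Lemma integral_beta_le (p q t : R) : 0 <= p < 1 -> 0 <= q < 1 -> 0 < t ->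
  (\int[mu]_(s in `]0%R, t[) ((t - s) `^ (- p) * s `^ (- q))%:E <=
   (2 * (2 `^ p / (1 - q) + 2 `^ q / (1 - p)) * t `^ (1 - p - q))%:E)%E.
Proof.
move=> /andP[p0 p1] /andP[q0 q1] t0; have t20 : 0 < t / 2 by rewrite divr_gt0.
pose h s := (t / 2) `^ (- p) * cut_powR q t s.
pose k s := (t / 2) `^ (- q) * cut_powR p t (t - s).
have mh : measurable_fun [set: R] (fun s => (h s)%:E).
  by apply/measurable_EFinP/measurable_funM => //; exact: measurable_cut_powR.
have mk : measurable_fun [set: R] (fun s => (k s)%:E).
  apply/measurable_EFinP/measurable_funM => //.
  apply: measurableT_comp; first exact: measurable_cut_powR.
  exact: measurable_funB.
have h0 s : (0 <= (h s)%:E)%E by rewrite lee_fin mulr_ge0 ?powR_ge0 ?cut_powR_ge0.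
have k0 s : (0 <= (k s)%:E)%E by rewrite lee_fin mulr_ge0 ?powR_ge0 ?cut_powR_ge0.
apply: (@le_trans _ _ (\int[mu]_(s in `]0%R, t[) ((h s)%:E + (k s)%:E))%E).
  apply: ge0_le_integral => //.
  - by move=> s _; rewrite lee_fin mulr_ge0 ?powR_ge0.
  - apply/measurable_EFinP; apply: measurable_funTS; apply: measurable_funM.
      by apply: measurable_fun_powR; exact: measurable_funB.
    exact: measurable_fun_powR.
  - by apply: measurable_funTS; exact: emeasurable_funD.
  - move=> s; rewrite /= in_itv/= => /andP[s0 st]; rewrite -EFinD lee_fin /h /k /cut_powR.
    rewrite !gtr0_norm ?subr_gt0// st ltrBlDr ltrDl s0 !mulr1.
    have [st2|st2] := leP s (t / 2).
      rewrite -[leLHS]addr0 lerD ?mulr_ge0 ?powR_ge0// ler_wpM2r ?powR_ge0//.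
      by apply: ler_powRN => //; lra.
    rewrite -[leLHS]add0r lerD ?mulr_ge0 ?powR_ge0// mulrC ler_wpM2r ?powR_ge0//.
    by apply: ler_powRN => //; lra.
apply: (@le_trans _ _ (\int[mu]_s ((h s)%:E + (k s)%:E))%E).
  apply: ge0_subset_integral => //; first exact: emeasurable_funD.
  by move=> s _; exact: adde_ge0.
rewrite ge0_integralD// /h /k.
under eq_integral do rewrite EFinM.
under [X in (_ + X)%E]eq_integral do rewrite EFinM.
rewrite !ge0_integralZl//; first last.
- by rewrite lee_fin powR_ge0.
- by move=> s _; rewrite lee_fin cut_powR_ge0.
- by apply/measurable_EFinP; exact: measurable_cut_powR.
- by rewrite lee_fin powR_ge0.
- by move=> s _; rewrite lee_fin cut_powR_ge0.
- apply/measurable_EFinP/measurableT_comp; first exact: measurable_cut_powR.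
  exact: measurable_funB.
rewrite (@integral_lebesgue_reflect (fun s => (cut_powR p t s)%:E)); last 2 first.
- by apply/measurable_EFinP; exact: measurable_cut_powR.
- by move=> s; rewrite lee_fin cut_powR_ge0.
apply: (@le_trans _ _ (((t / 2) `^ (- p))%:E * (2 * t `^ (1 - q) / (1 - q))%:E +
   ((t / 2) `^ (- q))%:E * (2 * t `^ (1 - p) / (1 - p))%:E)%E).
  by rewrite leeD// lee_pmul2l ?lte_fin ?powR_gt0// integral_cut_powR.
rewrite -!EFinM -EFinD lee_fin.
have E x : (t / 2) `^ (- x) = 2 `^ x * t `^ (- x).
  rewrite powRM ?invr_ge0 ?ltW// mulrC; congr (_ * _).
  by rewrite -powR_inv1// -powRrM mulrNN mul1r.
have D x y : t `^ (- x) * t `^ y = t `^ (y - x).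
  by rewrite -gt0_powRD// addrC.
rewrite !E le_eqVlt; apply/orP; left; apply/eqP.
rewrite (_ : 1 - p - q = 1 - q - p); last by ring.
rewrite -(D p (1 - q)).
have -> : t `^ (- p) * t `^ (1 - q) = t `^ (- q) * t `^ (1 - p).
  by rewrite !D; congr (_ `^ _); ring.
set A := t `^ (- p); set B := t `^ (1 - q).
have AB : A * B = t `^ (- q) * t `^ (1 - p).
  by rewrite !D; congr (_ `^ _); ring.
transitivity (2 * 2 `^ p * (A * B) / (1 - q) + 2 * 2 `^ q * (t `^ (- q) * t `^ (1 - p)) / (1 - p)).
  by ring.
by rewrite AB; ring.
Qed.

End one_dimensional_integrals.

(** * Oscillating Gaussian moments *)

Section gauss_moments.
Context {R : realType}.
Local Notation mu := (@lebesgue_measure R).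

(** The form in which integration by parts is used. Limits along the integers suffice, since by
    dominated convergence the integrals over symmetric intervals with integer ends tend to the full
    integral. *)
Lemma Rintegral_derive_eq0 (F f : R -> R) :
  (forall x : R, is_derive x 1 F (f x)) -> continuous f ->
  mu.-integrable setT (EFin \o f) ->
  F n%:R @[n --> \oo] --> 0 -> F (- n%:R) @[n --> \oo] --> 0 ->
  \int[mu]_x f x = 0.
Proof.
move=> dF cf intf Fy FNy.
(* The shift to [n.+1] keeps every interval nondegenerate. *)
pose D (n : nat) : set R := `[- n.+1%:R, n.+1%:R]%classic.
pose fn (n : nat) : R -> \bar R := (EFin \o f) \_ (D n).
have mf : measurable_fun [set: measurableTypeR R] (EFin \o f) := measurable_int _ intf.
have intFn n : (\int[mu]_x fn n x = (F n.+1%:R - F (- n.+1%:R))%:E)%E.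
  rewrite /fn -integral_mkcond (@continuous_FTC2 _ f F)//.
  - by rewrite gtrN.
  - by apply: continuous_subspaceT => x; exact: cf.
  - have cF : continuous F.
      move=> x; apply/differentiable_continuous/derivable1_diffP.
      exact: (@ex_derive _ _ _ _ _ _ _ (dF x)).
    split; first by move=> x _; exact: (@ex_derive _ _ _ _ _ _ _ (dF x)).
    + by apply: cvg_at_right_filter; exact: cF.
    + by apply: cvg_at_left_filter; exact: cF.
  - by move=> x _; rewrite derive1E (@derive_val _ _ _ _ _ _ _ (dF x)).
have [|||||_ _ /=] := @dominated_convergence _ (measurableTypeR R) R mu setT measurableT fn (EFin \o f)
  (abse \o (EFin \o f)).
- move=> n; apply/(measurable_restrictT _ _).1 => //.
    exact: measurable_itv.
  exact: measurable_funTS.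
- by [].
- apply: aeW => x _; apply: cvg_near_cst; near=> n.
  rewrite /fn patchE mem_set// /D /= in_itv/= -ler_norml.
  near: n; exists (Num.truncn `|x|) => // n /= xn.
  rewrite ltW// (lt_le_trans (truncnS_gt _))// ler_nat//.
- exact: integrable_abse.
- apply: aeW => x n _; rewrite /fn patchE; case: ifPn => //= _.
  by rewrite normr0 lee_fin.
move=> cvgI.
have lim0 : (F n.+1%:R - F (- n.+1%:R))%:E @[n --> \oo] --> 0%:E.
  apply: cvg_EFin; first exact: nearW.
  rewrite /comp/= -(subrr 0); apply: cvgB.
  - by rewrite -(cvg_shiftS (fun n => F n%:R)) in Fy.
  - by rewrite -(cvg_shiftS (fun n => F (- n%:R))) in FNy.
have {}cvgI : (F n.+1%:R - F (- n.+1%:R))%:E @[n --> \oo] --> (\int[mu]_x (f x)%:E)%E.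
  by move: cvgI; under eq_fun do rewrite intFn.
by rewrite /Rintegral (cvg_unique _ cvgI lim0).
Unshelve. all: end_near. Qed.

Lemma integral_gauss_scale (k : R) : 0 < k ->
  (\int[mu]_x (gauss_fun (k * x))%:E = (Num.sqrt pi / k)%:E)%E.
Proof.
move=> k0.
have F' : (fun x : R => k * x)^`()%classic = cst k.
  by apply/funext => x; rewrite derive1Ml// derive1_id mulr1.
have mg : measurable_fun [set: R] (fun x => (gauss_fun (k * x))%:E).
  by apply/measurable_EFinP; apply: measurableT_comp; [exact: measurable_gauss_fun|exact: measurable_funM].
have := @increasing_ge0_integration_by_substitutionT R (fun x => k * x) gauss_fun.
rewrite integralT_gauss F' => H.
have : (\int[mu]_x (gauss_fun (k * x))%:E * k%:E = (Num.sqrt pi)%:E)%E.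
  rewrite -ge0_integralZr//; last 2 first.
  - by move=> x _; rewrite lee_fin gauss_fun_ge0.
  - by rewrite lee_fin ltW.
  apply/esym; apply: H.
  - by move=> x y xy; rewrite ltr_pM2l.
  - by move=> x; exact: cvg_cst.
  - exact: is_cvg_cst.
  - exact: is_cvg_cst.
  - by move=> x; apply: derivableM.
  - by apply: gt0_cvgMrNy => //; exact: cvg_id.
  - by apply: gt0_cvgMry => //; exact: cvg_id.
  - exact: continuous_gauss_fun.
  - by move=> x; exact: gauss_fun_ge0.
move=> /(congr1 (fun x => x * (k^-1)%:E)%E).
by rewrite -muleA -!EFinM divff ?gt_eqF// mule1.
Qed.

Lemma measurable_fun_cos d (T : measurableType d) (f : T -> R) :
  measurable_fun [set: T] f -> measurable_fun [set: T] (fun x => cos (f x)).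
Proof.
by apply: measurableT_comp; apply: continuous_measurable_fun; exact: continuous_cos.
Qed.

Lemma measurable_gauss_moment (m : nat) (r : R) :
  measurable_fun [set: R] (fun x : R => `|x| ^+ m * gauss_fun (r * x)).
Proof.
apply: measurable_funM.
  by apply: measurable_funX; exact: measurable_fun_norm.
by apply: measurableT_comp; [exact: measurable_gauss_fun|exact: measurable_funM].
Qed.

(** Three quarters of the exponent absorb the power: |u|^m <= 1 + (u^2)^(m+1), and e^(3u^2/4)
    dominates this through the terms of degree 0 and m + 1 of its series. *)
Lemma moment_le_gauss (m : nat) :
  exists2 A : R, 0 < A & forall u : R, `|u| ^+ m * gauss_fun u <= A * gauss_fun (2^-1 * u).
Proof.
have c0 : 0 < (4 / 3 : R) ^+ m.+1 * (m.+1)`!%:R.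
  by rewrite mulr_gt0 ?exprn_gt0// ltr0n fact_gt0.
exists (1 + (4 / 3) ^+ m.+1 * (m.+1)`!%:R); first by rewrite addr_gt0.
move=> u; set v : R := `|u|.
have v0 : 0 <= v by exact: normr_ge0.
have -> : gauss_fun u = gauss_fun v by rewrite /gauss_fun real_normK ?num_real.
have -> : gauss_fun (2^-1 * u) = gauss_fun (2^-1 * v).
  by rewrite /gauss_fun !exprMn real_normK ?num_real.
have -> : gauss_fun (2^-1 * v) = gauss_fun v * expR (3 / 4 * v ^+ 2).
  by rewrite /gauss_fun -expRD; congr expR; field.
rewrite mulrCA mulrC ler_pM2l ?expR_gt0//.
set x := 3 / 4 * v ^+ 2; have x0 : 0 <= x by rewrite mulr_ge0// exprn_ge0.
apply: (@le_trans _ _ (1 + (v ^+ 2) ^+ m.+1)).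
  have [v1|/ltW v1] := leP v 1.
    by apply: (@le_trans _ _ 1); [exact: exprn_ile1|rewrite lerDl !exprn_ge0].
  rewrite -exprM (@le_trans _ _ (v ^+ (2 * m.+1)))// ?lerDr//.
  by rewrite ler_weXn2l// mul2n -addnn addSn leqW// leq_addr.
have -> : v ^+ 2 = 4 / 3 * x by rewrite /x; field.
apply: (le_trans _ (ler_wpM2l _ (expR_ge1Dxn m x0))); last by rewrite addr_ge0// ltW.
have f0 : (m.+1)`!%:R != 0 :> R by rewrite pnatr_eq0 -lt0n fact_gt0.
have xm0 : 0 <= x ^+ m.+1 / (m.+1)`!%:R by rewrite divr_ge0// exprn_ge0.
rewrite exprMn (_ : _ * x ^+ m.+1 = (4 / 3) ^+ m.+1 * (m.+1)`!%:R * (x ^+ m.+1 / (m.+1)`!%:R)); last first.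
  by rewrite -!mulrA; congr (_ * _); rewrite mulrCA divff// mulr1.
set c := (4 / 3) ^+ m.+1 * _ in c0 *; set y := x ^+ _ / _ in xm0 *.
by have := mulr_ge0 (ltW c0) xm0; lra.
Qed.

Lemma integral_gauss_moment (m : nat) : exists2 A : R, 0 < A & forall r : R, 0 < r ->
  (\int[mu]_x (`|x| ^+ m * gauss_fun (r * x))%:E <= (A / r ^+ m.+1)%:E)%E.
Proof.
have [A A0 hA] := moment_le_gauss m.
exists (2 * A * (Num.sqrt pi + 1)); first by rewrite !mulr_gt0// ltr_wpDl// sqrtr_ge0.
move=> r r0.
have mg (k : R) : measurable_fun [set: R] (fun x => gauss_fun (k * x)).
  by apply: measurableT_comp; [exact: measurable_gauss_fun|exact: measurable_funM].
apply: (@le_trans _ _ (\int[mu]_x ((A / r ^+ m)%:E * (gauss_fun (2^-1 * r * x))%:E))%E).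
  apply: ge0_le_integral => //.
  - by move=> x _; rewrite lee_fin mulr_ge0 ?exprn_ge0 ?gauss_fun_ge0.
  - by apply/measurable_EFinP; exact: measurable_gauss_moment.
  - by apply: emeasurable_funM => //; apply/measurable_EFinP; exact: mg.
  - move=> x _; rewrite -EFinM lee_fin mulrAC ler_pdivlMr ?exprn_gt0// mulrAC.
    by have := hA (r * x); rewrite normrM (gtr0_norm r0) exprMn (mulrC (r ^+ m)) -(mulrA 2^-1).
rewrite ge0_integralZl//; last 3 first.
- by apply/measurable_EFinP; exact: mg.
- by move=> x _; rewrite lee_fin gauss_fun_ge0.
- by rewrite lee_fin divr_ge0 ?exprn_ge0// ltW.
rewrite integral_gauss_scale ?mulr_gt0// -EFinM lee_fin.
rewrite (_ : A / r ^+ m * _ = 2 * A * Num.sqrt pi / r ^+ m.+1); last first.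
  by rewrite exprS; field; rewrite expf_neq0 gt_eqF.
by rewrite ler_pM2r ?invr_gt0 ?exprn_gt0// ler_pM2l ?mulr_gt0// lerDl.
Qed.

(* The phase [phi] keeps the family stable under differentiation of the cosine
   and under separation of the variables. *)
Definition osc_gauss (m : nat) (r x phi xi : R) : R :=
  xi ^+ m * gauss_fun (r * xi) * cos (x * xi + phi).

Lemma measurable_osc_gauss m r x phi : measurable_fun [set: R] (osc_gauss m r x phi).
Proof.
apply: measurable_funM; last first.
  apply: measurable_fun_cos.
  by apply: measurable_funD => //; exact: measurable_funM.
apply: measurable_funM; first exact: measurable_funX.
by apply: measurableT_comp; [exact: measurable_gauss_fun|exact: measurable_funM].
Qed.

Lemma norm_osc_gauss m r x phi xi :
  `|osc_gauss m r x phi xi| <= `|xi| ^+ m * gauss_fun (r * xi).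
Proof.
rewrite !normrM normrX (ger0_norm (gauss_fun_ge0 _)) ler_piMr ?mulr_ge0 ?exprn_ge0 ?gauss_fun_ge0//.
by rewrite ler_norml cos_geN1 cos_le1.
Qed.

Lemma integral_norm_osc_gauss m r x phi :
  (\int[mu]_xi `|osc_gauss m r x phi xi|%:E <=
   \int[mu]_xi (`|xi| ^+ m * gauss_fun (r * xi))%:E)%E.
Proof.
apply: ge0_le_integral => //.
- by apply/measurable_EFinP/measurable_fun_norm; exact: measurable_osc_gauss.
- by apply/measurable_EFinP; exact: measurable_gauss_moment.
- by move=> xi _; rewrite lee_fin norm_osc_gauss.
Qed.

Lemma integrable_osc_gauss m r x phi : 0 < r ->
  mu.-integrable [set: R] (EFin \o osc_gauss m r x phi).
Proof.
move=> r0; have [A _ hA] := integral_gauss_moment m.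
apply: (@le_integrable_bound _ _ (measurableTypeR R) mu _ _ (A / r ^+ m.+1)) => //.
  exact: measurable_osc_gauss.
by apply: le_trans (hA r r0); exact: integral_norm_osc_gauss.
Qed.

(** The same function with one more power of |xi| is bounded, so this one decays like 1/n. *)
Lemma osc_gauss_cvg m r x phi (v : R^nat) : 0 < r -> (forall n, `|v n| = n%:R) ->
  osc_gauss m r x phi (v n) @[n --> \oo] --> 0.
Proof.
move=> r0 hv; have [A A0 hA] := moment_le_gauss m.+1.
apply: norm_cvg0; rewrite -cvg_shiftS /=.
apply: (@squeeze_cvgr _ _ _ _ (cst 0) (fun n => A / r ^+ m.+1 / n.+1%:R)); last 2 first.
- exact: cvg_cst.
- rewrite -(mulr0 (A / r ^+ m.+1)); apply: cvgMr; exact: cvg_harmonic.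
apply: nearW => n; rewrite normr_ge0/= (le_trans (norm_osc_gauss _ _ _ _ _))//.
rewrite ler_pdivlMr// -(hv n.+1) mulrAC -exprSr ler_pdivlMr ?exprn_gt0// mulrAC.
have := hA (r * v n.+1); rewrite normrM (gtr0_norm r0) exprMn (mulrC (r ^+ m.+1)) => /le_trans; apply.
by rewrite ler_piMr ?(ltW A0)//; exact: gauss_fun_le1.
Qed.

Definition osc_integral (m : nat) (r x phi : R) : R := \int[mu]_xi osc_gauss m r x phi xi.

Lemma is_derive_osc_gauss m r x phi (xi : R) :
  is_derive xi 1 (osc_gauss m r x (phi - pi / 2))
    (m%:R * osc_gauss m.-1 r x (phi - pi / 2) xi -
     2 * r ^+ 2 * osc_gauss m.+1 r x (phi - pi / 2) xi + x * osc_gauss m r x phi xi).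
Proof.
have -> : osc_gauss m r x (phi - pi / 2) =
    ((@id R) ^+ m) * (expR \o (- ((r \*: @id R) ^+ 2))) * (sin \o (x \*: @id R + cst phi)).
  apply/funext => t; rewrite /osc_gauss /gauss_fun addrA cosBpihalf !fctE /=.
  by [].
apply: is_derive_eq.
rewrite /osc_gauss /gauss_fun !addrA !cosBpihalf /GRing.scale /= !fctE /= /GRing.scale /=.
by rewrite expr1 (exprS xi m); ring.
Qed.

(** Integrating the derivative of [osc_gauss m r x (phi - pi / 2)] trades a factor x for moments of
    the neighbouring orders. For [m = 0] the index [m.-1] is again 0, but its coefficient
    vanishes. *)
Lemma osc_integral_rec m r x phi : 0 < r ->
  x * osc_integral m r x phi =
  2 * r ^+ 2 * osc_integral m.+1 r x (phi - pi / 2) -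
  m%:R * osc_integral m.-1 r x (phi - pi / 2).
Proof.
move=> r0.
pose f xi := (m%:R * osc_gauss m.-1 r x (phi - pi / 2) xi -
     2 * r ^+ 2 * osc_gauss m.+1 r x (phi - pi / 2) xi + x * osc_gauss m r x phi xi).
have i1 : mu.-integrable setT (EFin \o (fun xi => m%:R * osc_gauss m.-1 r x (phi - pi / 2) xi)).
  rewrite /comp; under eq_fun do rewrite EFinM.
  by apply: integrableZl => //; exact: integrable_osc_gauss.
have i2 : mu.-integrable setT (EFin \o (fun xi => 2 * r ^+ 2 * osc_gauss m.+1 r x (phi - pi / 2) xi)).
  rewrite /comp; under eq_fun do rewrite EFinM.
  by apply: integrableZl => //; exact: integrable_osc_gauss.
have i3 : mu.-integrable setT (EFin \o (fun xi => x * osc_gauss m r x phi xi)).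
  rewrite /comp; under eq_fun do rewrite EFinM.
  by apply: integrableZl => //; exact: integrable_osc_gauss.
have i12 : mu.-integrable setT (EFin \o (fun xi => m%:R * osc_gauss m.-1 r x (phi - pi / 2) xi - 2 * r ^+ 2 * osc_gauss m.+1 r x (phi - pi / 2) xi)).
  by rewrite /comp; under eq_fun do rewrite EFinB; exact: integrableB.
have If : \int[mu]_xi f xi = 0.
  apply: (@Rintegral_derive_eq0 (osc_gauss m r x (phi - pi / 2))).
  - by move=> xi; exact: is_derive_osc_gauss.
  - have co k psi : continuous (osc_gauss k r x psi).
      have -> : psi = (psi + pi / 2) - pi / 2 by rewrite addrK.
      move=> xi; apply/differentiable_continuous/derivable1_diffP.
      exact: (@ex_derive _ _ _ _ _ _ _ (is_derive_osc_gauss _ _ _ _ _)).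
    move=> xi; apply: cvgD; last by apply: cvgM; [exact: cvg_cst|exact: co].
    by apply: cvgB; apply: cvgM; [exact: cvg_cst|exact: co|exact: cvg_cst|exact: co].
  - by rewrite /comp; under eq_fun do rewrite EFinD; exact: integrableD.
  - by apply: osc_gauss_cvg => // n; rewrite ger0_norm.
  - by apply: osc_gauss_cvg => // n; rewrite normrN ger0_norm.
move: If; rewrite /f RintegralD// RintegralB// !RintegralZl//.
- by rewrite /osc_integral => H; apply/eqP; rewrite -subr_eq0; apply/eqP; rewrite -[RHS]H; ring.
- exact: integrable_osc_gauss.
- exact: integrable_osc_gauss.
- exact: integrable_osc_gauss.
Qed.

(** The factor [r ^+ m.+1] normalises the integral, so that each integration by parts costs exactly
    one factor r. As it also moves m up or down and shifts the phase, the induction on N is for all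
    m and phases at once. *)
Lemma osc_integral_decay_step (N m : nat) : exists2 A : R, 0 <= A &
  forall r x phi : R, 0 < r ->
    `|x| ^+ N * (r ^+ m.+1 * `|osc_integral m r x phi|) <= A * r ^+ N.
Proof.
elim: N m => [|N IH] m.
  have [A A0 hA] := integral_gauss_moment m; exists A; first exact: ltW.
  move=> r x phi r0; rewrite !expr0 mul1r mulr1 mulrC -ler_pdivlMr ?exprn_gt0//.
  apply: normr_Rintegral_le => //; first exact: measurable_osc_gauss.
  by apply: le_trans (hA r r0); exact: integral_norm_osc_gauss.
have [A A0 hA] := IH m.-1; have [B B0 hB] := IH m.+1.
exists (m%:R * A + 2 * B); first by rewrite addr_ge0// mulr_ge0.
move=> r x phi r0.
rewrite exprSr -mulrA (mulrCA `|x|) -normrM osc_integral_rec//.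
set I1 := osc_integral m.+1 _ _ _; set I0 := osc_integral m.-1 _ _ _.
have r0' := ltW r0; have xN : 0 <= `|x| ^+ N by rewrite exprn_ge0.
apply: (@le_trans _ _ (`|x| ^+ N * (r ^+ m.+1 * (2 * r ^+ 2 * `|I1| + m%:R * `|I0|)))).
  rewrite ler_wpM2l// ler_wpM2l ?exprn_ge0// (le_trans (ler_normB _ _))//.
  by rewrite (normrM _ I1) (normrM _ I0) (@ger0_norm _ (2 * r ^+ 2)) ?normr_nat// mulr_ge0 ?exprn_ge0.
have h1 := hB r x (phi - pi / 2) r0; have h0 := hA r x (phi - pi / 2) r0.
rewrite -/I1 in h1; rewrite -/I0 in h0.
rewrite (_ : `|x| ^+ N * _ = m%:R * (`|x| ^+ N * (r ^+ m.+1 * `|I0|)) +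
  2 * r * (`|x| ^+ N * (r ^+ m.+2 * `|I1|))); last by rewrite !exprS; ring.
rewrite (_ : _ * r ^+ N.+1 = m%:R * (r * (A * r ^+ N)) + 2 * r * (B * r ^+ N)); last first.
  by rewrite exprS; ring.
apply: lerD; last by rewrite ler_wpM2l// mulr_ge0.
(* For [m = 0] the powers of r do not match, because [m.-1] is not one less than m; the coefficient
   [m%:R] is then 0. *)
case: m @I0 h0 {hA IH I1 h1 hB} => [|m] I0 h0; first by rewrite !mul0r.
rewrite ler_wpM2l// (_ : `|x| ^+ N * _ = r * (`|x| ^+ N * (r ^+ m.+1 * `|I0|))).
  by rewrite ler_wpM2l.
by rewrite exprS; ring.
Qed.

Lemma osc_integral_decay (N m : nat) : exists2 A : R, 0 <= A &
  forall r x phi : R, 0 < r ->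
    (1 + `|x| / r) ^+ N * (r ^+ m.+1 * `|osc_integral m r x phi|) <= A.
Proof.
have [A A0 hA] := osc_integral_decay_step 0 m.
have [B B0 hB] := osc_integral_decay_step N m.
exists (2 ^+ N * (A + B)); first by rewrite mulr_ge0 ?exprn_ge0 ?addr_ge0.
move=> r x phi r0; set I : R := _ * `|_|.
have I0 : 0 <= I by rewrite mulr_ge0// exprn_ge0// ltW.
set u : R := `|x| / r; have u0 : 0 <= u by rewrite divr_ge0// ltW.
apply: (@le_trans _ _ ((2 ^+ N * (1 + u ^+ N)) * I)).
  rewrite ler_wpM2r//; have [u1|/ltW u1] := leP u 1.
    apply: (@le_trans _ _ (2 ^+ N * 1)); last by rewrite ler_wpM2l ?exprn_ge0// lerDl exprn_ge0.
    by rewrite mulr1 lerXn2r ?nnegrE ?addr_ge0//; lra.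
  apply: (@le_trans _ _ (2 ^+ N * u ^+ N)); last by rewrite ler_wpM2l ?exprn_ge0// lerDr.
  by rewrite -exprMn; apply: lerXn2r; rewrite ?nnegrE; lra.
rewrite -mulrA ler_wpM2l ?exprn_ge0// mulrDl mul1r lerD//.
  by have := hA r x phi r0; rewrite !expr0 mul1r mulr1.
rewrite /u exprMn exprVn mulrAC ler_pdivrMr ?exprn_gt0//.
exact: hB.
Qed.

End gauss_moments.

(** * Oscillating Gaussian integrals in several variables *)

Section osc_gauss_rV.
Context {R : realType}.

Lemma measurable_fun_dotp d (T : measurableType d) n (f g : T -> 'rV[R]_n) :
  measurable_fun [set: T] f -> measurable_fun [set: T] g ->
  measurable_fun [set: T] (fun x => dotp (f x) (g x)).
Proof.
move=> mf mg; apply: measurable_sum => i; apply: measurable_funM.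
  by apply: (measurableT_comp (measurable_rV_coord i)).
by apply: (measurableT_comp (measurable_rV_coord i)).
Qed.

Lemma EFin_Rintegral d (T : measurableType d) (mu : {measure set T -> \bar R}) (f : T -> R) :
  mu.-integrable setT (EFin \o f) -> (\int[mu]_x (f x)%:E = (\int[mu]_x f x)%:E)%E.
Proof. by move=> intf; rewrite /Rintegral fineK//; exact: integrable_fin_num. Qed.

Definition osc_gauss_rV n (m : 'I_n -> nat) (r : R) (x : 'rV[R]_n) (phi : R) (xi : 'rV[R]_n) : R :=
  (\prod_(i < n) (xi ord0 i ^+ m i * gauss_fun (r * xi ord0 i))) * cos (dotp x xi + phi).

Lemma measurable_osc_gauss_rV n (m : 'I_n -> nat) r x phi :
  measurable_fun [set: 'rV[R]_n] (osc_gauss_rV m r x phi).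
Proof.
apply: measurable_funM; last first.
  apply: measurable_fun_cos; apply: measurable_funD => //.
  exact: measurable_fun_dotp.
apply: (@measurable_prod_rV _ _ (fun i a => a ^+ m i * gauss_fun (r * a))) => i.
apply: measurable_funM; first exact: measurable_funX.
by apply: measurableT_comp; [exact: measurable_gauss_fun|exact: measurable_funM].
Qed.

Lemma ge0_integral_prod_rV_le n (f : 'I_n -> R -> R) (c : 'I_n -> R) :
  (forall i, measurable_fun [set: R] (f i)) -> (forall i x, (0 <= f i x)%R) ->
  (forall i, \int[lebesgue_measure]_a (f i a)%:E <= (c i)%:E)%E ->
  (\int[@lebesgue_rV R n]_x (\prod_(i < n) f i (x ord0 i))%:E <= (\prod_(i < n) c i)%:E)%E.
Proof.
move=> mf f0 fc; rewrite ge0_integral_prod_rV// -prodEFin.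
apply: (proj2 (_ : 0 <= _ /\ _))%E.
apply: (big_ind2 (fun a b => 0 <= a /\ a <= b)%E) => // [a b a' b' [a0 ab] [a'0 ab']|i _].
  by split; [exact: mule_ge0|exact: lee_pmul].
by split => //; apply: integral_ge0 => x _; rewrite lee_fin.
Qed.

Lemma norm_osc_gauss_rV n (m : 'I_n -> nat) r x phi xi :
  `|osc_gauss_rV m r x phi xi| <= \prod_(i < n) (`|xi ord0 i| ^+ m i * gauss_fun (r * xi ord0 i)).
Proof.
have -> : \prod_(i < n) (`|xi ord0 i| ^+ m i * gauss_fun (r * xi ord0 i)) =
    `|\prod_(i < n) (xi ord0 i ^+ m i * gauss_fun (r * xi ord0 i))|.
  rewrite normr_prod; apply: eq_bigr => i _.
  by rewrite normrM normrX (ger0_norm (gauss_fun_ge0 _)).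
by rewrite /osc_gauss_rV normrM ler_piMr// ler_norml cos_geN1 cos_le1.
Qed.

Lemma integral_gauss_moment_rV n (m : 'I_n -> nat) : exists2 A : R, 0 < A &
  forall r, 0 < r ->
  (\int[@lebesgue_rV R n]_xi (\prod_(i < n) (`|xi ord0 i| ^+ m i * gauss_fun (r * xi ord0 i)))%:E
   <= (A / r ^+ (n + \sum_(i < n) m i))%:E)%E.
Proof.
have /choice[A hA] (i : 'I_n) : exists A : R, 0 < A /\ forall r, 0 < r ->
  (\int[lebesgue_measure]_x (`|x| ^+ m i * gauss_fun (r * x))%:E <= (A / r ^+ (m i).+1)%:E)%E.
  by have [A A0 H] := integral_gauss_moment (R := R) (m i); exists A.
exists (\prod_(i < n) A i); first by apply: prodr_gt0 => i _; exact: (hA i).1.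
move=> r r0.
rewrite (_ : _ / _ = \prod_(i < n) (A i / r ^+ (m i).+1)); last first.
  rewrite prodf_div; congr (_ / _).
  rewrite prodrXr; congr (_ ^+ _).
  under [RHS]eq_bigr do rewrite -add1n.
  by rewrite big_split /= sum1_card card_ord.
apply: (@ge0_integral_prod_rV_le _ (fun i a => `|a| ^+ m i * gauss_fun (r * a))).
- by move=> i; exact: measurable_gauss_moment.
- by move=> i a; rewrite mulr_ge0 ?exprn_ge0 ?gauss_fun_ge0.
- by move=> i; exact: (hA i).2.
Qed.

Lemma integral_norm_osc_gauss_rV n (m : 'I_n -> nat) r x phi :
  (\int[@lebesgue_rV R n]_xi `|osc_gauss_rV m r x phi xi|%:E <=
   \int[@lebesgue_rV R n]_xi (\prod_(i < n) (`|xi ord0 i| ^+ m i * gauss_fun (r * xi ord0 i)))%:E)%E.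
Proof.
apply: ge0_le_integral => //.
- by apply/measurable_EFinP/measurable_fun_norm; exact: measurable_osc_gauss_rV.
- apply/measurable_EFinP.
  apply: (@measurable_prod_rV _ _ (fun i a => `|a| ^+ m i * gauss_fun (r * a))) => i.
  exact: measurable_gauss_moment.
- by move=> xi _; rewrite lee_fin norm_osc_gauss_rV.
Qed.

Lemma integrable_osc_gauss_rV n (m : 'I_n -> nat) r x phi : 0 < r ->
  (@lebesgue_rV R n).-integrable setT (EFin \o osc_gauss_rV m r x phi).
Proof.
move=> r0; have [A _ hA] := integral_gauss_moment_rV m.
apply: (@le_integrable_bound _ _ _ _ _ _ (A / r ^+ (n + \sum_(i < n) m i))) => //.
  exact: measurable_osc_gauss_rV.
by apply: le_trans (hA r r0); exact: integral_norm_osc_gauss_rV.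
Qed.

(** The addition formula of the cosine splits off the first variable; the sines are cosines with
    phase lowered by pi / 2, so the family is not left. *)
Lemma osc_gauss_rVS n (m : 'I_n.+1 -> nat) r (x : 'rV[R]_n.+1) phi a v :
  let x' : 'rV[R]_n := \row_i x ord0 (lift ord0 i) in
  let m' (i : 'I_n) := m (lift ord0 i) in
  osc_gauss_rV m r x phi (cons_rV (a, v)) =
  osc_gauss (m ord0) r (x ord0 ord0) 0 a * osc_gauss_rV m' r x' phi v -
  osc_gauss (m ord0) r (x ord0 ord0) (- (pi / 2)) a * osc_gauss_rV m' r x' (phi - pi / 2) v.
Proof.
move=> x' m'; rewrite /osc_gauss_rV /osc_gauss big_ord_recl cons_rV0 /=.
under eq_bigr do rewrite cons_rVS /=.
have -> : dotp x (cons_rV (a, v)) = x ord0 ord0 * a + dotp x' v.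
  rewrite /dotp big_ord_recl cons_rV0; congr (_ + _).
  by apply: eq_bigr => i _; rewrite cons_rVS mxE.
rewrite -(addrA _ (dotp x' v) phi) (cosD _ (dotp x' v + phi)) addr0 (addrA _ phi) !cosBpihalf.
by rewrite /m'; ring.
Qed.

(** Each variable split off by the addition formula doubles the number of products, whence [2 ^+ n].
    The bounds [B i] are uniform in the phase because the splitting changes it. *)
Lemma norm_osc_integral_rV n (m : 'I_n -> nat) r (x : 'rV[R]_n) (B : 'I_n -> R) : 0 < r ->
  (forall i phi, `|osc_integral (m i) r (x ord0 i) phi| <= B i) ->
  forall phi, `|\int[@lebesgue_rV R n]_xi osc_gauss_rV m r x phi xi| <= 2 ^+ n * \prod_(i < n) B i.
Proof.
move=> r0; elim: n m x B => [|n IH] m x B hB phi.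
  rewrite big_ord0 expr0 mulr1.
  apply: normr_Rintegral_le => //; first exact: measurable_osc_gauss_rV.
  apply: (le_trans (integral_norm_osc_gauss_rV _ _ _ _)).
  rewrite (@ge0_integral_prod_rV _ _ (fun i a => `|a| ^+ m i * gauss_fun (r * a))).
  - by rewrite big_ord0.
  - by move=> [].
  - by move=> [].
pose x' : 'rV[R]_n := \row_i x ord0 (lift ord0 i); pose m' (i : 'I_n) := m (lift ord0 i).
pose J phi := \int[@lebesgue_rV R n]_xi osc_gauss_rV m' r x' phi xi.
pose I0 psi := osc_integral (m ord0) r (x ord0 ord0) psi.
have hJ psi : `|J psi| <= 2 ^+ n * \prod_(i < n) B (lift ord0 i).
  by apply: IH => i psi'; rewrite mxE; exact: hB.
have inner a : (\int[@lebesgue_rV R n]_v (osc_gauss_rV m r x phi (cons_rV (a, v)))%:E =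
   (osc_gauss (m ord0) r (x ord0 ord0) 0 a * J phi -
    osc_gauss (m ord0) r (x ord0 ord0) (- (pi / 2)) a * J (phi - pi / 2))%:E)%E.
  under eq_integral do rewrite osc_gauss_rVS.
  rewrite EFin_Rintegral; last first.
    rewrite /comp; under eq_fun do rewrite EFinB.
    apply: integrableB => //; under eq_fun do rewrite EFinM; apply: integrableZl => //;
      exact: integrable_osc_gauss_rV.
  rewrite RintegralB//.
  - by rewrite !RintegralZl//; exact: integrable_osc_gauss_rV.
  - by rewrite /comp; under eq_fun do rewrite EFinM; apply: integrableZl => //; exact: integrable_osc_gauss_rV.
  - by rewrite /comp; under eq_fun do rewrite EFinM; apply: integrableZl => //; exact: integrable_osc_gauss_rV.
have -> : \int[@lebesgue_rV R n.+1]_xi osc_gauss_rV m r x phi xi =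
    I0 0 * J phi - I0 (- (pi / 2)) * J (phi - pi / 2).
  rewrite /Rintegral integral_lebesgue_rVS; last exact: integrable_osc_gauss_rV.
  under eq_integral do rewrite inner.
  have iz psi c : lebesgue_measure.-integrable [set: R] (EFin \o (fun a => osc_gauss (m ord0) r (x ord0 ord0) psi a * c)).
    by rewrite /comp; under eq_fun do rewrite EFinM; apply: integrableZr => //; exact: integrable_osc_gauss.
  rewrite -[LHS]/(\int[lebesgue_measure]_a _) RintegralB//.
  by rewrite !RintegralZr//; exact: integrable_osc_gauss.
have B0 : 0 <= B ord0 by apply: le_trans (hB ord0 0).
have P0 : 0 <= 2 ^+ n * \prod_(i < n) B (lift ord0 i) by apply: le_trans (hJ 0).
apply: (le_trans (ler_normB _ _)); rewrite big_ord_recl exprS.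
rewrite (_ : 2 * _ * _ = B ord0 * (2 ^+ n * \prod_(i < n) B (lift ord0 i)) +
  B ord0 * (2 ^+ n * \prod_(i < n) B (lift ord0 i))); last by ring.
by rewrite lerD// normrM ler_pM//; exact: hB.
Qed.

End osc_gauss_rV.

(** * Kernel bounds *)

Section kernel_majorant.
Context {R : realType} {n : nat}.
Implicit Types (x : 'rV[R]_n) (r : R).

(* The l^1 norm splits sums over the coordinates without Cauchy-Schwarz. *)
Definition norm1 x : R := \sum_(i < n) `|x ord0 i|.

(* Any exponent strictly between d and d + 1 would do: more than d for the
   integrability, less than d + 1 for the integral over rho of the layers. *)
Definition majorant r x : R := r `^ 2^-1 * (r + norm1 x) `^ (- (n%:R + 2^-1)).

Lemma norm1_ge0 x : 0 <= norm1 x. Proof. exact: sumr_ge0. Qed.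

Lemma majorant_ge0 r x : 0 <= majorant r x.
Proof. by rewrite mulr_ge0 ?powR_ge0. Qed.

Lemma norm1_coord x i : `|x ord0 i| <= norm1 x.
Proof. by rewrite /norm1 (bigD1 i)//= lerDl sumr_ge0. Qed.

Lemma prod_1D_ge (a : 'I_n -> R) : (forall i, 0 <= a i) ->
  1 + \sum_(i < n) a i <= \prod_(i < n) (1 + a i).
Proof.
move=> a0; apply: (proj2 (_ : 0 <= \sum_(i < n) a i /\ _)).
apply: (big_rec2 (fun s p => 0 <= s /\ 1 + s <= p)); first by rewrite addr0.
move=> i s p _ [s0 sp]; split; first exact: addr_ge0.
have ai := a0 i; apply: (@le_trans _ _ ((1 + a i) * (1 + s))).
  by have := mulr_ge0 ai s0; lra.
by rewrite ler_wpM2l// addr_ge0.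
Qed.

Lemma norm1_prod_ge x r (M : nat) : 0 < r ->
  (1 + norm1 x / r) ^+ M <= \prod_(i < n) (1 + `|x ord0 i| / r) ^+ M.
Proof.
move=> r0; rewrite prodrXl /norm1 mulr_suml.
apply: lerXn2r; rewrite ?nnegrE ?addr_ge0 ?sumr_ge0 ?prodr_ge0//.
- by move=> i _; rewrite divr_ge0// ltW.
- by move=> i _; rewrite addr_ge0// divr_ge0// ltW.
- by apply: prod_1D_ge => i; rewrite divr_ge0// ltW.
Qed.

(** As r (1 + N/r) = r + N, the left side is (r + N)^-(n+1); half a power of it is given up through
    (r + N)^(-1/2) <= r^(-1/2). *)
Lemma inv_le_majorant r x : 0 < r ->
  (r ^+ n.+1 * (1 + norm1 x / r) ^+ n.+1)^-1 <= r^-1 * majorant r x.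
Proof.
move=> r0; rewrite -exprMn mulrDr mulr1 mulrCA divff ?gt_eqF// mulr1.
have s0 : 0 < r + norm1 x by rewrite ltr_wpDr// norm1_ge0.
rewrite /majorant mulrA -(powR_inv1 (ltW r0)) -gt0_powRD//.
rewrite -powR_mulrn ?(ltW s0)// -powRN.
rewrite (_ : - n.+1%:R = - 2^-1 + - (n%:R + 2^-1)); last by rewrite -addn1 natrD; lra.
rewrite (gt0_powRD (- 2^-1))// ler_wpM2r ?powR_ge0//.
rewrite (_ : -1 + 2^-1 = - 2^-1 :> R); last by lra.
by apply: ler_powRN => //; rewrite lerDl norm1_ge0.
Qed.

(** The decays in the single variables multiply, and the product of the factors 1 + |x_i|/r
    dominates 1 + N/r. *)
Lemma osc_integral_rV_decay (m : 'I_n -> nat) (M : nat) : exists2 A : R, 0 <= A &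
  forall r x phi, 0 < r ->
  `|\int[@lebesgue_rV R n]_xi osc_gauss_rV m r x phi xi| <=
  A / (r ^+ (n + \sum_(i < n) m i) * (1 + norm1 x / r) ^+ M).
Proof.
have /choice[A hA] (i : 'I_n) : exists A : R, 0 <= A /\ forall r x phi : R, 0 < r ->
    (1 + `|x| / r) ^+ M * (r ^+ (m i).+1 * `|osc_integral (m i) r x phi|) <= A.
  by have [A A0 H] := osc_integral_decay (R := R) M (m i); exists A.
exists (2 ^+ n * \prod_(i < n) A i).
  by rewrite mulr_ge0 ?exprn_ge0// prodr_ge0// => i _; exact: (hA i).1.
move=> r x phi r0.
have p0 (y : R) : 0 < 1 + `|y| / r by rewrite ltr_pwDl// divr_ge0// ltW.
have := @norm_osc_integral_rV R n m r x (fun i => A i / (r ^+ (m i).+1 * (1 + `|x ord0 i| / r) ^+ M)) r0.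
move=> /(_ _ phi) /le_trans; apply.
  move=> i psi; rewrite ler_pdivlMr; last by rewrite mulr_gt0 ?exprn_gt0.
  by rewrite mulrC -mulrA mulrCA; exact: (hA i).2.
rewrite -mulrA ler_wpM2l ?exprn_ge0// prodf_div ler_wpM2l//.
  by rewrite prodr_ge0// => i _; exact: (hA i).1.
rewrite lef_pV2 ?posrE; last 2 first.
- by rewrite prodr_gt0// => i _; rewrite mulr_gt0 ?exprn_gt0.
- by rewrite mulr_gt0 ?exprn_gt0// ltr_pwDl// divr_ge0 ?norm1_ge0// ltW.
rewrite big_split /= prodrXr (_ : (\sum_(i < n) (m i).+1 = n + \sum_(i < n) m i)%N).
  by rewrite ler_wpM2l ?exprn_ge0 ?(ltW r0)// norm1_prod_ge.
under eq_bigr do rewrite -add1n.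
by rewrite big_split /= sum1_card card_ord.
Qed.

(** The kernel is a product of one-dimensional Gaussians in x_i / (2 sqrt t), and each absorbs its
    own factor (1 + |x_i| / sqrt t)^(n+1). The normalisation is harmless because 4 pi >= 1. *)
Lemma heat_kernel_le_majorant : exists2 A : R, 0 <= A &
  forall t x, 0 < t -> 0 <= heat_kernel t x <= A * majorant (Num.sqrt t) x.
Proof.
have [A A0 hA] := moment_le_gauss (R := R) n.+1.
pose C : R := (4 ^+ n.+1 * (1 + A)).
have C0 : 0 <= C by rewrite mulr_ge0 ?exprn_ge0// addr_ge0// ltW.
have hC (u : R) : (1 + `|u|) ^+ n.+1 * gauss_fun (u / 2) <= C.
  have u0 := normr_ge0 u; have g0 := gauss_fun_ge0 (u / 2); have g1 := gauss_fun_le1 (u / 2).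
  apply: (@le_trans _ _ ((4 ^+ n.+1 * (1 + `|u / 2| ^+ n.+1)) * gauss_fun (u / 2))).
    rewrite ler_wpM2r//; have [u1|/ltW u1] := leP `|u| 1.
      apply: (@le_trans _ _ (4 ^+ n.+1 * 1)); last by rewrite ler_wpM2l ?exprn_ge0// lerDl exprn_ge0.
      by rewrite mulr1; apply: lerXn2r; rewrite ?nnegrE; lra.
    apply: (@le_trans _ _ (4 ^+ n.+1 * `|u / 2| ^+ n.+1)); last by rewrite ler_wpM2l ?exprn_ge0// lerDr.
    by rewrite -exprMn normrM normfV (@ger0_norm _ 2)//; apply: lerXn2r; rewrite ?nnegrE; lra.
  rewrite -mulrA ler_wpM2l ?exprn_ge0// mulrDl mul1r lerD//.
  by rewrite (le_trans (hA _))// ler_piMr ?(ltW A0)// gauss_fun_le1.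
exists (C ^+ n); first by rewrite exprn_ge0.
move=> t x t0; rewrite /heat_kernel mulr_ge0 ?powR_ge0 ?expR_ge0//=.
set r := Num.sqrt t; have r0 : 0 < r by rewrite sqrtr_gt0.
have tr : t = r ^+ 2 by rewrite sqr_sqrtr// ltW.
have p0 (y : R) : 0 < 1 + `|y| / r by rewrite ltr_pwDl// divr_ge0// ltW.
have e0 : 0 <= dotp x x by apply: sumr_ge0 => i _; rewrite -expr2 sqr_ge0.
have -> : expR (- (enorm x ^+ 2 / (4 * t))) = \prod_(i < n) gauss_fun (x ord0 i / r / 2).
  rewrite /gauss_fun -expR_sum; congr expR; rewrite sumrN; congr (- _).
  rewrite /enorm sqr_sqrtr// /dotp mulr_suml; apply: eq_bigr => i _.
  by rewrite tr; field; rewrite gt_eqF.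
apply: (@le_trans _ _ (r ^- n * (C ^+ n * ((1 + norm1 x / r) ^+ n.+1)^-1))); last first.
  rewrite mulrCA ler_wpM2l ?exprn_ge0//.
  have := ler_wpM2l (ltW r0) (inv_le_majorant x r0).
  rewrite (mulrA r r^-1) divff ?gt_eqF// mul1r; apply: le_trans.
  rewrite (invfM (r ^+ n.+1)) mulrA (exprS r) invfM mulrA divff ?(gt_eqF r0)// mul1r.
  by [].
rewrite ler_pM ?powR_ge0 ?prodr_ge0//.
- by move=> i _; exact: gauss_fun_ge0.
- have -> : r ^- n = t `^ (- (n%:R / 2)).
    by rewrite /r -powR12_sqrt ?(ltW t0)// -powR_mulrn ?powR_ge0// -powRrM -powRN; congr (_ `^ _); ring.
  apply: ler_powRN => //; rewrite ?divr_ge0//.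
  rewrite ler_peMl ?(ltW t0)//; have := pi_ge2 R; lra.
- rewrite ler_pdivlMr; last by rewrite exprn_gt0// ltr_pwDl// divr_ge0 ?norm1_ge0// ltW.
  apply: (@le_trans _ _ ((\prod_(i < n) gauss_fun (x ord0 i / r / 2)) * \prod_(i < n) (1 + `|x ord0 i| / r) ^+ n.+1)).
    rewrite ler_wpM2l ?norm1_prod_ge// prodr_ge0// => i _; exact: gauss_fun_ge0.
  rewrite -big_split /= -[leRHS]mulr1.
  rewrite (_ : C ^+ n * 1 = \prod_(i < n) C); last by rewrite prodr_const card_ord mulr1.
  apply: ler_prod => i _; rewrite mulr_ge0 ?gauss_fun_ge0 ?exprn_ge0 ?(ltW (p0 _))//= mulrC.
  by have := hC (x ord0 i / r); rewrite normrM normfV (gtr0_norm r0).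
Qed.

End kernel_majorant.

(** * The Oseen kernel *)

Section oseen_bound.
Context {R : realType} {d : nat}.
Implicit Types (x xi : 'rV[R]_d) (r t : R).
Local Notation leb := (@lebesgue_measure R).
Local Notation lebd := (@lebesgue_rV R d).

Lemma integral_2rho_gauss (r a : R) : 0 < r -> 0 < a ->
  (\int[leb]_(rho in `[r, +oo[) (2 * rho * expR (- (rho ^+ 2 * a)))%:E =
   (expR (- (r ^+ 2 * a)) / a)%:E)%E.
Proof.
move=> r0 a0.
pose F (z : R) := - a^-1 * expR (- (z ^+ 2 * a)).
pose f (z : R) := 2 * z * expR (- (z ^+ 2 * a)).
have dF (z : R) : is_derive z 1 F (f z).
  have -> : F = (- a^-1) \*: (expR \o (- (a \*: ((@id R) ^+ 2)))).
    by apply/funext => x; rewrite /F (mulrC (x ^+ 2)).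
  apply: is_derive_eq; rewrite /f /GRing.scale /= !fctE /GRing.scale /=.
  rewrite expr1 (_ : a *: z ^+ 2 = z ^+ 2 * a); last exact: mulrC.
  by field; rewrite gt_eqF.
have cF : continuous F.
  move=> z; apply/differentiable_continuous/derivable1_diffP.
  exact: (@ex_derive _ _ _ _ _ _ _ (dF z)).
rewrite (@ge0_continuous_FTC2y _ f F r 0)//.
- by rewrite sub0e -EFinN /F mulNr opprK mulrC.
- by move=> z rz; rewrite /f !mulr_ge0 ?expR_ge0// (le_trans (ltW r0)).
- apply: continuous_subspaceT => z; rewrite /f.
  apply: cvgM; first by apply: cvgM; [exact: cvg_cst|exact: cvg_id].
  apply: continuous_comp; last exact: continuous_expR.
  apply: cvgN; apply: cvgM; last exact: cvg_cst.
  exact: exprn_continuous.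
- rewrite -(mulr0 (- a^-1)); apply: cvgM; first exact: cvg_cst.
  apply: (@cvg_comp _ _ _ (fun z : R => z ^+ 2 * a) (fun z => expR (- z)) _ (pinfty_nbhs R)); last exact: cvgr_expR.
  by apply: gt0_cvgMly => //; exact: cvgr_expr2.
- by apply: cvg_at_right_filter; exact: cF.
- by move=> z _; rewrite derive1E (@derive_val _ _ _ _ _ _ _ (dF z)).
Qed.

(** [mono1] and [mono3] are the multi-indices of the monomials xi_l and xi_j xi_k xi_l, which occur
    in the two parts of the Oseen symbol. *)
Definition mono1 (l i : 'I_d) : nat := (i == l).
Definition mono3 (j k l i : 'I_d) : nat := ((i == j) + (i == k) + (i == l))%N.

Lemma sum_mono1 l : (\sum_(i < d) mono1 l i = 1)%N.
Proof. by rewrite /mono1 (bigD1 l)//= eqxx big1 ?addn0// => i /negPf ->. Qed.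

Lemma sum_mono3 j k l : (\sum_(i < d) mono3 j k l i = 3)%N.
Proof. by rewrite /mono3 !big_split /= !sum_mono1. Qed.

Lemma prod_mono1 (y : 'rV[R]_d) l : \prod_(i < d) y ord0 i ^+ mono1 l i = y ord0 l.
Proof.
rewrite /mono1 (bigD1 l)//= eqxx expr1 big1 ?mulr1// => i /negPf ->.
by rewrite expr0.
Qed.

Lemma prod_mono3 (y : 'rV[R]_d) j k l :
  \prod_(i < d) y ord0 i ^+ mono3 j k l i = y ord0 j * y ord0 k * y ord0 l.
Proof.
under eq_bigr do rewrite !exprD.
by rewrite !big_split /= !prod_mono1.
Qed.

Lemma prod_gauss_fun (y : 'rV[R]_d) r :
  \prod_(i < d) gauss_fun (r * y ord0 i) = expR (- (r ^+ 2 * dotp y y)).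
Proof.
rewrite /gauss_fun -expR_sum; congr expR; rewrite sumrN; congr (- _).
by rewrite /dotp mulr_sumr; apply: eq_bigr => i _; ring.
Qed.

Lemma osc_gauss_rVE (m : 'I_d -> nat) r x phi xi : osc_gauss_rV m r x phi xi =
  (\prod_(i < d) xi ord0 i ^+ m i) * expR (- (r ^+ 2 * dotp xi xi)) * cos (dotp x xi + phi).
Proof. by rewrite /osc_gauss_rV big_split /= prod_gauss_fun. Qed.

Lemma dotp_ge0 xi : 0 <= dotp xi xi.
Proof. by apply: sumr_ge0 => i _; rewrite -expr2 sqr_ge0. Qed.

Lemma enorm_sqr xi : enorm xi ^+ 2 = dotp xi xi.
Proof. by rewrite sqr_sqrtr// dotp_ge0. Qed.

(* The symbol is purely imaginary, hence the phase shift by [pi / 2]. *)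
Lemma Re_oseen_symbol t j k l x xi :
  complex.Re (expi (dotp x xi) * oseen_symbol t j k l xi) =
  ((j == k)%:R - xi ord0 j * xi ord0 k / dotp xi xi) * xi ord0 l *
  expR (- (t * dotp xi xi)) * cos (dotp x xi + pi / 2).
Proof.
rewrite /expi /oseen_symbol enorm_sqr cosDpihalf /=.
by rewrite !(mul0r, mulr0, subr0, sub0r, add0r, addr0); ring.
Qed.

Lemma oseen_kernelE t j k l x : oseen_kernel t j k l x =
  ((2 * pi) ^+ d)^-1 * \int[lebd]_xi
    (((j == k)%:R - xi ord0 j * xi ord0 k / dotp xi xi) * xi ord0 l *
     expR (- (t * dotp xi xi)) * cos (dotp x xi + pi / 2)).
Proof.
have ReM (c a b : R) : complex.Re (Complex c 0 * Complex a b) = c * a.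
  by rewrite /= mul0r subr0.
rewrite /oseen_kernel /inverse_fourier ReM; congr (_ * _).
by apply: eq_Rintegral => xi _; rewrite -Re_oseen_symbol.
Qed.

Lemma measurable_fun_leb d' (T : measurableType d') (f g : T -> R) : measurable_fun [set: T] f ->
  measurable_fun [set: T] g -> measurable_fun [set: T] (fun y => (f y <= g y)%R%:R : R).
Proof.
move=> mf mg.
apply: (@measurableT_comp _ _ _ _ _ _ (fun b : bool => b%:R : R) _ (fun y => (f y <= g y)%R)) => //.
exact: measurable_fun_ler.
Qed.

Lemma ge0_integral_indic_itvy (f : R -> R) (r : R) : measurable_fun [set: R] f ->
  (\int[leb]_rho ((r <= rho)%R%:R * f rho)%:E = \int[leb]_(rho in `[r, +oo[) (f rho)%:E)%E.
Proof.
move=> mf; rewrite [RHS]integral_mkcond; apply: eq_integral => rho _.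
rewrite patchE; case: ifPn => [|/negP]; rewrite inE /= in_itv/= andbT => h.
  by rewrite h mul1r.
by move/negP/negPf : h => ->; rewrite mul0r.
Qed.

Lemma integral_tail_powR (c e r : R) : 0 <= c -> 0 < e -> 0 < r ->
  (\int[leb]_rho ((r <= rho)%R%:R * (c * rho `^ (- 1 - e)))%:E = (c * (r `^ (- e) / e))%:E)%E.
Proof.
move=> c0 e0 r0; rewrite (@ge0_integral_indic_itvy (fun rho => c * rho `^ (- 1 - e))); last first.
  by apply: measurable_funM => //; exact: measurable_fun_powR.
under eq_integral do rewrite EFinM.
rewrite ge0_integralZl ?integral_powR_itvy//; last first.
  by move=> z _; rewrite lee_fin powR_ge0.
by apply/measurable_EFinP; apply: measurable_funTS; exact: measurable_fun_powR.
Qed.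

Definition singular_symbol j k l r x phi xi : R :=
  xi ord0 j * xi ord0 k / dotp xi xi * xi ord0 l * expR (- (r ^+ 2 * dotp xi xi)) *
  cos (dotp x xi + phi).

(* Integrating the layers over rho > r gives the symbol with its singularity. *)
Definition heat_layer j k l r x phi (p : 'rV[R]_d * R) : R :=
  (r <= p.2)%R%:R * (2 * p.2 * osc_gauss_rV (mono3 j k l) p.2 x phi p.1).

Lemma measurable_heat_layer j k l r x phi : measurable_fun [set: 'rV[R]_d * R] (heat_layer j k l r x phi).
Proof.
have m1 : measurable_fun [set: 'rV[R]_d * R] (fun p => p.1) by exact: measurable_fst.
have m2 : measurable_fun [set: 'rV[R]_d * R] (fun p => p.2) by exact: measurable_snd.
apply: measurable_funM.
  by apply: measurable_fun_leb.
apply: measurable_funM; first exact: measurable_funM.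
under eq_fun do rewrite osc_gauss_rVE.
apply: measurable_funM.
  apply: measurable_funM.
    apply: measurable_prod => i _; apply: measurable_funX.
    exact: (measurableT_comp (measurable_rV_coord i)).
  apply: measurableT_comp => //; apply: measurableT_comp => //.
  by apply: measurable_funM; [exact: measurable_funX|exact: measurable_fun_dotp].
apply: measurable_fun_cos; apply: measurable_funD => //.
by apply: measurable_fun_dotp => //; exact: measurable_cst.
Qed.

Lemma integral_heat_layer j k l r x phi xi : 0 < r ->
  (\int[leb]_rho (heat_layer j k l r x phi (xi, rho))%:E = (singular_symbol j k l r x phi xi)%:E)%E.
Proof.
move=> r0; rewrite /heat_layer /= /singular_symbol.
(* At xi = 0 the factor xi_l makes both the layers and the symbol vanish, whatever the quotient by 0
   is. *)
have [D0|D0] := ltP 0 (dotp xi xi); last first.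
  have xl : xi ord0 l = 0.
    apply/eqP; rewrite -sqrf_eq0 eq_le sqr_ge0 andbT (le_trans _ D0)//.
    by rewrite /dotp (bigD1 l)//= -expr2 lerDl sumr_ge0// => i _; rewrite -expr2 sqr_ge0.
  under eq_integral do rewrite osc_gauss_rVE prod_mono3 xl !(mulr0, mul0r).
  by rewrite xl !(mulr0, mul0r) integral0.
pose c := xi ord0 j * xi ord0 k * xi ord0 l * cos (dotp x xi + phi).
pose f rho := 2 * rho * expR (- (rho ^+ 2 * dotp xi xi)).
have mf : measurable_fun [set: R] f.
  apply: measurable_funM; first exact: measurable_funM.
  apply: measurableT_comp => //; apply: measurableT_comp => //.
  by apply: measurable_funM => //; exact: measurable_funX.
have If : (\int[leb]_rho ((r <= rho)%R%:R * f rho)%:E = (expR (- (r ^+ 2 * dotp xi xi)) / dotp xi xi)%:E)%E.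
  by rewrite ge0_integral_indic_itvy// integral_2rho_gauss.
have mrf : measurable_fun [set: R] (fun rho => (r <= rho)%R%:R * f rho).
  apply: measurable_funM => //.
  by apply: measurable_fun_leb.
under eq_integral => rho _.
  rewrite osc_gauss_rVE prod_mono3.
  rewrite (_ : _ * (_ * _) = c * ((r <= rho)%R%:R * f rho)); last by rewrite /c /f; ring.
  rewrite EFinM; over.
rewrite /= integralZl//.
  by rewrite If -EFinM; congr (_%:E); rewrite /c; field; rewrite gt_eqF.
apply/integrableP; split; first exact/measurable_EFinP.
under eq_integral => rho _.
  rewrite /= ger0_norm; first over.
  have [rr|] := leP r rho; last by rewrite mul0r.
  by rewrite mul1r /f !mulr_ge0 ?expR_ge0// (le_trans (ltW r0)).
by rewrite /= If ltry.
Qed.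

(** Integrating in xi first, the moment of order 3 is of size rho^-(d+3); with the factor 2 rho this
    leaves rho^-(d+2), integrable on rho > r. *)
Lemma integrable_heat_layer j k l r x phi : 0 < r ->
  (lebd \x leb)%E.-integrable [set: _] (EFin \o heat_layer j k l r x phi).
Proof.
move=> r0; have [A A0 hA] := integral_gauss_moment_rV (R := R) (mono3 j k l).
apply/integrable21ltyP; first by apply/measurable_EFinP; exact: measurable_heat_layer.
apply: (@le_lt_trans _ _ (\int[leb]_rho ((r <= rho)%R%:R * (2 * A * rho `^ (- 1 - d.+1%:R)))%:E)%E); last first.
  by rewrite integral_tail_powR ?ltry// mulr_ge0// ltW.
apply: ge0_le_integral => //.
- by move=> rho _; apply: integral_ge0 => xi _.
- apply: (measurable_fun_fubini_tonelli_G (abse \o (EFin \o heat_layer j k l r x phi))) => //.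
    by apply: measurableT_comp => //; apply/measurable_EFinP; exact: measurable_heat_layer.
  by move=> y; exact: abse_ge0.
- apply/measurable_EFinP; apply: measurable_funM.
    by apply: measurable_fun_leb.
  by apply: measurable_funM => //; exact: measurable_fun_powR.
move=> rho _; rewrite /heat_layer /=; have [rr|_] := leP r rho; last first.
  by under eq_integral do rewrite mul0r normr0; rewrite integral0 mul0r.
have rho0 : 0 < rho by exact: lt_le_trans rr.
rewrite mul1r.
under eq_integral => xi _.
  rewrite mul1r normrM (@ger0_norm _ (2 * rho)) ?mulr_ge0 ?(ltW rho0)// EFinM; over.
rewrite /= ge0_integralZl//; last 2 first.
- by apply/measurable_EFinP/measurable_fun_norm; exact: measurable_osc_gauss_rV.
- by rewrite lee_fin mulr_ge0// ltW.
apply: (@le_trans _ _ ((2 * rho)%:E * (A / rho ^+ (d + 3))%:E)%E).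
  rewrite lee_pmul2l ?lte_fin ?mulr_gt0//.
  have := hA rho rho0; rewrite sum_mono3; apply: le_trans.
  exact: integral_norm_osc_gauss_rV.
rewrite -EFinM lee_fin.
rewrite (_ : 2 * rho * _ = 2 * A * (rho * rho ^- (d + 3))); last by ring.
rewrite ler_wpM2l ?mulr_ge0 ?(ltW A0)//.
rewrite addnS exprS invfM mulrA divff ?(gt_eqF rho0)// mul1r.
rewrite -powR_mulrn ?(ltW rho0)// -powRN.
rewrite (_ : - (d + 2)%:R = -1 - d.+1%:R :> R)//.
by rewrite -(addn1 d) !natrD; lra.
Qed.

(** After Fubini, the layer at rho is at most 2 A rho^-2 [majorant rho x], that is 2 A rho^(-3/2)
    (rho + N)^-(d + 1/2). Replacing rho + N by r + N leaves the tail integral of rho^(-3/2), equal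
    to 2 r^(-1/2); hence the constant 4 A. *)
Lemma singular_bound j k l : exists2 A : R, 0 <= A & forall r x phi, 0 < r ->
  lebd.-integrable setT (EFin \o singular_symbol j k l r x phi) /\
  `|\int[lebd]_xi singular_symbol j k l r x phi xi| <= A * (r^-1 * majorant r x).
Proof.
have [A A0 hA] := osc_integral_rV_decay (R := R) (mono3 j k l) d.+1.
exists (4 * A); first by rewrite mulr_ge0.
move=> r x phi r0; have intH := integrable_heat_layer j k l x phi r0.
have FE : fubini_F leb (EFin \o heat_layer j k l r x phi) = EFin \o singular_symbol j k l r x phi.
  by apply/funext => xi; rewrite /fubini_F /comp /= integral_heat_layer.
have intg : lebd.-integrable setT (EFin \o singular_symbol j k l r x phi).
  by rewrite -FE; exact: integrable_fubini_F.
split => //; rewrite -lee_fin EFin_normr_Rintegral//.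
have -> : (\int[lebd]_xi (singular_symbol j k l r x phi xi)%:E =
    \int[leb]_rho \int[lebd]_xi (heat_layer j k l r x phi (xi, rho))%:E)%E.
  rewrite -(Fubini intH); apply: eq_integral => xi _.
  by rewrite integral_heat_layer.
pose c := 2 * A * (r + norm1 x) `^ (- (d%:R + 2^-1)).
have c0 : 0 <= c by rewrite !mulr_ge0 ?powR_ge0.
apply: (@le_trans _ _ (\int[leb]_rho ((r <= rho)%R%:R * (c * rho `^ (- 1 - 2^-1)))%:E)%E); last first.
  rewrite integral_tail_powR// lee_fin /majorant invrK /c.
  have -> : r `^ (- 2^-1) = r^-1 * r `^ 2^-1.
    by rewrite -(powR_inv1 (ltW r0)) -gt0_powRD//; congr (_ `^ _); lra.
  by rewrite le_eqVlt; apply/orP; left; apply/eqP; ring.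
have mG := measurable_fubini_G intH.
apply: (le_trans (le_abse_integral _ _ _)) => //.
apply: ge0_le_integral => //.
- exact: measurableT_comp.
- apply/measurable_EFinP; apply: measurable_funM.
    by apply: measurable_fun_leb.
  by apply: measurable_funM => //; exact: measurable_fun_powR.
move=> rho _; rewrite /heat_layer /=; have [rr|_] := leP r rho; last first.
  by under eq_integral do rewrite mul0r; rewrite integral0 abse0 mul0r.
have rho0 : 0 < rho by exact: lt_le_trans rr.
rewrite mul1r.
under eq_integral do rewrite mul1r EFinM.
rewrite integralZl//; last exact: integrable_osc_gauss_rV.
rewrite EFin_Rintegral; last exact: integrable_osc_gauss_rV.
rewrite -EFinM lee_fin normrM (@ger0_norm _ (2 * rho)); last by rewrite mulr_ge0// ltW.
apply: (@le_trans _ _ (2 * rho * (A / (rho ^+ (d + 3) * (1 + norm1 x / rho) ^+ d.+1)))).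
  rewrite ler_wpM2l ?mulr_ge0 ?(ltW rho0)//.
  by have := hA rho x phi rho0; rewrite sum_mono3.
have := inv_le_majorant x rho0; set Y := (1 + norm1 x / rho) ^+ d.+1 => hM.
have Y0 : 0 < Y by rewrite exprn_gt0// ltr_pwDl// divr_ge0 ?norm1_ge0// ltW.
rewrite (_ : 2 * rho * _ = 2 * A * (rho^-1 * (rho ^+ d.+1 * Y)^-1)); last first.
  by rewrite addnS addn2 !exprS; field; rewrite !gt_eqF// exprn_gt0.
rewrite /c -!mulrA ler_wpM2l// ler_wpM2l//.
apply: (@le_trans _ _ (rho^-1 * (rho^-1 * majorant rho x))).
  by rewrite ler_wpM2l// invr_ge0 ltW.
rewrite /majorant !mulrA -(powR_inv1 (ltW rho0)) -!gt0_powRD// mulrC.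
rewrite (_ : -1 + -1 + 2^-1 = - 1 - 2^-1 :> R); last by lra.
rewrite ler_wpM2r ?powR_ge0//; apply: ler_powRN.
- by rewrite addr_ge0.
- by rewrite ltr_wpDr// norm1_ge0.
- by rewrite lerD2r.
Qed.

Lemma oseen_kernel_le_majorant : exists2 A : R, 0 <= A &
  forall t j k l x, 0 < t ->
  `|oseen_kernel t j k l x| <= A * ((Num.sqrt t)^-1 * majorant (Num.sqrt t) x).
Proof.
have /choice[S hS] (p : 'I_d * 'I_d * 'I_d) : exists A : R, 0 <= A /\ forall r x phi, 0 < r ->
  lebd.-integrable setT (EFin \o singular_symbol p.1.1 p.1.2 p.2 r x phi) /\
  `|\int[lebd]_xi singular_symbol p.1.1 p.1.2 p.2 r x phi xi| <= A * (r^-1 * majorant r x).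
  by have [A A0 hA] := singular_bound p.1.1 p.1.2 p.2; exists A.
have /choice[G hG] (l : 'I_d) : exists A : R, 0 <= A /\ forall r x phi, 0 < r ->
  `|\int[lebd]_xi osc_gauss_rV (mono1 l) r x phi xi| <=
  A / (r ^+ (d + \sum_(i < d) mono1 l i) * (1 + norm1 x / r) ^+ d.+1).
  by have [A A0 hA] := osc_integral_rV_decay (R := R) (mono1 l) d.+1; exists A.
(* Summing over all indices makes the constant independent of j, k, l. *)
exists (\sum_p S p + \sum_l G l).
  by rewrite addr_ge0// sumr_ge0// => p _; [exact: (hS p).1|exact: (hG p).1].
move=> t j k l x t0; set r := Num.sqrt t; have r0 : 0 < r by rewrite sqrtr_gt0.
have tr : t = r ^+ 2 by rewrite sqr_sqrtr// ltW.
have M0 : 0 <= r^-1 * majorant r x by rewrite mulr_ge0 ?majorant_ge0 ?invr_ge0 ?(ltW r0).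
have c1 : ((2 * pi) ^+ d)^-1 <= 1 :> R.
  rewrite invf_le1 ?exprn_gt0 ?mulr_gt0 ?pi_gt0//; apply: exprn_ege1.
  have := pi_ge2 R; lra.
rewrite oseen_kernelE normrM ger0_norm ?invr_ge0 ?exprn_ge0 ?mulr_ge0 ?pi_ge0//.
rewrite -[leRHS]mul1r ler_pM ?invr_ge0 ?exprn_ge0 ?mulr_ge0 ?pi_ge0//.
have [intS leS] := (hS (j, k, l)).2 r x (pi / 2) r0; rewrite /= in intS leS.
have leG := (hG l).2 r x (pi / 2) r0.
have intG := integrable_osc_gauss_rV (mono1 l) x (pi / 2) r0.
have {}leG : `|\int[lebd]_xi osc_gauss_rV (mono1 l) r x (pi / 2) xi| <= G l * (r^-1 * majorant r x).
  apply: (le_trans leG); rewrite sum_mono1 addn1 ler_wpM2l//; first exact: (hG l).1.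
  exact: inv_le_majorant.
have intG' : lebd.-integrable setT (EFin \o (fun xi => (j == k)%:R * osc_gauss_rV (mono1 l) r x (pi / 2) xi)).
  by rewrite /comp; under eq_fun do rewrite EFinM; exact: integrableZl.
rewrite (@eq_Rintegral _ _ _ _ _ (fun xi => (j == k)%:R * osc_gauss_rV (mono1 l) r x (pi / 2) xi -
    singular_symbol j k l r x (pi / 2) xi)); last first.
  by move=> xi _; rewrite osc_gauss_rVE prod_mono1 /singular_symbol tr; ring.
rewrite RintegralB// RintegralZl// [leRHS]mulrDl; apply: (le_trans (ler_normB _ _)); rewrite addrC lerD//.
  apply: (le_trans leS); rewrite ler_wpM2r// (bigD1 (j, k, l))//= lerDl sumr_ge0// => p _.
  exact: (hS p).1.
rewrite normrM; apply: (@le_trans _ _ (1 * (G l * (r^-1 * majorant r x)))).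
  by rewrite ler_pM//; case: (j == k); rewrite ?normr1 ?normr0.
rewrite mul1r ler_wpM2r// (bigD1 l)//= lerDl sumr_ge0// => p _.
exact: (hG p).1.
Qed.

End oseen_bound.

(** * The Duhamel operator in weighted spaces *)

Section spatial_estimate.
Context {R : realType} {d : nat}.
Hypothesis d_gt0 : (0 < d)%N.
Implicit Types (x y : 'rV[R]_d) (r t : R).
Local Notation leb := (@lebesgue_measure R).
Local Notation lebd := (@lebesgue_rV R d).

Lemma ler_norm1D x y : norm1 (x + y) <= norm1 x + norm1 y.
Proof. by rewrite /norm1 -big_split /= ler_sum// => i _; rewrite mxE ler_normD. Qed.

Lemma norm1_eq0 x : norm1 x = 0 -> x = 0.
Proof.
move=> x0; apply/rowP => i; rewrite mxE.
by have := norm1_coord x i; rewrite x0 normr_le0 => /eqP.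
Qed.

Lemma measurable_fun_norm1 e (T : measurableType e) (f : T -> 'rV[R]_d) :
  measurable_fun [set: T] f -> measurable_fun [set: T] (fun z => norm1 (f z)).
Proof.
move=> mf; apply: measurable_sum => i; apply: measurable_fun_norm.
exact: (measurableT_comp (measurable_rV_coord i)).
Qed.

Lemma measurable_fun_majorant e (T : measurableType e) (f : T -> R) (g : T -> 'rV[R]_d) :
  measurable_fun [set: T] f -> measurable_fun [set: T] g ->
  measurable_fun [set: T] (fun z => majorant (f z) (g z)).
Proof.
move=> mf mg; apply: measurable_funM; first exact: measurable_fun_powR.
apply: measurable_fun_powR; apply: measurable_funD => //.
exact: measurable_fun_norm1.
Qed.

Lemma measurable_fun_subr e (T : measurableType e) (f g : T -> 'rV[R]_d) :
  measurable_fun [set: T] f -> measurable_fun [set: T] g ->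
  measurable_fun [set: T] (fun z => f z - g z).
Proof.
move=> mf mg; apply: measurable_fun_rV => i.
under eq_fun do rewrite !mxE.
by apply: measurable_funB; exact: (measurableT_comp (measurable_rV_coord i)).
Qed.

Lemma prod_powR (I : finType) (z : R) (e : I -> R) : 0 < z ->
  \prod_i z `^ e i = z `^ (\sum_i e i).
Proof.
move=> z0; apply: (big_rec2 (fun p s => p = z `^ s)); first by rewrite powRr0.
by move=> i p s _ ->; rewrite gt0_powRD.
Qed.

Lemma integral_majorant : exists2 C : R, 0 <= C & forall r x, 0 < r ->
  (\int[lebd]_y (majorant r (x - y))%:E <= C%:E)%E.
Proof.
(* This [e] shares the exponent equally: d + 1/2 = d (1 + e). Each coordinate receives the
   integrable power -1-e, because r + N dominates r + |x_i - y_i|; the powers r^e and r^-e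
   cancel. *)
pose e : R := (2 * d%:R)^-1.
have dR0 : 0 < d%:R :> R by rewrite ltr0n.
have e0 : 0 < e by rewrite invr_gt0 mulr_gt0.
exists ((2 + 2 / e) ^+ d); first by rewrite exprn_ge0// addr_ge0// divr_ge0// ltW.
move=> r x r0.
pose f (i : 'I_d) a := r `^ e * (r + `|x ord0 i - a|) `^ (- 1 - e).
have mf i : measurable_fun [set: R] (f i).
  apply: measurable_funM => //; apply: measurable_fun_powR; apply: measurable_funD => //.
  by apply: measurable_fun_norm; exact: measurable_funB.
apply: (@le_trans _ _ (\int[lebd]_y (\prod_(i < d) f i (y ord0 i))%:E)%E).
  apply: ge0_le_integral => //.
  - by move=> y _; rewrite lee_fin majorant_ge0.
  - apply/measurable_EFinP; apply: measurable_fun_majorant => //.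
    by apply: measurable_fun_subr => //; exact: measurable_cst.
  - by apply/measurable_EFinP; exact: measurable_prod_rV.
  move=> y _; rewrite lee_fin /majorant /f big_split /= prod_powR// sumr_const card_ord.
  have -> : e *+ d = 2^-1.
    by rewrite /e -mulr_natr; field; rewrite gt_eqF.
  rewrite ler_wpM2l ?powR_ge0//.
  have s0 : 0 < r + norm1 (x - y) by rewrite ltr_wpDr// norm1_ge0.
  have -> : - (d%:R + 2^-1) = \sum_(i < d) (- 1 - e).
    by rewrite sumr_const card_ord /e -mulr_natr; field; rewrite gt_eqF.
  rewrite -prod_powR//; apply: ler_prod => i _; rewrite powR_ge0/=.
  rewrite -opprD; apply: ler_powRN.
  - by rewrite addr_ge0// ltW.
  - by rewrite ltr_wpDr.
  - by rewrite lerD2l; have := norm1_coord (x - y) i; rewrite !mxE.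
rewrite (_ : _ ^+ d = \prod_(i < d) (2 + 2 / e)); last by rewrite prodr_const card_ord.
apply: ge0_integral_prod_rV_le => //.
  by move=> i a; rewrite mulr_ge0 ?powR_ge0.
move=> i; under eq_integral do rewrite EFinM.
rewrite ge0_integralZl//; last 3 first.
- apply/measurable_EFinP; apply: measurable_fun_powR; apply: measurable_funD => //.
  by apply: measurable_fun_norm; exact: measurable_funB.
- by move=> a _; rewrite lee_fin powR_ge0.
- by rewrite lee_fin powR_ge0.
apply: (@le_trans _ _ ((r `^ e)%:E * ((2 + 2 / e) * r `^ (- e))%:E)%E).
  by rewrite lee_pmul2l ?lte_fin ?powR_gt0//; exact: integral_shifted_powR.
by rewrite -EFinM lee_fin mulrCA -gt0_powRD// subrr powRr0 mulr1.
Qed.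

(** Cut at N(y) = rho, half of max(r, N(x)). Beyond, N(y)^-g <= rho^-g and the majorant has bounded
    mass. Inside, r + N(x-y) >= rho, so the majorant is at most 2 rho^-d, while N(y)^-g is at most
    the product of the |y_i|^(-g/d), each integrable because g < d. *)
Lemma integral_majorant_powR (g : R) : 0 <= g < d%:R -> exists2 C : R, 0 <= C & forall r x, 0 < r ->
  (\int[lebd]_y (majorant r (x - y) * norm1 y `^ (- g))%:E <=
   (C * Num.max r (norm1 x) `^ (- g))%:E)%E.
Proof.
move=> /andP[g0 gd]; have [C1 C10 hC1] := integral_majorant.
have dR0 : 0 < d%:R :> R by rewrite ltr0n.
pose a : R := g / d%:R; have a1 : a < 1 by rewrite ltr_pdivrMr// mul1r.
have a0 : 0 <= a by rewrite divr_ge0// ltW.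
have ca0 : 0 <= 2 / (1 - a) by rewrite divr_ge0// subr_ge0 ltW.
exists (2 `^ g * (C1 + 2 * (2 / (1 - a)) ^+ d)).
  by rewrite mulr_ge0 ?powR_ge0// addr_ge0// mulr_ge0// exprn_ge0.
move=> r x r0; set m := Num.max _ _; have m0 : 0 < m by rewrite lt_max r0.
pose rho := m / 2; have rho0 : 0 < rho by rewrite divr_gt0.
pose f (i : 'I_d) := cut_powR a rho.
have mmaj : measurable_fun [set: 'rV[R]_d] (fun y => majorant r (x - y)).
  apply: measurable_fun_majorant => //.
  by apply: measurable_fun_subr => //; exact: measurable_cst.
have mN : measurable_fun [set: 'rV[R]_d] (fun y => norm1 y `^ (- g)).
  by apply: measurable_fun_powR; exact: measurable_fun_norm1.
have mprod : measurable_fun [set: 'rV[R]_d] (fun y => \prod_(i < d) f i (y ord0 i)).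
  by apply: (@measurable_prod_rV _ _ f) => i; exact: measurable_cut_powR.
have prod0 y : 0 <= \prod_(i < d) f i (y ord0 i) by apply: prodr_ge0 => i _; exact: cut_powR_ge0.
apply: (@le_trans _ _ (\int[lebd]_y ((rho `^ (- g) * majorant r (x - y))%:E +
   (2 * rho `^ (- d%:R) * \prod_(i < d) f i (y ord0 i))%:E))%E).
  apply: ae_ge0_le_integral => //.
  - by move=> y _; rewrite lee_fin mulr_ge0 ?majorant_ge0 ?powR_ge0.
  - by apply/measurable_EFinP; exact: measurable_funM.
  - by move=> y _; rewrite -EFinD lee_fin addr_ge0// !mulr_ge0 ?majorant_ge0 ?powR_ge0.
  - apply/measurable_EFinP; apply: measurable_funD; exact: measurable_funM.
  apply: filterS (ae_coord_neq0 (R := R) d) => y y0 _.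
  rewrite -EFinD lee_fin; have [rN|Nr] := leP rho (norm1 y).
    rewrite -[leLHS]addr0 lerD ?mulr_ge0 ?powR_ge0// mulrC ler_wpM2r ?majorant_ge0//.
    exact: ler_powRN.
  rewrite -[leLHS]add0r lerD ?mulr_ge0 ?majorant_ge0 ?powR_ge0//.
  have yi0 i : 0 < `|y ord0 i| by rewrite normr_gt0.
  have Ny0 : 0 < norm1 y.
    by apply: (lt_le_trans (yi0 (Ordinal d_gt0))); exact: norm1_coord.
  apply: ler_pM; rewrite ?majorant_ge0 ?powR_ge0//.
    have rm : r <= 2 * rho by rewrite /rho mulrC divfK// le_max lexx.
    have mx : norm1 x <= norm1 (x - y) + norm1 y.
      by rewrite -{1}(subrK y x) ler_norm1D.
    have s0 : rho <= r + norm1 (x - y).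
      have : m <= r + norm1 x by rewrite ge_max lerDl lerDr norm1_ge0 ltW.
      have -> : m = 2 * rho by rewrite /rho mulrC divfK.
      lra.
    apply: (@le_trans _ _ ((2 * rho) `^ 2^-1 * rho `^ (- (d%:R + 2^-1)))).
      apply: ler_pM; rewrite ?powR_ge0//.
        by apply: ge0_ler_powR; rewrite ?nnegrE ?mulr_ge0// ltW.
      by apply: ler_powRN => //; rewrite addr_ge0// ltW.
    rewrite powRM ?(ltW rho0)// -mulrA -gt0_powRD// (_ : 2^-1 - (d%:R + 2^-1) = - d%:R); last by lra.
    by rewrite ler_wpM2r ?powR_ge0// -[leRHS]powRr1// ler_powR ?ler1n//; lra.
  have -> : - g = \sum_(i < d) - a.
    by rewrite sumr_const card_ord /a -mulr_natr; field; rewrite gt_eqF.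
  rewrite -prod_powR//; apply: ler_prod => i _; rewrite powR_ge0/= /f /cut_powR.
  have yN := norm1_coord y i; rewrite (le_lt_trans yN Nr) mulr1.
  exact: ler_powRN.
rewrite ge0_integralD//; last 4 first.
- by move=> y _; rewrite lee_fin mulr_ge0 ?majorant_ge0 ?powR_ge0.
- by apply/measurable_EFinP; exact: measurable_funM.
- by move=> y _; rewrite lee_fin !mulr_ge0 ?powR_ge0.
- by apply/measurable_EFinP; exact: measurable_funM.
under eq_integral do rewrite EFinM.
under [X in (_ + X)%E]eq_integral do rewrite EFinM.
rewrite !ge0_integralZl//; first last.
- by rewrite lee_fin powR_ge0.
- by move=> y _; rewrite lee_fin majorant_ge0.
- exact/measurable_EFinP.
- by rewrite lee_fin mulr_ge0 ?powR_ge0.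
- by move=> y _; rewrite lee_fin.
- exact/measurable_EFinP.
apply: (@le_trans _ _ ((rho `^ (- g))%:E * C1%:E + (2 * rho `^ (- d%:R))%:E *
    (\prod_(i < d) (2 * rho `^ (1 - a) / (1 - a)))%:E)%E).
  rewrite leeD//.
    by rewrite lee_pmul2l ?lte_fin ?powR_gt0//; exact: hC1.
  rewrite lee_pmul2l ?lte_fin ?mulr_gt0 ?powR_gt0//.
  apply: (@ge0_integral_prod_rV_le _ _ f).
  - by move=> i; exact: measurable_cut_powR.
  - by move=> i z; exact: cut_powR_ge0.
  - by move=> i; exact: integral_cut_powR.
rewrite -!EFinM -EFinD lee_fin prodr_const card_ord.
have -> : m `^ (- g) = (2 `^ g)^-1 * rho `^ (- g).
  by rewrite /rho -powRN powRM ?invr_ge0 ?(ltW m0)// mulrCA -powR_inv1// -powRrM mulN1r opprK -gt0_powRD// addNr powRr0 mulr1.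
rewrite (_ : (2 * rho `^ (1 - a) / (1 - a)) ^+ d = (2 / (1 - a)) ^+ d * rho `^ (d%:R - g)); last first.
  rewrite mulrAC exprMn; congr (_ * _).
  rewrite -powR_mulrn ?powR_ge0// -powRrM; congr (_ `^ _).
  by rewrite /a; field; rewrite gt_eqF.
rewrite (_ : 2 * rho `^ (- d%:R) * _ = 2 * (2 / (1 - a)) ^+ d * rho `^ (- g)); last first.
  rewrite (_ : rho `^ (- g) = rho `^ (- d%:R) * rho `^ (d%:R - g)); first by ring.
  by rewrite -gt0_powRD// addrA addNr add0r.
have p20 : 2 `^ g != 0 :> R by rewrite gt_eqF// powR_gt0.
by rewrite le_eqVlt; apply/orP; left; apply/eqP; field.
Qed.

(** The alternative excludes N = 0 with g' > 0, where the power N^-g' is 0 by convention and the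
    bound fails. *)
Lemma max_powRN (r N g g' : R) : 0 < r -> 0 <= N -> 0 <= g' <= g -> (g' = 0 \/ 0 < N) ->
  Num.max r N `^ (- g) <= r `^ (- (g - g')) * N `^ (- g').
Proof.
move=> r0 N0 /andP[g'0 g'g] hN.
have m0 : 0 < Num.max r N by rewrite lt_max r0.
rewrite (_ : - g = - (g - g') + - g'); last by ring.
rewrite gt0_powRD// ler_pM ?powR_ge0//.
  by apply: ler_powRN; rewrite ?subr_ge0// le_max lexx.
case: hN => [->|Np]; first by rewrite oppr0 !powRr0.
by apply: ler_powRN; rewrite // le_max lexx orbT.
Qed.

(** The inverse is written as f (f^2)^-1 with a real power. The square handles negative values of f,
    and at f = 0 both sides are 0. *)
Lemma measurable_fun_inv e (T : measurableType e) (f : T -> R) :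
  measurable_fun [set: T] f -> measurable_fun [set: T] (fun z => (f z)^-1).
Proof.
move=> mf; have -> : (fun z => (f z)^-1) = (fun z => f z * (f z ^+ 2) `^ (-1)).
  apply/funext => z; rewrite powR_inv1 ?sqr_ge0//.
  have [->|fz] := eqVneq (f z) 0; first by rewrite mul0r invr0.
  by rewrite expr2 invfM mulrA divff// mul1r.
by apply: measurable_funM => //; apply: measurable_fun_powR; exact: measurable_funX.
Qed.

Lemma measurable_fun_sqrt e (T : measurableType e) (f : T -> R) :
  measurable_fun [set: T] f -> measurable_fun [set: T] (fun z => Num.sqrt (f z)).
Proof.
by apply: measurableT_comp; apply: continuous_measurable_fun; exact: sqrt_continuous.
Qed.

Lemma measurable_oseen_kernel j k l :
  measurable_fun [set: R * 'rV[R]_d] (fun p => oseen_kernel p.1 j k l p.2).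
Proof.
under eq_fun do rewrite oseen_kernelE; apply: measurable_funM => //.
apply: (@measurable_Rintegral_param R _ _ _ _ lebd ( fun q : (R * 'rV[R]_d) * 'rV[R]_d =>
  ((j == k)%:R - q.2 ord0 j * q.2 ord0 k / dotp q.2 q.2) * q.2 ord0 l *
     expR (- (q.1.1 * dotp q.2 q.2)) * cos (dotp q.1.2 q.2 + pi / 2))).
have m1 : measurable_fun [set: (R * 'rV[R]_d) * 'rV[R]_d] (fun q => q.1.1).
  by apply: measurableT_comp.
have m2 : measurable_fun [set: (R * 'rV[R]_d) * 'rV[R]_d] (fun q => q.1.2).
  by apply: measurableT_comp.
have m3 : measurable_fun [set: (R * 'rV[R]_d) * 'rV[R]_d] (fun q => q.2) by exact: measurable_snd.
have mc i : measurable_fun [set: (R * 'rV[R]_d) * 'rV[R]_d] (fun q => q.2 ord0 i).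
  exact: (measurableT_comp (measurable_rV_coord i)).
have md : measurable_fun [set: (R * 'rV[R]_d) * 'rV[R]_d] (fun q => dotp q.2 q.2).
  exact: measurable_fun_dotp.
apply: measurable_funM; last first.
  by apply: measurable_fun_cos; apply: measurable_funD => //; exact: measurable_fun_dotp.
apply: measurable_funM; last first.
  by apply: measurableT_comp => //; apply: measurableT_comp => //; exact: measurable_funM.
apply: measurable_funM => //; apply: measurable_funB => //.
apply: measurable_funM; first exact: measurable_funM.
exact: measurable_fun_inv.
Qed.

Lemma measurable_heat_kernel :
  measurable_fun [set: R * 'rV[R]_d] (fun p => heat_kernel p.1 p.2).
Proof.
rewrite /heat_kernel; under eq_fun do rewrite enorm_sqr.
have m1 : measurable_fun [set: R * 'rV[R]_d] (fun q => q.1) by exact: measurable_fst.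
have m2 : measurable_fun [set: R * 'rV[R]_d] (fun q => q.2) by exact: measurable_snd.
apply: measurable_funM; first by apply: measurable_fun_powR; exact: measurable_funM.
apply: measurableT_comp => //; apply: measurableT_comp => //.
apply: measurable_funM; first exact: measurable_fun_dotp.
by apply: measurable_fun_inv; exact: measurable_funM.
Qed.

Lemma measurable_fun_oseen_kernel e (T : measurableType e) (f : T -> R) (g : T -> 'rV[R]_d) j k l :
  measurable_fun [set: T] f -> measurable_fun [set: T] g ->
  measurable_fun [set: T] (fun z => oseen_kernel (f z) j k l (g z)).
Proof.
move=> mf mg; have mfg : measurable_fun [set: T] (fun z => (f z, g z)) by apply/measurable_fun_pairP.
exact: (measurableT_comp (measurable_oseen_kernel j k l) mfg).
Qed.

Lemma measurable_fun_heat_kernel e (T : measurableType e) (f : T -> R) (g : T -> 'rV[R]_d) :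
  measurable_fun [set: T] f -> measurable_fun [set: T] g ->
  measurable_fun [set: T] (fun z => heat_kernel (f z) (g z)).
Proof.
move=> mf mg; have mfg : measurable_fun [set: T] (fun z => (f z, g z)) by apply/measurable_fun_pairP.
exact: (measurableT_comp measurable_heat_kernel mfg).
Qed.

(** The bound of the Oseen kernel at time t - s, up to its constant. *)
Definition duhamel_weight t x (p : R * 'rV[R]_d) : R :=
  (Num.sqrt (t - p.1))^-1 * majorant (Num.sqrt (t - p.1)) (x - p.2).

Lemma duhamel_weight_ge0 t x p : 0 <= duhamel_weight t x p.
Proof. by rewrite mulr_ge0 ?majorant_ge0// invr_ge0 sqrtr_ge0. Qed.

Lemma measurable_duhamel_weight t x :
  measurable_fun [set: R * 'rV[R]_d] (duhamel_weight t x).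
Proof.
have m1 : measurable_fun [set: R * 'rV[R]_d] (fun q => q.1) by exact: measurable_fst.
have m2 : measurable_fun [set: R * 'rV[R]_d] (fun q => q.2) by exact: measurable_snd.
have ms : measurable_fun [set: R * 'rV[R]_d] (fun q => Num.sqrt (t - q.1)).
  by apply: measurable_fun_sqrt; exact: measurable_funB.
apply: measurable_funM; first exact: measurable_fun_inv.
by apply: measurable_fun_majorant => //; apply: measurable_fun_subr => //; exact: measurable_cst.
Qed.

(* [g - g'] is the part of the spatial decay that is traded for decay in time. *)
Lemma duhamel_weight_power (g g' k mu : R) :
  0 <= g' <= g -> g < d%:R -> 0 <= k < 1 -> 0 <= mu -> 2^-1 + (g - g') / 2 + mu < 1 ->
  exists2 C : R, 0 <= C & forall t x, 0 < t -> (g' = 0 \/ 0 < norm1 x) ->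
  (\int[leb]_(s in `]0%R, t[) \int[lebd]_y
     (duhamel_weight t x (s, y) * (s `^ (- k) * (t - s) `^ (- mu) * norm1 y `^ (- g)))%:E
   <= (C * (norm1 x `^ (- g') * t `^ (2^-1 - (g - g') / 2 - k - mu)))%:E)%E.
Proof.
move=> /andP[g'0 g'g] gd /andP[k0 k1] mu0 p1.
have g0 : 0 <= g by exact: le_trans g'g.
have [C C0 hC] := @integral_majorant_powR g (introT andP (conj g0 gd)).
(* Total singularity at s = t: with r = sqrt(t-s), the kernel gives r^-1, the traded decay
   r^-(g-g'), and the third term is the extra factor (t-s)^-mu. *)
pose p := 2^-1 + (g - g') / 2 + mu.
have p0 : 0 <= p by rewrite /p !addr_ge0// divr_ge0// subr_ge0.
pose B := 2 * (2 `^ p / (1 - k) + 2 `^ k / (1 - p)).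
have B0 : 0 <= B by rewrite mulr_ge0// addr_ge0// divr_ge0 ?powR_ge0// subr_ge0 ltW.
exists (C * B); first by rewrite mulr_ge0.
move=> t x t0 hx; set X := norm1 x `^ (- g').
have X0 : 0 <= X by exact: powR_ge0.
apply: (@le_trans _ _ (\int[leb]_(s in `]0%R, t[) (C * X * ((t - s) `^ (- p) * s `^ (- k)))%:E)%E); last first.
  under eq_integral do rewrite EFinM.
  rewrite ge0_integralZl//; last 3 first.
  - apply/measurable_EFinP; apply: measurable_funTS; apply: measurable_funM.
      by apply: measurable_fun_powR; exact: measurable_funB.
    exact: measurable_fun_powR.
  - by move=> s _; rewrite lee_fin mulr_ge0 ?powR_ge0.
  - by rewrite lee_fin mulr_ge0.
  apply: (@le_trans _ _ ((C * X)%:E * (B * t `^ (1 - p - k))%:E)%E).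
    by apply: lee_wpmul2l; rewrite ?lee_fin ?mulr_ge0// integral_beta_le ?p0 ?k0.
  rewrite -EFinM lee_fin (_ : 2^-1 - (g - g') / 2 - k - mu = 1 - p - k); last by rewrite /p; lra.
  by rewrite le_eqVlt; apply/orP; left; apply/eqP; ring.
have mw := measurable_duhamel_weight t x.
have m1 : measurable_fun [set: R * 'rV[R]_d] (fun q => q.1) by exact: measurable_fst.
have m2 : measurable_fun [set: R * 'rV[R]_d] (fun q => q.2) by exact: measurable_snd.
pose f q := duhamel_weight t x q * (q.1 `^ (- k) * (t - q.1) `^ (- mu) * norm1 q.2 `^ (- g)).
have mf : measurable_fun [set: R * 'rV[R]_d] (fun q => (f q)%:E).
  apply/measurable_EFinP; apply: measurable_funM => //; apply: measurable_funM.
    apply: measurable_funM; apply: measurable_fun_powR => //.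
    exact: measurable_funB.
  by apply: measurable_fun_powR; exact: measurable_fun_norm1.
have f0 q : (0 <= (f q)%:E)%E.
  by rewrite lee_fin /f !mulr_ge0 ?duhamel_weight_ge0 ?powR_ge0.
apply: ge0_le_integral => //.
- by move=> s _; apply: integral_ge0 => y _; exact: (f0 (s, y)).
- apply: measurable_funTS.
  exact: (@measurable_fun_fubini_tonelli_F _ _ _ _ R lebd (fun q => (f q)%:E) mf f0).
- apply/measurable_EFinP; apply: measurable_funTS; apply: measurable_funM => //.
  apply: measurable_funM; apply: measurable_fun_powR => //.
  exact: measurable_funB.
move=> s; rewrite /= in_itv/= => /andP[s0 st].
have ts0 : 0 < t - s by rewrite subr_gt0.
set r := Num.sqrt (t - s); have r0 : 0 < r by rewrite sqrtr_gt0.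
pose c := r^-1 * (s `^ (- k) * (t - s) `^ (- mu)).
have c0 : 0 <= c by rewrite !mulr_ge0 ?powR_ge0 ?invr_ge0 ?(ltW r0).
under eq_integral => y _.
  rewrite /duhamel_weight /= -/r (_ : _ * _ * _ = c * (majorant r (x - y) * norm1 y `^ (- g))).
    rewrite EFinM; over.
  by rewrite /c; ring.
rewrite /= ge0_integralZl//; last 2 first.
- apply/measurable_EFinP; apply: measurable_funM.
    by apply: measurable_fun_majorant => //; apply: measurable_fun_subr => //; exact: measurable_cst.
  by apply: measurable_fun_powR; exact: measurable_fun_norm1.
- by move=> y _; rewrite lee_fin mulr_ge0 ?majorant_ge0 ?powR_ge0.
apply: (@le_trans _ _ (c%:E * (C * Num.max r (norm1 x) `^ (- g))%:E)%E).
  by apply: lee_wpmul2l; rewrite ?lee_fin// hC.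
rewrite -EFinM lee_fin.
apply: (@le_trans _ _ (c * (C * (r `^ (- (g - g')) * X)))).
  rewrite ler_wpM2l// ler_wpM2l//; apply: max_powRN; rewrite ?norm1_ge0 ?g'0//.
rewrite le_eqVlt; apply/orP; left; apply/eqP.
have -> : (t - s) `^ (- p) = r^-1 * r `^ (- (g - g')) * (t - s) `^ (- mu).
  rewrite /r -powR12_sqrt ?(ltW ts0)// -powRN -powRrM -!gt0_powRD//.
  by congr (_ `^ _); rewrite /p; lra.
by rewrite /c; ring.
Qed.

Lemma ge0_integral_setXT (A : set R) (f : R * 'rV[R]_d -> \bar R) : measurable A ->
  measurable_fun (A `*` [set: 'rV[R]_d]) f -> (forall p, (A `*` setT) p -> 0 <= f p)%E ->
  (\int[(leb \x lebd)%E]_(p in A `*` setT) f p = \int[leb]_(s in A) \int[lebd]_y f (s, y))%E.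
Proof.
move=> mA mf f0; have mD : measurable (A `*` [set: 'rV[R]_d]) by exact: measurableX.
rewrite integral_mkcond fubini_tonelli1; last 2 first.
- exact/(measurable_restrictT _ _).1.
- by move=> p; rewrite patchE; case: ifPn => // /set_mem; exact: f0.
rewrite [RHS]integral_mkcond; apply: eq_integral => s _.
rewrite patchE /fubini_F; case: ifPn => [/set_mem|/negP] sA.
  apply: eq_integral => y _; rewrite patchE mem_set//.
rewrite integral0_eq// => y _; rewrite patchE; case: ifPn => // /set_mem[/= h _].
by case: sA; rewrite inE.
Qed.

Lemma duhamel_bound : exists2 A : R, 0 <= A & forall t x (F Phi : R * 'rV[R]_d -> R) c,
  measurable_fun (`]0, t[ `*` [set: 'rV[R]_d]) F -> measurable_fun [set: R * 'rV[R]_d] Phi ->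
  (forall s y, 0 < s < t -> 0 < norm1 y -> `|F (s, y)| <= Phi (s, y)) ->
  (forall p, 0 <= Phi p) ->
  (\int[leb]_(s in `]0%R, t[) \int[lebd]_y (duhamel_weight t x (s, y) * Phi (s, y))%:E <= c%:E)%E ->
  forall j k l,
  (leb \x lebd)%E.-integrable (`]0, t[ `*` setT)
    (EFin \o (fun p => oseen_kernel (t - p.1) j k l (x - p.2) * F p)) /\
  `|\int[(leb \x lebd)%E]_(p in `]0, t[ `*` setT) (oseen_kernel (t - p.1) j k l (x - p.2) * F p)| <= A * c.
Proof.
have [A A0 hA] := @oseen_kernel_le_majorant R d; exists A => // t x F Phi c mF mPhi FPhi Phi0 hc j k l.
have m1 : measurable_fun [set: R * 'rV[R]_d] (fun q => q.1) by exact: measurable_fst.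
have m2 : measurable_fun [set: R * 'rV[R]_d] (fun q => q.2) by exact: measurable_snd.
have mD : measurable (`]0, t[ `*` [set: 'rV[R]_d]) by exact: measurableX.
have mK : measurable_fun [set: R * 'rV[R]_d] (fun p => oseen_kernel (t - p.1) j k l (x - p.2)).
  apply: measurable_fun_oseen_kernel; first exact: measurable_funB.
  by apply: measurable_fun_subr => //; exact: measurable_cst.
have mKF : measurable_fun (`]0, t[ `*` [set: 'rV[R]_d])
    (fun p => oseen_kernel (t - p.1) j k l (x - p.2) * F p).
  by apply: measurable_funM => //; exact: measurable_funTS.
have mwP : measurable_fun [set: R * 'rV[R]_d] (fun p => duhamel_weight t x p * Phi p).
  by apply: measurable_funM => //; exact: measurable_duhamel_weight.
suff H : (\int[(leb \x lebd)%E]_(p in `]0%R, t[ `*` setT)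
    `|oseen_kernel (t - p.1) j k l (x - p.2) * F p|%:E <= (A * c)%:E)%E.
  by split; [exact: le_integrable_bound H|exact: normr_Rintegral_le].
have mabs : measurable_fun (`]0, t[ `*` [set: 'rV[R]_d]) (fun p => `|oseen_kernel (t - p.1) j k l (x - p.2) * F p|%:E).
  by apply/measurable_EFinP; apply: measurableT_comp.
rewrite EFinM; apply: (@le_trans _ _ (A%:E * \int[leb]_(s in `]0%R, t[) \int[lebd]_y (duhamel_weight t x (s, y) * Phi (s, y))%:E)%E); last first.
  by apply: lee_wpmul2l => //; rewrite lee_fin.
have wP0 p : 0 <= duhamel_weight t x p * Phi p by rewrite mulr_ge0// duhamel_weight_ge0.
rewrite -(@ge0_integral_setXT `]0, t[%classic (fun p => (duhamel_weight t x p * Phi p)%:E))//; last 2 first.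
- by apply: measurable_funTS; apply/measurable_EFinP.
- by move=> p _; rewrite lee_fin.
rewrite -ge0_integralZl//; last 2 first.
- by apply: measurable_funTS; apply/measurable_EFinP.
- by move=> p _; rewrite lee_fin.
apply: ae_ge0_le_integral => //.
- by move=> p _; rewrite -EFinM lee_fin mulr_ge0.
- by apply: measurable_funTS; apply/measurable_EFinP; exact: measurable_funM.
(* The bound on F is known for y nonzero only; the exceptional set is contained in the product of
   the time line with the null set of the hyperplanes. *)
have [N [mN N0 hN]] := ae_coord_neq0 (R := R) d.
exists (setT `*` N); split.
- exact: measurableX.
- apply: (eq_trans (@product_measure1E _ _ _ _ _ leb lebd _ _ measurableT mN)).
  by rewrite N0 mule0.
- move=> [s y] /= hp; split => //; apply: hN => /= hy; apply: hp => -[].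
  rewrite /= in_itv/= => /andP[s0 st] _.
  have ts0 : 0 < t - s by rewrite subr_gt0.
  have y0 : 0 < norm1 y.
    by apply: lt_le_trans (norm1_coord y (Ordinal d_gt0)); rewrite normr_gt0.
  rewrite -EFinM lee_fin normrM mulrA; apply: ler_pM => //.
    exact: hA.
  by apply: FPhi; rewrite ?s0.
Qed.

Lemma heat_bound (g : R) : 0 <= g < d%:R -> exists2 C : R, 0 <= C &
  forall M (f : 'rV[R]_d -> R), 0 <= M -> measurable_fun [set: 'rV[R]_d] f ->
  {ae lebd, forall y, `|f y| <= M * norm1 y `^ (- g)} ->
  forall t x, 0 < t ->
  `|\int[lebd]_y (heat_kernel t (x - y) * f y)| <= C * M * Num.max (Num.sqrt t) (norm1 x) `^ (- g).
Proof.
move=> gd; have [A A0 hA] := @heat_kernel_le_majorant R d.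
have [C C0 hC] := integral_majorant_powR gd.
exists (A * C); first by rewrite mulr_ge0.
move=> M f M0 mf hf t x t0; have r0 : 0 < Num.sqrt t by rewrite sqrtr_gt0.
have mx : measurable_fun [set: 'rV[R]_d] (fun y => x - y).
  by apply: measurable_fun_subr => //; exact: measurable_cst.
have mN : measurable_fun [set: 'rV[R]_d] (fun y => majorant (Num.sqrt t) (x - y) * norm1 y `^ (- g)).
  apply: measurable_funM; first by apply: measurable_fun_majorant.
  by apply: measurable_fun_powR; exact: measurable_fun_norm1.
have mk : measurable_fun [set: 'rV[R]_d] (fun y => heat_kernel t (x - y) * f y).
  by apply: measurable_funM => //; exact: measurable_fun_heat_kernel.
apply: normr_Rintegral_le => //.
apply: (@le_trans _ _ (\int[lebd]_y ((A * M)%:E * (majorant (Num.sqrt t) (x - y) * norm1 y `^ (- g))%:E))%E).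
  apply: ae_ge0_le_integral => //.
  - by apply/measurable_EFinP; exact: measurable_fun_norm.
  - by move=> y _; rewrite -EFinM lee_fin !mulr_ge0 ?majorant_ge0 ?powR_ge0.
  - by apply: emeasurable_funM => //; exact/measurable_EFinP.
  apply: filterS hf => y hy _; rewrite -EFinM lee_fin normrM.
  have /andP[k0 kA] := hA t (x - y) t0.
  by rewrite mulrACA ler_pM// ger0_norm.
rewrite ge0_integralZl//; last 3 first.
- exact/measurable_EFinP.
- by move=> y _; rewrite lee_fin mulr_ge0 ?majorant_ge0 ?powR_ge0.
- by rewrite lee_fin mulr_ge0.
apply: (@le_trans _ _ ((A * M)%:E * (C * Num.max (Num.sqrt t) (norm1 x) `^ (- g))%:E)%E).
  by apply: lee_wpmul2l; rewrite ?lee_fin ?mulr_ge0// hC.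
by rewrite -EFinM lee_fin le_eqVlt; apply/orP; left; apply/eqP; ring.
Qed.

Lemma enorm_le_norm1 x : enorm x <= norm1 x.
Proof.
rewrite -[leRHS]ger0_norm ?norm1_ge0// -sqrtr_sqr ler_sqrt ?sqr_ge0//.
rewrite /dotp /norm1 expr2 mulr_suml ler_sum// => i _.
rewrite -[leLHS]ger0_norm -?expr2 ?sqr_ge0// normrX expr2 ler_wpM2l//.
exact: norm1_coord.
Qed.

Lemma norm1_le_enorm x : norm1 x <= d%:R * enorm x.
Proof.
rewrite /norm1 -[X in X%:R]card_ord -sum1_card natr_sum mulr_suml ler_sum// => i _.
rewrite mul1r -sqrtr_sqr ler_sqrt ?dotp_ge0//.
by rewrite /dotp (bigD1 i)//= -expr2 lerDl sumr_ge0// => j _; rewrite -expr2 sqr_ge0.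
Qed.

Definition velocity := R -> 'rV[R]_d -> 'rV[R]_d.

(** A single space-time integral with a free tensor F, so that differences of squares and spatial
    truncations are covered; [duhamel_heat_leray] returns to the iterated integral of the mild
    formulation. *)
Definition duhamel (F : 'I_d -> 'I_d -> R * 'rV[R]_d -> R) t x : 'rV[R]_d :=
  \row_j \sum_(k < d) \sum_(l < d) \int[(leb \x lebd)%E]_(p in `]0, t[ `*` setT)
    (oseen_kernel (t - p.1) j k l (x - p.2) * F k l p).

Definition square (u : velocity) k l (p : R * 'rV[R]_d) : R := u p.1 p.2 ord0 k * u p.1 p.2 ord0 l.

Definition mild_map u0 (u : velocity) : velocity := fun t x => heat t u0 x - duhamel (square u) t x.

Definition measurable_velocity (u : velocity) := forall j,
  measurable_fun [set: R * 'rV[R]_d] (fun p => u p.1 p.2 ord0 j).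

Lemma measurable_square u k l : measurable_velocity u ->
  measurable_fun [set: R * 'rV[R]_d] (square u k l).
Proof. by move=> mu; apply: measurable_funM; exact: mu. Qed.

Lemma measurable_mild_map u0 u : measurable_fun [set: 'rV[R]_d] u0 ->
  measurable_velocity u -> measurable_velocity (mild_map u0 u).
Proof.
move=> mu0 mu j; rewrite /mild_map /heat /duhamel; under eq_fun do rewrite !mxE.
apply: measurable_funB.
  apply: (@measurable_Rintegral_param R _ _ _ _ lebd (fun q : (R * 'rV[R]_d) * 'rV[R]_d =>
    heat_kernel q.1.1 (q.1.2 - q.2) * u0 q.2 ord0 j)).
  apply: measurable_funM.
    apply: measurable_fun_heat_kernel; first exact: measurableT_comp.
    by apply: measurable_fun_subr; [exact: measurableT_comp|exact: measurable_snd].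
  apply: (measurableT_comp (measurable_rV_coord j)).
  by apply: (measurableT_comp mu0); exact: measurable_snd.
apply: measurable_sum => k; apply: measurable_sum => l.
(* The domain of integration depends on t. Moved into the integrand as a product of two indicators,
   it leaves a fixed domain and a jointly measurable function. *)
under eq_fun => p.
  rewrite Rintegral_mkcond.
  rewrite (_ : _ \_ _ = fun q : R * 'rV[R]_d => (0 < q.1)%R%:R * (q.1 < p.1)%R%:R *
     (oseen_kernel (p.1 - q.1) j k l (p.2 - q.2) * square u k l q)); first over.
  apply/funext => q; rewrite patchE; case: ifPn => [/set_mem[] | /negP].
    by rewrite /= in_itv/= => /andP[-> ->] _; rewrite !mul1r.
  rewrite inE => h; case: (ltP 0 q.1) => q0; last by rewrite !mul0r.
  case: (ltP q.1 p.1) => qp; last by rewrite mulr0 mul0r.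
  by exfalso; apply: h; split => //; rewrite /= in_itv/= q0 qp.
apply: (@measurable_Rintegral_sigma_finite _ _ _ _ _ (leb \x lebd)%E (fun q : (R * 'rV[R]_d) * (R * 'rV[R]_d) =>
  (0 < q.2.1)%R%:R * (q.2.1 < q.1.1)%R%:R *
     (oseen_kernel (q.1.1 - q.2.1) j k l (q.1.2 - q.2.2) * square u k l q.2)));
  first exact: product_measure1_sigma_finite.
have m11 : measurable_fun [set: (R * 'rV[R]_d) * (R * 'rV[R]_d)] (fun q => q.1.1).
  exact: measurableT_comp.
have m12 : measurable_fun [set: (R * 'rV[R]_d) * (R * 'rV[R]_d)] (fun q => q.1.2).
  exact: measurableT_comp.
have m21 : measurable_fun [set: (R * 'rV[R]_d) * (R * 'rV[R]_d)] (fun q => q.2.1).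
  exact: measurableT_comp.
have m22 : measurable_fun [set: (R * 'rV[R]_d) * (R * 'rV[R]_d)] (fun q => q.2.2).
  exact: measurableT_comp.
apply: measurable_funM; first by apply: measurable_funM; exact: measurable_fun_ltb.
apply: measurable_funM.
  by apply: measurable_fun_oseen_kernel; [exact: measurable_funB|exact: measurable_fun_subr].
by apply: (measurableT_comp (measurable_square k l mu)); exact: measurable_snd.
Qed.

Lemma norm1N x : norm1 (- x) = norm1 x.
Proof. by apply: eq_bigr => i _; rewrite mxE normrN. Qed.

Lemma ler_norm1B x y : norm1 (x - y) <= norm1 x + norm1 y.
Proof. by rewrite -(norm1N y) ler_norm1D. Qed.

Lemma norm1_duhamel : exists2 A : R, 0 < A & forall t x (F : 'I_d -> 'I_d -> R * 'rV[R]_d -> R) Phi c,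
  (forall k l, measurable_fun [set: R * 'rV[R]_d] (F k l)) -> measurable_fun [set: R * 'rV[R]_d] Phi ->
  (forall k l s y, 0 < s < t -> 0 < norm1 y -> `|F k l (s, y)| <= Phi (s, y)) ->
  (forall p, 0 <= Phi p) -> 0 <= c ->
  (\int[leb]_(s in `]0%R, t[) \int[lebd]_y (duhamel_weight t x (s, y) * Phi (s, y))%:E <= c%:E)%E ->
  (forall j k l,
  (leb \x lebd)%E.-integrable (`]0, t[ `*` setT)
    (EFin \o (fun p => oseen_kernel (t - p.1) j k l (x - p.2) * F k l p))) /\
  norm1 (duhamel F t x) <= A * c.
Proof.
have [A A0 hA] := duhamel_bound; exists (d%:R ^+ 3 * A + 1); first by rewrite ltr_wpDl// mulr_ge0.
move=> t x F Phi c mF mPhi FPhi Phi0 c0 hc.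
have H j k l := hA t x (F k l) Phi c (measurable_funTS (mF k l)) mPhi (FPhi k l) Phi0 hc j k l.
split; first by move=> j k l; exact: (H j k l).1.
have -> : (d%:R ^+ 3 * A + 1) * c = d%:R * (d%:R * (d%:R * (A * c))) + c by ring.
rewrite -[leLHS]addr0 lerD//.
have h3 j : `|duhamel F t x ord0 j| <= d%:R * (d%:R * (A * c)).
  rewrite mxE -[X in X%:R * (_ * _)]card_ord.
  apply: (@ler_norm_sum1 R 'I_d) => k.
  rewrite -[X in X%:R * (_ * _)]card_ord.
  by apply: (@ler_norm_sum1 R 'I_d) => l; have [_] := H j k l.
have h4 := @ler_sum R 'I_d (index_enum 'I_d) predT _ _ (fun j _ => h3 j).
apply: (@le_trans _ R _ _ _ h4).
by rewrite sumr_const card_ord -[leLHS]mulr_natl.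
Qed.

Lemma duhamelB t x F G :
  (forall j k l, (leb \x lebd)%E.-integrable (`]0, t[ `*` setT)
    (EFin \o (fun p => oseen_kernel (t - p.1) j k l (x - p.2) * F k l p))) ->
  (forall j k l, (leb \x lebd)%E.-integrable (`]0, t[ `*` setT)
    (EFin \o (fun p => oseen_kernel (t - p.1) j k l (x - p.2) * G k l p))) ->
  duhamel F t x - duhamel G t x = duhamel (fun k l p => F k l p - G k l p) t x.
Proof.
move=> iF iG; apply/rowP => j; rewrite !mxE -sumrB; apply: eq_bigr => k _.
rewrite -sumrB; apply: eq_bigr => l _.
have mD : measurable (`]0, t[ `*` [set: 'rV[R]_d]) by exact: measurableX.
rewrite -RintegralB//; first by apply: eq_Rintegral => p _; rewrite mulrBr.
Qed.

Definition duhamel_integrable (F : 'I_d -> 'I_d -> R * 'rV[R]_d -> R) t x :=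
  forall j k l, (leb \x lebd)%E.-integrable (`]0, t[ `*` setT)
    (EFin \o (fun p => oseen_kernel (t - p.1) j k l (x - p.2) * F k l p)).

(** Every later estimate of the Duhamel term is an instance of this one, for suitable exponents. *)
Lemma duhamel_power (g g' k mu : R) :
  0 <= g' <= g -> g < d%:R -> 0 <= k < 1 -> 0 <= mu -> 2^-1 + (g - g') / 2 + mu < 1 ->
  exists2 K : R, 0 <= K & forall t x (F : 'I_d -> 'I_d -> R * 'rV[R]_d -> R) (Q : R),
  0 < t -> g' = 0 \/ 0 < norm1 x -> (forall i j, measurable_fun [set: R * 'rV[R]_d] (F i j)) ->
  0 <= Q ->
  (forall i j s y, 0 < s < t -> 0 < norm1 y ->
    `|F i j (s, y)| <= Q * (s `^ (- k) * (t - s) `^ (- mu) * norm1 y `^ (- g))) ->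
  duhamel_integrable F t x /\
  norm1 (duhamel F t x) <= K * Q * (norm1 x `^ (- g') * t `^ (2^-1 - (g - g') / 2 - k - mu)).
Proof.
move=> gg' gd k01 mu0 p1.
have [A A0 hA] := norm1_duhamel; have [C C0 hC] := duhamel_weight_power gg' gd k01 mu0 p1.
exists (A * C); first by rewrite mulr_ge0// ltW.
move=> t x F Q t0 gx mF Q0 FQ.
pose w (p : R * 'rV[R]_d) := p.1 `^ (- k) * (t - p.1) `^ (- mu) * norm1 p.2 `^ (- g).
have mw : measurable_fun [set: R * 'rV[R]_d] w.
  have m1 : measurable_fun [set: R * 'rV[R]_d] (fun q => q.1) by exact: measurable_fst.
  apply: measurable_funM; last by apply/measurable_fun_powR/measurable_fun_norm1; exact: measurable_snd.
  by apply: measurable_funM; apply: measurable_fun_powR => //; exact: measurable_funB.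
have w0 p : 0 <= w p by rewrite !mulr_ge0 ?powR_ge0.
pose c := C * (norm1 x `^ (- g') * t `^ (2^-1 - (g - g') / 2 - k - mu)).
have c0 : 0 <= c by rewrite !mulr_ge0 ?powR_ge0.
have -> : A * C * Q * (norm1 x `^ (- g') * t `^ (2^-1 - (g - g') / 2 - k - mu)) = A * (Q * c).
  by rewrite /c; ring.
apply: (hA t x F (fun p => Q * w p) (Q * c)) => //.
- exact: measurable_funM.
- by move=> p; rewrite mulr_ge0.
- by rewrite mulr_ge0.
have mdw s : measurable_fun [set: 'rV[R]_d] (fun y => (duhamel_weight t x (s, y) * w (s, y))%:E).
  apply/measurable_EFinP; apply: measurable_funM.
    by apply: (measurableT_comp (measurable_duhamel_weight t x)); exact: measurable_pair1.
  by apply: (measurableT_comp mw); exact: measurable_pair1.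
have dw0 s y : 0 <= duhamel_weight t x (s, y) * w (s, y) by rewrite mulr_ge0 ?duhamel_weight_ge0.
rewrite (_ : (\int[leb]_(s in _) _)%E = (\int[leb]_(s in `]0%R, t[) (Q%:E * \int[lebd]_y (duhamel_weight t x (s, y) * w (s, y))%:E))%E); last first.
  apply: eq_integral => s _; rewrite -ge0_integralZl//.
    by apply: eq_integral => y _; rewrite -EFinM mulrCA.
  by move=> y _; rewrite lee_fin.
rewrite ge0_integralZl//.
- by rewrite EFinM lee_wpmul2l ?lee_fin// hC.
- apply: measurable_funTS.
  apply: (measurable_fun_fubini_tonelli_F (fun p => (duhamel_weight t x p * w p)%:E)) => //.
    by apply/measurable_EFinP; apply: measurable_funM => //; exact: measurable_duhamel_weight.
  by move=> p; rewrite lee_fin mulr_ge0 ?duhamel_weight_ge0.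
- by move=> s _; apply: integral_ge0 => y _; rewrite lee_fin.
Qed.

(** * Picard iteration *)

Section critical_bounds.
Variable (alpha : R).
Hypothesis alpha01 : 0 < alpha < 1.
Hypothesis d_gt1 : (1 < d)%N.

Lemma alpha1_ltd : 1 + alpha < d%:R.
Proof.
have /andP[_ a1] := alpha01; have : 2 <= d%:R :> R by rewrite ler_nat.
by lra.
Qed.

Definition subcritical_bound (eta : R) (v : velocity) := forall t x, 0 < t ->
  norm1 x `^ alpha * t `^ ((1 - alpha) / 2) * norm1 (v t x) <= eta.

Definition critical_bound (M : R) (v : velocity) := forall t x, 0 < t ->
  norm1 x * norm1 (v t x) <= M /\ Num.sqrt t * norm1 (v t x) <= M.

Lemma subcritical_boundE eta v t x : subcritical_bound eta v -> 0 < t -> 0 < norm1 x ->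
  norm1 (v t x) <= eta * (t `^ (- ((1 - alpha) / 2)) * norm1 x `^ (- alpha)).
Proof.
move=> hv t0 x0; rewrite !powRN -invfM ler_pdivlMr ?mulr_gt0 ?powR_gt0//.
by rewrite mulrC (mulrC (t `^ _)); exact: hv.
Qed.

Lemma critical_bound_space M v t x : critical_bound M v -> 0 < t -> 0 < norm1 x ->
  norm1 (v t x) <= M * norm1 x `^ (- 1).
Proof.
move=> hv t0 x0; rewrite powR_inv1 ?norm1_ge0// ler_pdivlMr// mulrC.
by have [] := hv t x t0.
Qed.

Lemma critical_bound_time M v t x : critical_bound M v -> 0 < t ->
  norm1 (v t x) <= M * t `^ (- 2^-1).
Proof.
move=> hv t0; rewrite powRN powR12_sqrt ?(ltW t0)// ler_pdivlMr ?sqrtr_gt0// mulrC.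
by have [] := hv t x t0.
Qed.

(** Exponents of a product of two subcritical factors. Of the order 2 alpha < d in space, alpha is
    traded for time: this leaves (t-s)^(-(1+alpha)/2), integrable as alpha < 1, and reproduces the
    time exponent -(1-alpha)/2. *)
Lemma duhamel_subcritical : exists2 K : R, 0 <= K &
  forall (F : 'I_d -> 'I_d -> R * 'rV[R]_d -> R) (Q : R),
  (forall i j, measurable_fun [set: R * 'rV[R]_d] (F i j)) -> 0 <= Q ->
  (forall i j s y, 0 < s -> 0 < norm1 y ->
    `|F i j (s, y)| <= Q * (s `^ (- (1 - alpha)) * norm1 y `^ (- (2 * alpha)))) ->
  subcritical_bound (K * Q) (duhamel F).
Proof.
have /andP[a0 a1] := alpha01; have := alpha1_ltd => ad.
have [|||||K K0 hK] := @duhamel_power (2 * alpha) alpha (1 - alpha) 0.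
- by apply/andP; split; lra.
- by lra.
- by apply/andP; split; lra.
- by [].
- by lra.
exists K => // F Q mF Q0 FQ t x t0.
have [x0|x0] := eqVneq (norm1 x) 0.
  by rewrite x0 powR0 ?gt_eqF// !mul0r mulr_ge0.
have {}x0 : 0 < norm1 x by rewrite lt_def x0 norm1_ge0.
have [|_] := hK t x F Q t0 (or_intror x0) mF Q0.
  move=> i j s y /andP[s0 st] y0; rewrite oppr0 powRr0 mulr1; exact: FQ.
rewrite (_ : _ - _ = - ((1 - alpha) / 2)); last by lra.
rewrite !powRN -invfM ler_pdivlMr ?mulr_gt0 ?powR_gt0// => h.
by rewrite mulrC.
Qed.

(** One subcritical factor, with the other bounded in space for the first estimate and in time for
    the second. These lead to N^-(1+alpha) s^(-(1-alpha)/2), traded down to N^-1, and to N^-alpha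
    s^-(1-alpha/2), traded down to a pure time power t^(-1/2). *)
Lemma duhamel_critical : exists2 K : R, 0 <= K &
  forall (F : 'I_d -> 'I_d -> R * 'rV[R]_d -> R) (Q : R),
  (forall i j, measurable_fun [set: R * 'rV[R]_d] (F i j)) -> 0 <= Q ->
  (forall i j s y, 0 < s -> 0 < norm1 y ->
    `|F i j (s, y)| <= Q * (s `^ (- ((1 - alpha) / 2)) * norm1 y `^ (- alpha)) * norm1 y `^ (- 1)) ->
  (forall i j s y, 0 < s -> 0 < norm1 y ->
    `|F i j (s, y)| <= Q * (s `^ (- ((1 - alpha) / 2)) * norm1 y `^ (- alpha)) * s `^ (- 2^-1)) ->
  (forall t x, 0 < t -> duhamel_integrable F t x) /\ critical_bound (K * Q) (duhamel F).
Proof.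
have /andP[a0 a1] := alpha01; have := alpha1_ltd => ad.
have [|||||K1 K10 hK1] := @duhamel_power (1 + alpha) 1 ((1 - alpha) / 2) 0.
- by apply/andP; split; lra.
- by [].
- by apply/andP; split; lra.
- by [].
- by lra.
have [|||||K2 K20 hK2] := @duhamel_power alpha 0 (1 - alpha / 2) 0.
- by apply/andP; split; lra.
- by lra.
- by apply/andP; split; lra.
- by [].
- by lra.
exists (K1 + K2); first by rewrite addr_ge0.
move=> F Q mF Q0 F1 F2.
(* With g' = 0 the estimate holds at every x, the origin included; integrability is taken from
   here. *)
have H2 t x : 0 < t -> duhamel_integrable F t x /\ norm1 (duhamel F t x) <= K2 * Q * t `^ (- 2^-1).
  move=> t0; have [|iF] := hK2 t x F Q t0 (or_introl erefl) mF Q0.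
    move=> i j s y /andP[s0 st] y0; apply: (le_trans (F2 i j s y s0 y0)).
    rewrite oppr0 powRr0 mulr1 -mulrA mulrAC -gt0_powRD//.
    by rewrite (_ : - _ + - _ = - (1 - alpha / 2))//; lra.
  rewrite !subr0 oppr0 powRr0 mul1r (_ : _ - _ = - 2^-1)//; last by lra.
split=> [t x t0|t x t0]; first exact: (H2 t x t0).1.
have KQ1 : K1 * Q <= (K1 + K2) * Q by rewrite ler_wpM2r// lerDl.
have KQ2 : K2 * Q <= (K1 + K2) * Q by rewrite ler_wpM2r// lerDr.
split; last first.
  apply: le_trans KQ2; have [_] := H2 t x t0.
  by rewrite powRN powR12_sqrt ?(ltW t0)// ler_pdivlMr ?sqrtr_gt0// mulrC.
apply: le_trans KQ1.
have [->|x0] := eqVneq (norm1 x) 0; first by rewrite mul0r mulr_ge0.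
have {}x0 : 0 < norm1 x by rewrite lt_def x0 norm1_ge0.
have [|_] := hK1 t x F Q t0 (or_intror x0) mF Q0.
  move=> i j s y /andP[s0 st] y0; apply: (le_trans (F1 i j s y s0 y0)).
  rewrite oppr0 powRr0 mulr1 -mulrA -mulrA -gt0_powRD//.
  by rewrite (_ : - _ + - _ = - (1 + alpha))//; lra.
rewrite (_ : _ - _ = 0); last by lra.
by rewrite powRr0 mulr1 powR_inv1 ?norm1_ge0// ler_pdivlMr// mulrC.
Qed.

(** z^(1/4) <= 1 + z <= e^z. The exponent 1/4 is small enough that, together with the kernel
    singularity (t-s)^(-1/2), the total (t-s)^(-3/4) remains integrable. *)
Lemma expRN_le_powR (z : R) : 0 < z -> expR (- z) <= z `^ (- 4^-1).
Proof.
move=> z0; rewrite powRN expRN lef_pV2 ?posrE ?expR_gt0 ?powR_gt0//.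
apply: le_trans (expR_ge1Dx z); have [z1|z1] := leP z 1.
  rewrite (@le_trans _ _ 1) ?lerDl ?(ltW z0)//.
  have : z `^ 4^-1 <= 1 `^ 4^-1 by rewrite ge0_ler_powR// ?nnegrE// ltW.
  by rewrite powR1.
rewrite (@le_trans _ _ z) ?lerDr//.
by rewrite -[leRHS]powRr1 ?(ltW z0)// ler_powR ?(ltW z1)//; lra.
Qed.

(** F is cut at the unit sphere: near the origin the singularity is the fixed power 1 + alpha,
    outside it the decay is N^-beta with an exponential in time. No spatial decay is traded; the
    outer part gains lam^(-1/4) from e^(-lam (t-s)). *)
Lemma duhamel_growth (beta : R) : 1 <= beta < d%:R -> exists2 K : R, 0 <= K &
  forall (F : 'I_d -> 'I_d -> R * 'rV[R]_d -> R) (Q1 Q2 lam : R) t x,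
  (forall i j, measurable_fun [set: R * 'rV[R]_d] (F i j)) ->
  0 <= Q1 -> 0 <= Q2 -> 0 < lam -> 0 < t -> 1 <= norm1 x -> duhamel_integrable F t x ->
  (forall i j s y, 0 < s < t -> 0 < norm1 y < 1 ->
    `|F i j (s, y)| <= Q1 * (s `^ (- ((1 - alpha) / 2)) * norm1 y `^ (- (1 + alpha)))) ->
  (forall i j s y, 0 < s < t -> 1 <= norm1 y ->
    `|F i j (s, y)| <= Q2 * (expR (lam * s) * norm1 y `^ (- beta))) ->
  norm1 x `^ beta * norm1 (duhamel F t x) <=
    K * (Q1 * t `^ (alpha / 2) + Q2 * expR (lam * t) * lam `^ (- 4^-1) * t `^ 4^-1).
Proof.
move=> /andP[b1 bd]; have /andP[a0 a1] := alpha01; have := alpha1_ltd => ad.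
(* For N(y) < 1, raising the exponent from 1 + alpha to g only weakens the bound on F, and g < d
   still holds; for N(x) >= 1 the result N(x)^-g is at most N(x)^-beta. *)
pose g := Num.max beta (1 + alpha).
have [|||||K1 K10 hK1] := @duhamel_power g g ((1 - alpha) / 2) 0.
- by rewrite lexx andbT le_max; apply/orP; left; lra.
- by rewrite gt_max bd.
- by apply/andP; split; lra.
- by [].
- by rewrite subrr; lra.
have [|||||K2 K20 hK2] := @duhamel_power beta beta 0 4^-1.
- by apply/andP; split; lra.
- by [].
- by apply/andP; split; lra.
- by lra.
- by rewrite subrr; lra.
exists (K1 + K2); first by rewrite addr_ge0.
move=> F Q1 Q2 lam t x mF Q10 Q20 lam0 t0 x1 iF FQ1 FQ2.
have x0 : 0 < norm1 x by apply: lt_le_trans x1.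
pose F1 i j (p : R * 'rV[R]_d) := (norm1 p.2 < 1)%R%:R * F i j p.
pose F2 i j (p : R * 'rV[R]_d) := F i j p - F1 i j p.
have mF1 i j : measurable_fun [set: R * 'rV[R]_d] (F1 i j).
  apply: measurable_funM => //; apply: measurable_fun_ltb => //.
  by apply: measurable_fun_norm1; exact: measurable_snd.
have mF2 i j : measurable_fun [set: R * 'rV[R]_d] (F2 i j) by exact: measurable_funB.
have [|iF1 hF1] := hK1 t x F1 Q1 t0 (or_intror x0) mF1 Q10.
  move=> i j s y st y0; rewrite oppr0 powRr0 mulr1 /F1 /=.
  have [y1|y1] := ltP; last by rewrite mul0r normr0 !mulr_ge0 ?powR_ge0.
  rewrite mul1r; apply: (le_trans (FQ1 _ _ _ _ st _)); first by rewrite y0.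
  rewrite !ler_wpM2l ?powR_ge0//.
  rewrite !powRN lef_pV2 ?posrE ?powR_gt0//.
  by rewrite ger_powR ?le_max ?lexx ?orbT// y0 ltW.
have [||iF2 hF2] := hK2 t x F2 (Q2 * expR (lam * t) * lam `^ (- 4^-1)) t0 (or_intror x0) mF2 _.
  by rewrite !mulr_ge0 ?powR_ge0 ?expR_ge0.
  move=> i j s y st y0; rewrite oppr0 powRr0 mul1r /F2 /F1 /=.
  have [y1|y1] := ltP; first by rewrite mul1r subrr normr0 !mulr_ge0 ?powR_ge0 ?expR_ge0.
  rewrite mul0r subr0; apply: (le_trans (FQ2 _ _ _ _ st y1)).
  rewrite mulrA [leRHS]mulrA ler_wpM2r ?powR_ge0// -!mulrA ler_wpM2l//.
  have /andP[s0 st'] := st.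
  rewrite -powRM ?(ltW lam0)// ?subr_ge0 ?(ltW st')//.
  apply: (@le_trans _ _ (expR (lam * t) * expR (- (lam * (t - s))))).
    by rewrite -expRD ler_expR; lra.
  by rewrite ler_wpM2l ?expR_ge0// expRN_le_powR// mulr_gt0// subr_gt0.
have <- : duhamel F1 t x + duhamel F2 t x = duhamel F t x.
  by rewrite -duhamelB// addrC subrK.
apply: (le_trans (ler_wpM2l (powR_ge0 _ _) (ler_norm1D _ _))); rewrite mulrDr.
have xb0 : 0 < norm1 x `^ beta by rewrite powR_gt0.
have h1 : norm1 x `^ beta * norm1 (duhamel F1 t x) <= K1 * (Q1 * t `^ (alpha / 2)).
  rewrite mulrC -ler_pdivlMr// -powRN; apply: (le_trans hF1).
  rewrite (_ : _ - 0 = alpha / 2); last by lra.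
  rewrite -!mulrA !ler_wpM2l// mulrC ler_wpM2l ?powR_ge0//.
  by rewrite ler_powR// lerN2 le_max lexx.
have h2 : norm1 x `^ beta * norm1 (duhamel F2 t x) <=
    K2 * (Q2 * expR (lam * t) * lam `^ (- 4^-1) * t `^ 4^-1).
  rewrite mulrC -ler_pdivlMr// -powRN; apply: (le_trans hF2).
  rewrite (_ : _ - _ = 4^-1); last by lra.
  by rewrite le_eqVlt; apply/orP; left; apply/eqP; ring.
apply: (le_trans (lerD h1 h2)); rewrite mulrDl lerD// ler_wpM2l//.
  by rewrite lerDl !mulr_ge0 ?powR_ge0 ?expR_ge0.
by rewrite lerDr mulr_ge0 ?powR_ge0.
Qed.

Lemma square_le u k l s y : `|square u k l (s, y)| <= norm1 (u s y) * norm1 (u s y).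
Proof. by rewrite normrM ler_pM// norm1_coord. Qed.

Lemma squareB_le u v k l s y : `|square u k l (s, y) - square v k l (s, y)| <=
  (norm1 (u s y) + norm1 (v s y)) * norm1 (u s y - v s y).
Proof.
have -> : square u k l (s, y) - square v k l (s, y) =
    u s y ord0 k * (u s y - v s y) ord0 l + (u s y - v s y) ord0 k * v s y ord0 l.
  by rewrite /square /= !mxE; ring.
apply: (le_trans (ler_normD _ _)); rewrite mulrDl !normrM lerD//; first by rewrite ler_pM ?norm1_coord.
by rewrite mulrC ler_pM ?norm1_coord.
Qed.

(** The critical bound of the Duhamel term is K2 eta M, linear in M, so smallness is asked of [eta]
    alone. In a difference of squares one factor is u or v, which carries the subcritical bound, and
    the other is u - v, for which a critical bound suffices. *)
Lemma mild_map_bounds : exists2 eta : R, 0 < eta & forall u0,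
  (forall u M, measurable_velocity u -> 0 <= M ->
    subcritical_bound eta u -> critical_bound M u ->
    forall t x, 0 < t -> duhamel_integrable (square u) t x) /\
  (forall u M, measurable_velocity u -> 0 <= M ->
    subcritical_bound (eta / 2) (fun t => heat t u0) -> critical_bound (M / 2) (fun t => heat t u0) ->
    subcritical_bound eta u -> critical_bound M u ->
    subcritical_bound eta (mild_map u0 u) /\ critical_bound M (mild_map u0 u)) /\
  (forall u v M D, measurable_velocity u -> measurable_velocity v -> 0 <= M -> 0 <= D ->
    subcritical_bound eta u -> critical_bound M u ->
    subcritical_bound eta v -> critical_bound M v ->
    critical_bound D (fun t x => u t x - v t x) ->
    critical_bound (D / 2) (fun t x => mild_map u0 u t x - mild_map u0 v t x)).
Proof.
have [K1 K10 hK1] := duhamel_subcritical; have [K2 K20 hK2] := duhamel_critical.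
have K0 : 0 < 4 * (K1 + K2 + 1) by rewrite mulr_gt0// ltr_wpDl// addr_ge0.
(* This makes K1 eta and K2 eta at most 1/4: invariance follows from 1/2 + 1/4 < 1, and contraction
   by 1/2 from the two terms of the difference of squares. *)
pose eta := (4 * (K1 + K2 + 1))^-1.
have eta0 : 0 < eta by rewrite invr_gt0.
have K1e : K1 * eta <= 4^-1 by rewrite ler_pdivrMr//; lra.
have K2e : K2 * eta <= 4^-1 by rewrite ler_pdivrMr//; lra.
exists eta => // u0.
have crit u M : measurable_velocity u -> 0 <= M -> subcritical_bound eta u -> critical_bound M u ->
    (forall t x, 0 < t -> duhamel_integrable (square u) t x) /\
    critical_bound (K2 * (eta * M)) (duhamel (square u)).
  move=> mu M0 hA hB; apply: hK2 => [k l||k l s y s0 y0|k l s y s0 y0].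
  - exact: measurable_square.
  - by rewrite mulr_ge0 ?(ltW eta0).
  - apply: (le_trans (square_le _ _ _ _ _)); have h := subcritical_boundE hA s0 y0.
    apply: (le_trans (ler_pM (norm1_ge0 _) (norm1_ge0 _) h (critical_bound_space hB s0 y0))).
    by rewrite mulrACA mulrA.
  - apply: (le_trans (square_le _ _ _ _ _)); have h := subcritical_boundE hA s0 y0.
    apply: (le_trans (ler_pM (norm1_ge0 _) (norm1_ge0 _) h (critical_bound_time y hB s0))).
    by rewrite mulrACA mulrA.
split=> [u M mu M0 hA hB|]; first exact: (crit u M mu M0 hA hB).1.
split=> [u M mu M0 HA HB hA hB|u v M D mu mv M0 D0 hAu hBu hAv hBv hD].
  have [_ hc] := crit u M mu M0 hA hB.
  have hs : subcritical_bound (K1 * (eta * eta)) (duhamel (square u)).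
    apply: hK1 => [k l||k l s y s0 y0].
    - exact: measurable_square.
    - by rewrite mulr_ge0 ?(ltW eta0).
    apply: (le_trans (square_le _ _ _ _ _)).
    have h := subcritical_boundE hA s0 y0.
    apply: (le_trans (ler_pM (norm1_ge0 _) (norm1_ge0 _) h h)).
    rewrite mulrACA ler_wpM2l ?mulr_ge0 ?(ltW eta0)// mulrACA -!gt0_powRD//.
    by rewrite -!opprD -splitr mulr_natl mulr2n.
  split=> t x t0.
    have h1 := HA t x t0; have h2 := hs t x t0.
    apply: (@le_trans _ _ (eta / 2 + K1 * (eta * eta))); last by rewrite mulrA; nra.
    apply: le_trans (lerD h1 h2); rewrite -mulrDr ler_wpM2l ?mulr_ge0 ?powR_ge0//.
    exact: ler_norm1B.
  have MM : M / 2 + K2 * (eta * M) <= M by rewrite mulrA; nra.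
  have [h1 h1'] := HB t x t0; have [h2 h2'] := hc t x t0.
  by split; apply: le_trans MM; [apply: le_trans (lerD h1 h2)|apply: le_trans (lerD h1' h2')];
    rewrite -mulrDr ler_wpM2l ?norm1_ge0 ?sqrtr_ge0// ler_norm1B.
have [iu _] := crit u M mu M0 hAu hBu; have [iv _] := crit v M mv M0 hAv hBv.
have [||||_ hc] := hK2 (fun k l p => square u k l p - square v k l p) (2 * eta * D).
- by move=> k l; apply: measurable_funB; exact: measurable_square.
- by rewrite !mulr_ge0 ?(ltW eta0).
- move=> k l s y s0 y0; apply: (le_trans (squareB_le _ _ _ _ _ _)).
  have h := lerD (subcritical_boundE hAu s0 y0) (subcritical_boundE hAv s0 y0).
  apply: (le_trans (ler_pM (addr_ge0 (norm1_ge0 _) (norm1_ge0 _)) (norm1_ge0 _) h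
    (critical_bound_space hD s0 y0))).
  by rewrite le_eqVlt; apply/orP; left; apply/eqP; ring.
- move=> k l s y s0 y0; apply: (le_trans (squareB_le _ _ _ _ _ _)).
  have h := lerD (subcritical_boundE hAu s0 y0) (subcritical_boundE hAv s0 y0).
  apply: (le_trans (ler_pM (addr_ge0 (norm1_ge0 _) (norm1_ge0 _)) (norm1_ge0 _) h
    (critical_bound_time y hD s0))).
  by rewrite le_eqVlt; apply/orP; left; apply/eqP; ring.
move=> t x t0.
have -> : mild_map u0 u t x - mild_map u0 v t x =
    - duhamel (fun k l p => square u k l p - square v k l p) t x.
  by rewrite -duhamelB; [rewrite /mild_map opprB opprB addrC addrA subrK|exact: iu|exact: iv].
rewrite norm1N; have [h1 h2] := hc t x t0.
have DD : K2 * (2 * eta * D) <= D / 2 by nra.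
by split; [apply: le_trans h1 DD|apply: le_trans h2 DD].
Qed.

Definition growth_bound (beta T A lam : R) (v : velocity) := forall t x, 0 < t < T ->
  norm1 x `^ beta * norm1 (v t x) <= A * expR (lam * t).

(** For N(x) > 1 the growth bound of u enters linearly, with factor K M (T/lam)^(1/4). A large lam
    brings this below 1/2, and the bound reproduces itself with the same A. *)
Lemma mild_map_growth (beta T eta M H : R) u0 : 1 <= beta < d%:R -> 0 < T -> 0 <= eta -> 0 <= M -> 0 <= H ->
  (forall t x, 0 < t -> norm1 x `^ beta * norm1 (heat t u0 x) <= H) ->
  exists2 A : R, 0 <= A & exists2 lam : R, 0 < lam & forall u, measurable_velocity u ->
  subcritical_bound eta u -> critical_bound M u ->
  (forall t x, 0 < t -> duhamel_integrable (square u) t x) ->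
  critical_bound M (mild_map u0 u) ->
  growth_bound beta T A lam u -> growth_bound beta T A lam (mild_map u0 u).
Proof.
move=> b1d T0 eta0 M0 H0 hH; have [K K0 hK] := duhamel_growth b1d.
have /andP[b1 bd] := b1d; have /andP[a0 a1] := alpha01.
(* Chosen so that lam = c^4 gives lam^(-1/4) = 1/c and K M T^(1/4) / c <= 1/2; the added 1 keeps c
   positive. *)
pose c := 2 * K * M * T `^ 4^-1 + 1.
have c0 : 0 < c by rewrite ltr_wpDl// !mulr_ge0 ?powR_ge0.
pose lam := c ^+ 4; have lam0 : 0 < lam by rewrite exprn_gt0.
have lamE : lam `^ (- 4^-1) = c^-1.
  rewrite powRN /lam -powR_mulrn ?(ltW c0)// -powRrM mulfV ?powRr1 ?(ltW c0)//.
(* M covers the unit ball. The other terms are doubled because the feedback of the growth bound uses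
   up half of A e^(lam t). *)
pose A := M + 2 * (H + K * (eta * M * T `^ (alpha / 2))).
have HK0 : 0 <= H + K * (eta * M * T `^ (alpha / 2)) by rewrite addr_ge0 ?mulr_ge0 ?powR_ge0.
have A0 : 0 <= A by rewrite addr_ge0 ?mulr_ge0.
exists A => //; exists lam => // u mu hA hB iu hB' hC t x /andP[t0 tT].
have e1 : 1 <= expR (lam * t) by rewrite -expR0 ler_expR mulr_ge0 ?(ltW lam0) ?(ltW t0).
(* In the unit ball N^beta <= N because beta >= 1, so the critical bound of the image suffices. *)
have [x1|x1] := leP (norm1 x) 1.
  apply: (@le_trans _ _ M); last by rewrite /A; nra.
  apply: le_trans (hB' t x t0).1.
  have [->|x0] := eqVneq (norm1 x) 0; first by rewrite powR0 ?mul0r//; apply/eqP; lra.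
  by rewrite ler_wpM2r ?norm1_ge0// ge1r_powR// lt_def x0 norm1_ge0.
have := @hK (square u) (eta * M) (M * A) lam t x.
move=> /(_ _ _ _ lam0 t0 (ltW x1) (iu t x t0)) hK'.
have hd : norm1 x `^ beta * norm1 (duhamel (square u) t x) <=
  K * (eta * M * t `^ (alpha / 2) + M * A * expR (lam * t) * lam `^ (- 4^-1) * t `^ 4^-1).
  apply: hK'.
  - by move=> i j; exact: measurable_square.
  - exact: mulr_ge0.
  - exact: mulr_ge0.
  - move=> k l s y /andP[s0 st] /andP[y0 y1]; apply: (le_trans (square_le _ _ _ _ _)).
    have h := subcritical_boundE hA s0 y0.
    apply: (le_trans (ler_pM (norm1_ge0 _) (norm1_ge0 _) h (critical_bound_space hB s0 y0))).
    rewrite (_ : - (1 + alpha) = - alpha + - 1); last by lra.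
    by rewrite gt0_powRD// mulrACA !mulrA.
  move=> k l s y /andP[s0 st] y1; apply: (le_trans (square_le _ _ _ _ _)).
  have y0 : 0 < norm1 y by apply: lt_le_trans y1.
  rewrite -mulrA ler_pM ?norm1_ge0//.
    apply: (le_trans (critical_bound_space hB s0 y0)).
    by rewrite powR_inv1 ?norm1_ge0// ler_piMr// invf_le1.
  rewrite mulrA powRN ler_pdivlMr ?powR_gt0// mulrC; apply: hC.
  by rewrite s0 (lt_trans st).
apply: (@le_trans _ _ (H + K * (eta * M * t `^ (alpha / 2) + M * A * expR (lam * t) * lam `^ (- 4^-1) * t `^ 4^-1))).
  apply: le_trans (lerD (hH t x t0) hd).
  by rewrite -mulrDr ler_wpM2l ?powR_ge0// ler_norm1B.
have h1 : t `^ (alpha / 2) <= T `^ (alpha / 2).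
  by rewrite ge0_ler_powR ?nnegrE ?(ltW t0) ?(ltW T0) ?(ltW tT)//; lra.
have h2 : t `^ 4^-1 <= T `^ 4^-1.
  by rewrite ge0_ler_powR ?nnegrE ?(ltW t0) ?(ltW T0) ?(ltW tT)//.
have h3 : K * M * c^-1 * t `^ 4^-1 <= 2^-1.
  rewrite mulrAC ler_pdivrMr//; apply: (@le_trans _ _ (K * M * T `^ 4^-1)).
    by rewrite ler_wpM2l ?mulr_ge0.
  by rewrite /c; lra.
rewrite lamE mulrDr addrA.
have h4 : K * (M * A * expR (lam * t) / c * t `^ 4^-1) <= 2^-1 * (A * expR (lam * t)).
  rewrite (_ : K * _ = K * M / c * t `^ 4^-1 * (A * expR (lam * t))); last by ring.
  by rewrite ler_wpM2r// mulr_ge0 ?expR_ge0.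
have h5 : K * (eta * M * t `^ (alpha / 2)) <= K * (eta * M * T `^ (alpha / 2)).
  by rewrite !ler_wpM2l ?mulr_ge0.
have h6 : A <= A * expR (lam * t) by rewrite ler_peMr.
rewrite /A in h6 h4 *; lra.
Qed.

Lemma norm1_lim_le (w c : R) (z : nat -> 'rV[R]_d) (z0 : 'rV[R]_d) :
  (forall j, z n ord0 j @[n --> \oo] --> z0 ord0 j) ->
  (\forall n \near \oo, w * norm1 (z n) <= c) -> w * norm1 z0 <= c.
Proof.
move=> hz hc; apply: cvgr_to_le hc; apply: cvgMr.
rewrite /norm1; elim: (index_enum _) => [|j s IHs].
  by rewrite big_nil; under eq_fun do rewrite big_nil; exact: cvg_cst.
rewrite big_cons; under eq_fun do rewrite big_cons.
by apply: cvgD => //; apply: cvg_norm; exact: hz.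
Qed.

Lemma velocity_limit (u_ : nat -> velocity) (M : R) : 0 <= M ->
  (forall n, measurable_velocity (u_ n)) ->
  (forall n, critical_bound (M * 2^-1 ^+ n) (fun t x => u_ n.+1 t x - u_ n t x)) ->
  exists u : velocity, [/\ measurable_velocity u,
    (forall t x j, 0 < t -> u_ n t x ord0 j @[n --> \oo] --> u t x ord0 j) &
    forall n, critical_bound (2 * M * 2^-1 ^+ n) (fun t x => u t x - u_ n t x)].
Proof.
move=> M0 mu hu.
have cvgu t x j : 0 < t -> cvgn (fun n => u_ n t x ord0 j).
  move=> t0; pose a n := u_ n t x ord0 j.
  rewrite (_ : (fun n => _) = (fun n => a 0%N + series (telescope a) n)); last first.
    by apply/funext => n; rewrite -eq_sum_telescope.
  apply: is_cvgD; first exact: is_cvg_cst.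
  apply: normed_cvg; apply: (@series_le_cvg _ _ (geometric (M * t `^ (- 2^-1)) 2^-1)).
  - by move=> n; exact: normr_ge0.
  - by move=> n; rewrite /geometric/= !mulr_ge0 ?powR_ge0.
  - move=> n; rewrite /geometric/= /telescope mulrAC.
    apply: le_trans (critical_bound_time x (hu n) t0).
    by have := norm1_coord (u_ n.+1 t x - u_ n t x) j; rewrite !mxE.
  by apply: is_cvg_geometric_series; rewrite ger0_norm//; lra.
(* The bounds hold for t > 0 only; the value 0 elsewhere makes u a pointwise limit of measurable
   functions on all of space-time. *)
pose u t x : 'rV[R]_d := \row_j (if 0 < t then limn (fun n => u_ n t x ord0 j) else 0).
have limu t x j : 0 < t -> u_ n t x ord0 j @[n --> \oo] --> u t x ord0 j.
  by move=> t0; rewrite mxE t0; exact: cvgu.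
exists u; split => //.
  move=> j; apply: (@measurable_fun_cvg _ _ R setT (fun n (p : R * 'rV[R]_d) => (0 < p.1)%R%:R * u_ n p.1 p.2 ord0 j)
    (fun p => u p.1 p.2 ord0 j)).
    move=> n; apply: measurable_funM => //; last exact: mu.
    by apply: measurable_fun_ltb => //; exact: measurable_fst.
  move=> [t x] _ /=; have [t0|t0] := ltP 0 t.
    by under eq_fun do rewrite mul1r; exact: limu.
  by rewrite mxE ltNge t0/=; under eq_fun do rewrite mul0r; exact: cvg_cst.
(* 2 M 2^-n is the tail of the geometric series; keeping the subtracted remainder makes the
   induction on k close exactly. *)
have tele (w : R) t x : 0 <= w -> (forall n, w * norm1 (u_ n.+1 t x - u_ n t x) <= M * 2^-1 ^+ n) ->
    forall n k, w * norm1 (u_ (n + k)%N t x - u_ n t x) <= 2 * M * 2^-1 ^+ n - 2 * M * 2^-1 ^+ (n + k).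
  move=> w0 hw n; elim=> [|k IHk]; first by rewrite addn0 !subrr /norm1 big1 ?mulr0// => i _; rewrite mxE normr0.
  rewrite addnS -(subrK (u_ (n + k)%N t x) (u_ _.+1 t x)) -addrA.
  apply: (le_trans (ler_wpM2l w0 (ler_norm1D _ _))); rewrite mulrDr.
  apply: (le_trans (lerD (hw _) IHk)); rewrite exprS.
  by rewrite le_eqVlt; apply/orP; left; apply/eqP; field.
have lim (w : R) t x : 0 <= w -> 0 < t -> (forall n, w * norm1 (u_ n.+1 t x - u_ n t x) <= M * 2^-1 ^+ n) ->
    forall n, w * norm1 (u t x - u_ n t x) <= 2 * M * 2^-1 ^+ n.
  move=> w0 t0 hw n; apply: (@norm1_lim_le w _ (fun m => u_ m t x - u_ n t x)).
    move=> j; have -> : (u t x - u_ n t x) ord0 j = u t x ord0 j - u_ n t x ord0 j by rewrite !mxE.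
    under eq_fun do rewrite !mxE.
    by apply: cvgB; [exact: limu|exact: cvg_cst].
  near=> m; have nm : (n <= m)%N by near: m; exact: nbhs_infty_ge.
  rewrite -(subnKC nm); apply: (le_trans (tele w t x w0 hw n (m - n)%N)).
  by rewrite gerBl !mulr_ge0 ?exprn_ge0.
move=> n t x t0; split; apply: lim => //.
- exact: norm1_ge0.
- by move=> m; exact: (hu m t x t0).1.
- by move=> m; exact: (hu m t x t0).2.
Unshelve. all: end_near. Qed.

(** One solution serves every beta and T: the Picard sequence does not depend on them, and any bound
    uniform along it passes to the pointwise limit. *)
Lemma global_fixpoint : exists2 eta : R, 0 < eta & forall u0 M,
  measurable_fun [set: 'rV[R]_d] u0 -> 0 <= M ->
  subcritical_bound (eta / 2) (fun t => heat t u0) -> critical_bound (M / 2) (fun t => heat t u0) ->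
  exists u : velocity, [/\ measurable_velocity u, critical_bound M u,
    forall t x, 0 < t -> duhamel_integrable (square u) t x /\ u t x = mild_map u0 u t x &
    forall beta T H, 1 <= beta < d%:R -> 0 < T -> 0 <= H ->
      (forall t x, 0 < t -> norm1 x `^ beta * norm1 (heat t u0 x) <= H) ->
      exists A lam, growth_bound beta T A lam u].
Proof.
have [eta eta0 heta] := mild_map_bounds; exists eta => // u0 M mu0 M0 HA HB.
have [hI [hS hD]] := heta u0.
pose u_ n : velocity := iter n (mild_map u0) (fun=> fun=> 0).
have norm10 : norm1 (0 : 'rV[R]_d) = 0 by rewrite /norm1 big1// => i _; rewrite mxE normr0.
have inv n : [/\ measurable_velocity (u_ n), subcritical_bound eta (u_ n) & critical_bound M (u_ n)].
  elim: n => [|n [mn hA hB]].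
    split=> [j|t x t0|t x t0] /=; rewrite ?norm10 ?mulr0//; last by rewrite ltW.
  have [hA' hB'] := hS _ _ mn M0 HA HB hA hB.
  by split => //; exact: measurable_mild_map.
have mu n : measurable_velocity (u_ n) by have [] := inv n.
have diff n : critical_bound (M * 2^-1 ^+ n) (fun t x => u_ n.+1 t x - u_ n t x).
  elim: n => [|n IHn].
    have [_ _ hB] := inv 1%N; rewrite expr0 mulr1 => t x t0.
    by rewrite /= subr0; exact: hB.
  have [_ hA hB] := inv n; have [_ hA' hB'] := inv n.+1.
  have := hD _ _ _ _ (mu n.+1) (mu n) M0 _ hA' hB' hA hB IHn.
  by rewrite exprSr mulrA; apply; rewrite mulr_ge0 ?exprn_ge0.
have [u [muu limu hu]] := velocity_limit M0 mu diff.
have bnd w c t x : 0 < t -> (forall n, w * norm1 (u_ n t x) <= c) -> w * norm1 (u t x) <= c.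
  move=> t0 hw; apply: (@norm1_lim_le w c (fun n => u_ n t x)) => [j|]; first exact: limu.
  by near=> n; exact: hw.
have uA : subcritical_bound eta u.
  by move=> t x t0; apply: bnd => // n; have [_ h _] := inv n; exact: h.
have uB : critical_bound M u.
  by move=> t x t0; split; apply: bnd => // n; have [_ _ h] := inv n; have [] := h t x t0.
have uI t x : 0 < t -> duhamel_integrable (square u) t x by exact: (hI u M).
(* Both sides are compared with u_(n+1), the image of u_n: each is within M 2^-n of it in the weight
   sqrt t. This weight is positive at every x, so the equation also holds at the origin. *)
have uE t x : 0 < t -> u t x = mild_map u0 u t x.
  move=> t0; apply/eqP; rewrite -subr_eq0; apply/eqP/norm1_eq0/eqP.
  rewrite eq_le norm1_ge0 andbT.
  have st0 : 0 < Num.sqrt t by rewrite sqrtr_gt0.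
  rewrite -(pmulr_rle0 _ st0).
  have h n : Num.sqrt t * norm1 (u t x - mild_map u0 u t x) <= 2 * M * 2^-1 ^+ n.
    have [_ hA hB] := inv n.
    have D0 : 0 <= 2 * M * 2^-1 ^+ n by rewrite !mulr_ge0 ?exprn_ge0.
    have [_ h1] := hD _ _ _ _ muu (mu n) M0 D0 uA uB hA hB (hu n) t x t0.
    have [_ h2] := hu n.+1 t x t0.
    have eB (a b c : 'rV[R]_d) : a - b = (a - c) - (b - c) by rewrite opprB addrA subrK.
    rewrite (eB _ _ (u_ n.+1 t x)).
    apply: (le_trans (ler_wpM2l (ltW st0) (ler_norm1B _ _))); rewrite mulrDr.
    apply: (le_trans (lerD h2 h1)); rewrite exprS; set a := 2^-1 ^+ n.
    by rewrite le_eqVlt; apply/orP; left; apply/eqP; field.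
  apply: (@cvgr_to_ge _ \oo _ R (fun n => 2 * M * 2^-1 ^+ n)); last by near=> n; exact: h.
  rewrite -(mulr0 (2 * M)); apply: cvgMr; apply: cvg_expr; rewrite ger0_norm//; lra.
exists u; split => // [t x t0|beta T H b1d T0 H0 hH]; first by split; [exact: uI|exact: uE].
have [A A0 [lam lam0 hG]] := mild_map_growth b1d T0 (ltW eta0) M0 H0 hH.
exists A, lam => t x /andP[t0 tT]; apply: bnd => // n; move: t x t0 tT.
suff G : growth_bound beta T A lam (u_ n) by move=> t x t0 tT; apply: G; rewrite t0.
elim: n => [|n IHn].
  by move=> t x _; rewrite /= norm10 mulr0 mulr_ge0 ?expR_ge0.
have [mn hA hB] := inv n; have [_ _ hB'] := inv n.+1.
by apply: hG => //; exact: (hI _ M).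
Unshelve. all: end_near. Qed.

End critical_bounds.

(** * The initial datum and the return to the mild formulation *)

Lemma weighted_Linfty_ae (g : R) u0 : 0 <= g -> weighted_Linfty g u0 -> exists2 M : R, 0 <= M &
  {ae lebd, forall y, forall j, `|u0 y ord0 j| <= M * norm1 y `^ (- g)}.
Proof.
move=> g0 [mu /ess_supr_bounded[M hM]].
have dr0 : 0 < d%:R :> R by rewrite ltr0n.
exists (Num.max M 0 * d%:R `^ g); first by rewrite mulr_ge0 ?powR_ge0// le_max lexx orbT.
apply: filterS2 hM (@ae_coord_neq0 R d) => y hy ynz j.
have y0 : 0 < norm1 y.
  apply: lt_le_trans (norm1_coord y (Ordinal d_gt0)); by rewrite normr_gt0.
have ey0 : 0 < enorm y.
  by have := lt_le_trans y0 (norm1_le_enorm y); rewrite pmulr_rgt0.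
rewrite powRN ler_pdivlMr ?powR_gt0//.
have h1 : norm1 y `^ g <= d%:R `^ g * enorm y `^ g.
  by rewrite -powRM ?(ltW dr0) ?(ltW ey0)// ge0_ler_powR ?nnegrE ?norm1_ge0 ?mulr_ge0 ?(ltW ey0)// norm1_le_enorm.
apply: (@le_trans _ _ (enorm (u0 y) * (d%:R `^ g * enorm y `^ g))).
  rewrite ler_pM ?powR_ge0//.
  rewrite -sqrtr_sqr ler_sqrt ?dotp_ge0//.
  by rewrite /dotp (bigD1 j)//= -expr2 lerDl sumr_ge0// => i _; rewrite -expr2 sqr_ge0.
by rewrite mulrCA mulrC ler_wpM2r ?powR_ge0// mulrC (le_trans hy)// le_max lexx.
Qed.

(** The heat flow decays like max(sqrt t, N)^-g, which serves both weights at once; for g = 1 they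
    are the two halves of [critical_bound]. *)
Lemma heat_weighted (g : R) u0 : 0 <= g < d%:R -> weighted_Linfty g u0 -> exists2 H : R, 0 <= H &
  forall t x, 0 < t -> norm1 x `^ g * norm1 (heat t u0 x) <= H /\
    Num.sqrt t `^ g * norm1 (heat t u0 x) <= H.
Proof.
move=> gd hu; have /andP[g0 _] := gd; have [C C0 hC] := heat_bound gd.
have [M M0 hM] := weighted_Linfty_ae g0 hu; have [mu _] := hu.
have H0 : 0 <= d%:R * (C * M) by rewrite !mulr_ge0.
exists (d%:R * (C * M)) => // t x t0.
have st0 : 0 < Num.sqrt t by rewrite sqrtr_gt0.
have m0 : 0 < Num.max (Num.sqrt t) (norm1 x) by rewrite lt_max st0.
have hj j : `|heat t u0 x ord0 j| <= C * M * Num.max (Num.sqrt t) (norm1 x) `^ (- g).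
  rewrite mxE; apply: hC => //; first exact: (measurableT_comp (measurable_rV_coord j)).
  by apply: filterS hM => y hy; exact: hy.
have h : norm1 (heat t u0 x) <= d%:R * (C * M) * Num.max (Num.sqrt t) (norm1 x) `^ (- g).
  have h4 := @ler_sum R 'I_d (index_enum 'I_d) predT _ _ (fun j _ => hj j).
  apply: (@le_trans _ R _ _ _ h4).
  by rewrite sumr_const card_ord -[leLHS]mulr_natl [leLHS]mulrA.
have aux w : 0 <= w <= Num.max (Num.sqrt t) (norm1 x) -> w `^ g * norm1 (heat t u0 x) <= d%:R * (C * M).
  move=> /andP[w0 wm]; apply: (@le_trans _ _ (Num.max (Num.sqrt t) (norm1 x) `^ g * norm1 (heat t u0 x))).
    by rewrite ler_wpM2r ?norm1_ge0// ge0_ler_powR ?nnegrE// ltW.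
  by rewrite mulrC -ler_pdivlMr ?powR_gt0// -powRN.
by split; apply: aux; rewrite ?norm1_ge0 ?sqrtr_ge0 le_max lexx ?orbT.
Qed.

(** Fubini, with the finite sums over k and l moved inside the time integral; absolute integrability
    justifies both. *)
Lemma duhamel_heat_leray (u : velocity) t x : duhamel_integrable (square u) t x ->
  duhamel (square u) t x = \row_(j < d) \int[leb]_(tau in `]0, t[)
    heat_leray_div (t - tau) (tensor (u tau) (u tau)) x ord0 j.
Proof.
move=> iu; apply/rowP => j; rewrite !mxE.
have mD := @measurable_itv R `]0, t[.
pose G k l tau := \int[lebd]_y (oseen_kernel (t - tau) j k l (x - y) * square u k l (tau, y)).
have hkl k l := @Rintegral_setX _ _ _ _ _ leb lebd _ _ (measurable_itv _) (iu j k l).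
have hk k := @Rintegral_sum _ _ _ leb _ _ (index_enum 'I_d) (G k) mD (fun l => (hkl k l).1).
have [_ h] := @Rintegral_sum _ _ _ leb _ _ (index_enum 'I_d) (fun k tau => \sum_(l < d) G k l tau) mD
  (fun k => (hk k).1).
rewrite [RHS](_ : _ = \int[leb]_(tau in `]0, t[) \sum_(k < d) \sum_(l < d) G k l tau); last first.
  apply: eq_Rintegral => tau _; rewrite mxE; apply: eq_bigr => k _; apply: eq_bigr => l _.
  by apply: eq_Rintegral => y _; rewrite !mxE.
rewrite h; apply: eq_bigr => k _; rewrite (hk k).2; apply: eq_bigr => l _.
by rewrite -(hkl k l).2.
Qed.

End spatial_estimate.

Lemma space_time_sup_lty (R : realType) (d : nat) (T : \bar R) (f : R -> 'rV[R]_d -> R) (c : R) :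
  (forall t x, 0 < t -> (t%:E < T)%E -> f t x <= c) -> (space_time_sup T f < +oo)%E.
Proof.
move=> h; apply: (@le_lt_trans _ _ c%:E); last exact: ltry.
by apply/ereal_supP => _ [t [t0 tT] [x _ <-]]; rewrite lee_fin h.
Qed.

Theorem theorem3 (R : realType) (d : nat) (hd : (2 <= d)%N)
    (alpha : R) (halpha : 0 < alpha < 1) :
  exists2 delta : R, 0 < delta &
  forall (beta : R), 1 <= beta < d%:R ->
  forall u0 : 'rV[R]_d -> 'rV[R]_d,
  weighted_Linfty 1 u0 -> weighted_Linfty beta u0 ->
  divergence_free u0 ->
  (space_time_sup +oo
     (fun t x => enorm x `^ alpha * t `^ ((1 - alpha) / 2) *
                 enorm (heat t u0 x))%R
   <= delta%:E)%E ->
  exists u : R -> 'rV[R]_d -> 'rV[R]_d,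
  [/\ mild_solution +oo%E u0 u,
      (space_time_sup +oo
         (fun t x => (enorm x + Num.sqrt t) * enorm (u t x))%R < +oo)%E &
      forall T : R, 0 < T ->
        (space_time_sup T%:E
           (fun t x => enorm x `^ beta * enorm (u t x))%R < +oo)%E].
Proof.
have d_gt0 : (0 < d)%N by exact: ltnW.
have dr0 : 0 < d%:R :> R by rewrite ltr0n.
have dr1 : 1 <= d%:R :> R by rewrite ler1n.
have dr2 : 2 <= d%:R :> R by rewrite ler_nat.
have enorm_ge0 (z : 'rV[R]_d) : 0 <= enorm z by exact: sqrtr_ge0.
have [eta eta0 heta] := global_fixpoint d_gt0 halpha hd.
have /andP[a0 a1] := halpha.
(* The heat flow must stay below eta / 2 in the l^1 norm. Passing from the Euclidean norm costs
   d^alpha <= d for the weight and d for the velocity. *)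
exists (eta / (2 * d%:R ^+ 2)); first by rewrite divr_gt0 ?mulr_gt0 ?exprn_gt0.
move=> beta b1d u0 hu1 hub _ hdelta; have /andP[b1 bd] := b1d.
have [|H1 H10 hH1] := heat_weighted d_gt0 _ hu1; first by apply/andP; split; lra.
have [|H H0 hH] := heat_weighted d_gt0 _ hub; first by rewrite bd andbT (le_trans _ b1).
have hA : subcritical_bound alpha (eta / 2) (fun t => heat t u0).
  move=> t x t0; have : enorm x `^ alpha * t `^ ((1 - alpha) / 2) * enorm (heat t u0 x) <= eta / (2 * d%:R ^+ 2).
    rewrite -lee_fin; apply: le_trans hdelta; apply: ereal_sup_ubound.
    by exists t => //; [split => //; exact: ltry|exists x].
  rewrite invfM mulrA ler_pdivlMr ?exprn_gt0//; apply: le_trans.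
  rewrite expr2 [leRHS]mulrACA; apply: ler_pM.
  - by rewrite mulr_ge0 ?powR_ge0.
  - exact: norm1_ge0.
  - rewrite mulrAC ler_wpM2r ?powR_ge0// mulrC.
    apply: (@le_trans _ _ (d%:R `^ alpha * enorm x `^ alpha)).
      rewrite -powRM// ge0_ler_powR ?nnegrE ?norm1_ge0 ?mulr_ge0 ?norm1_le_enorm//; exact: ltW.
    by rewrite ler_wpM2r ?powR_ge0// ler1_powR// ltW.
  - by rewrite mulrC norm1_le_enorm.
have hB : critical_bound (2 * H1 / 2) (fun t => heat t u0).
  move=> t x t0; rewrite mulrAC divff// mul1r.
  by have [] := hH1 t x t0; rewrite !powRr1 ?norm1_ge0 ?sqrtr_ge0.
have [mu0 _] := hu1.
have [|u [mu uB uE uG]] := heta u0 (2 * H1) mu0 _ hA hB; first by rewrite mulr_ge0.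
exists u; split.
- split=> [|t x [t0 _]].
    apply: measurable_funTS; apply: measurable_fun_rV => j; exact: mu.
  have [iu ->] := uE t x t0; split; last by rewrite /mild_map -duhamel_heat_leray.
  move=> j k l; rewrite [X in _.-integrable _ X](_ : _ = EFin \o
      (fun p => oseen_kernel (t - p.1) j k l (x - p.2) * square u k l p)); first exact: iu.
  by apply/funext => p; rewrite /= mxE.
- apply: (@space_time_sup_lty _ _ _ _ (2 * H1 + 2 * H1)) => t x t0 _.
  have [h1 h2] := uB t x t0; rewrite mulrDl lerD//.
    by apply: le_trans h1; rewrite ler_pM ?enorm_le_norm1.
  by apply: le_trans h2; rewrite ler_wpM2l ?sqrtr_ge0 ?enorm_le_norm1.
move=> T T0; have [|A [lam hG]] := uG beta T H b1d T0 H0.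
  by move=> t x t0; have [] := hH t x t0.
(* A and lam come without a sign, so absolute values make the bound monotone in t up to T. *)
apply: (@space_time_sup_lty _ _ _ _ (`|A| * expR (`|lam| * T))) => t x t0 tT.
apply: (@le_trans _ _ (norm1 x `^ beta * norm1 (u t x))).
  rewrite ler_pM ?powR_ge0 ?enorm_le_norm1//.
  rewrite ge0_ler_powR ?nnegrE ?norm1_ge0 ?enorm_le_norm1//; lra.
apply: (@le_trans _ _ (A * expR (lam * t))); first by apply: hG; rewrite t0 -lte_fin.
apply: (@le_trans _ _ (`|A| * expR (lam * t))).
  by rewrite ler_wpM2r ?expR_ge0 ?ler_norm.
rewrite ler_wpM2l// ler_expR; apply: (@le_trans _ _ (`|lam| * t)).
  by rewrite ler_wpM2r ?ler_norm// ltW.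
by rewrite ler_wpM2l// ltW// -lte_fin.
Qed.
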